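(* Let $k,n\in\mathbb{N}$ and $i_1,\ldots,i_k\in\{1,\ldots,m\}$. Suppose that every $\psi_l(\tau)$ $(l=1,\ldots,k)$ is a continuous nonrandom function on $[t,T]$ and that $\{\phi_j(x)\}_{j=0}^{\infty}$ is a complete orthonormal system of continuous functions in the space $L_2([t,T])$. Let $$ J[\psi^{(k)}]_{T,t}=\int\limits_t^T\psi_k(t_k)\ldots\int\limits_t^{t_2}\psi_1(t_1)\,d{\bf f}_{t_1}^{(i_1)}\ldots d{\bf f}_{t_k}^{(i_k)} $$ and $$ J[\psi^{(k)}]_{T,t}^{p_1,\ldots,p_k}=\sum_{j_1=0}^{p_1}\ldots\sum_{j_k=0}^{p_k}C_{j_k\ldots j_1}\Biggl(\prod_{l=1}^k\zeta_{j_l}^{(i_l)}-\mathop{\rm l.i.m.}_{N\to\infty}\sum_{(l_1,\ldots,l_k)\in{\rm G}_k}\phi_{j_1}(\tau_{l_1})\Delta{\bf f}_{\tau_{l_1}}^{(i_1)}\ldots\phi_{j_k}(\tau_{l_k})\Delta{\bf f}_{\tau_{l_k}}^{(i_k)}\Biggr), $$ where $\zeta_j^{(i)}=\int_t^T\phi_j(s)\,d{\bf f}_s^{(i)}$. Then $$ {\sf M}\left\{\left(J[\psi^{(k)}]_{T,t}-J[\psi^{(k)}]_{T,t}^{p_1,\ldots,p_k}\right)^{2n}\right\}\le (k!)^n(2n-1)^{nk}\left(\ \int\limits_{[t,T]^k}K^2(t_1,\ldots,t_k)\,dt_1\ldots dt_k-\sum_{j_1=0}^{p_1}\ldots\sum_{j_k=0}^{p_k}C_{j_k\ldots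 j_1}^2\right)^n . $$ Consequently $J[\psi^{(k)}]_{T,t}^{p_1,\ldots,p_k}$ converges to $J[\psi^{(k)}]_{T,t}$ in the mean of degree $2n$ as $p_1,\ldots,p_k\to\infty$.
   Context: Setting: $(\Omega,{\rm F},{\sf P})$ is a complete probability space, $\{{\rm F}_\tau,\tau\in[0,T]\}$ is a nondecreasing right-continuous family of $\sigma$-algebras of ${\rm F}$, ${\bf f}_\tau$ is a standard $m$-dimensional Wiener process that is ${\rm F}_\tau$-measurable for every $\tau\in[0,T]$, with independent components ${\bf f}_\tau^{(i)}$, $i=1,\ldots,m$; $0\le t<T$. ${\sf M}$ is the expectation; l.i.m. denotes the limit in the mean-square sense. Kernel and Fourier coefficients: $K(t_1,\ldots,t_k)=\psi_1(t_1)\ldots\psi_k(t_k)$ if $t_1<\ldots<t_k$ and $0$ otherwise on $[t,T]^k$ ($k\ge 2$), $K(t_1)\equiv\psi_1(t_1)$ for $k=1$; $$C_{j_k\ldots j_1}=\int\limits_{[t,T]^k}K(t_1,\ldots,t_k)\prod_{l=1}^k\phi_{j_l}(t_l)\,dt_1\ldots dt_k .$$ Partition: for each $N$, $\{\tau_j\}_{j=0}^N$ is a partition $t=\tau_0<\ldots<\tau_N=T$ with $\max_{0\le j\le N-1}(\tau_{j+1}-\tau_j)\to 0$ as $N\to\infty$; $\Delta{\bf f}_{\tau_j}^{(i)}={\bf f}_{\tau_{j+1}}^{(i)}-{\bf f}_{\tau_j}^{(i)}$. Index sets: ${\rm H}_k=\{(l_1,\ldots,l_k): l_1,\ldots,l_k=0,1,\ldots,N-1\}$,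 ${\rm L}_k=\{(l_1,\ldots,l_k)\in{\rm H}_k: l_g\ne l_r\ (g\ne r);\ g,r=1,\ldots,k\}$, ${\rm G}_k={\rm H}_k\setminus{\rm L}_k$. *)

(* Defs.v *)
From HB Require Import structures.
From mathcomp Require Import all_boot all_order all_algebra.
From mathcomp Require Import all_classical all_reals all_analysis.

Set Implicit Arguments.
Unset Strict Implicit.
Unset Printing Implicit Defensive.
Import Order.TTheory GRing.Theory Num.Theory.
Import numFieldNormedType.Exports.

Local Open Scope classical_set_scope.
Local Open Scope ring_scope.

(* Lebesgue measure on R^k, by recursion on k:                                *)
(* lambda_(k.+1) is the image of lambda \x lambda_k under (x, v) |-> x :: v.  *)
Section lebesgue_step.
Context (R : realType) (k : nat)
  (mu : {sigma_finite_measure set (k.-tuple (measurableTypeR R)) -> \bar R}).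

Definition cons_pair (p : measurableTypeR R * k.-tuple (measurableTypeR R)) :
  k.+1.-tuple (measurableTypeR R) := [the k.+1.-tuple _ of p.1 :: p.2].

Lemma measurable_cons_pair : measurable_fun setT cons_pair.
Proof. exact: (measurable_cons measurable_fst measurable_snd). Qed.

Definition lebesgue_step : set (k.+1.-tuple (measurableTypeR R)) -> \bar R :=
  pushforward (@lebesgue_measure R \x mu)%E cons_pair.

Let step0 : lebesgue_step set0 = 0%E.
Proof. by rewrite /lebesgue_step /pushforward preimage_set0 measure0. Qed.

Let step_ge0 A : (0 <= lebesgue_step A)%E.
Proof. by rewrite /lebesgue_step /pushforward measure_ge0. Qed.

Let step_sigma_additive : semi_sigma_additive lebesgue_step.
Proof.
move=> A mA tA mUA; rewrite /lebesgue_step /pushforward preimage_bigcup.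
apply: measure_semi_sigma_additive.
- by move=> j; rewrite -[X in measurable X]setTI; exact: measurable_cons_pair.
- apply/trivIsetP => /= i j _ _ ij; rewrite -preimage_setI.
  by move/trivIsetP : tA => /(_ _ _ _ _ ij) ->//; rewrite preimage_set0.
- by rewrite -preimage_bigcup -[X in measurable X]setTI;
    exact: measurable_cons_pair.
Qed.

HB.instance Definition _ := isMeasure.Build _ _ _
  lebesgue_step step0 step_ge0 step_sigma_additive.

Let step_sigma_finite : sigma_finite setT lebesgue_step.
Proof.
have /sigma_finiteP[F [TF ndF Foo]] := sigma_finiteT (@lebesgue_measure R).
have /sigma_finiteP[G [TG ndG Goo]] := sigma_finiteT mu.
pose A j := F j `*` G j.
have TA : setT = \bigcup_j A j.
  rewrite -setXTT TF TG predeqE => -[x y]; split.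
    move=> [/= [j _ Fx] [l _ Gy]]; exists (maxn j l) => //; split.
    - by move: x Fx; exact/subsetPset/ndF/leq_maxl.
    - by move: y Gy; exact/subsetPset/ndG/leq_maxr.
  by move=> [j _ []/= ? ?]; split; exists j.
have Afin j : measurable (A j) /\ ((@lebesgue_measure R \x mu) (A j) < +oo)%E.
  have [? ?] := Foo j; have [? ?] := Goo j.
  split; first exact: measurableX.
  by rewrite product_measure1E// lte_mul_pinfty// ge0_fin_numE.
pose uncons (v : k.+1.-tuple (measurableTypeR R)) :
    measurableTypeR R * k.-tuple (measurableTypeR R) :=
  (tnth v ord0, [tuple of behead v]).
have unconsK : cancel cons_pair uncons.
  by move=> [x v]; congr pair; apply: val_inj.
have muncons : measurable_fun setT uncons.
  apply: measurable_fun_pair.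
    exact: measurable_tnth.
  exact: measurable_behead.
exists (fun j => uncons @^-1` A j).
  by rewrite -preimage_bigcup -TA preimage_setT.
move=> j; have [mA Aoo] := Afin j; split.
  by rewrite -[X in measurable X]setTI; exact: muncons.
rewrite /lebesgue_step /pushforward.
suff -> : cons_pair @^-1` (uncons @^-1` A j) = A j by [].
by apply/seteqP; split => p /=; rewrite unconsK.
Qed.

HB.instance Definition _ := @Measure_isSigmaFinite.Build _ _ _
  lebesgue_step step_sigma_finite.

End lebesgue_step.

Fixpoint lebesgue_tuple (R : realType) (k : nat) :
    {sigma_finite_measure set (k.-tuple (measurableTypeR R)) -> \bar R} :=
  match k with
  | 0 => \d_([tuple] : 0.-tuple (measurableTypeR R))
  | k'.+1 => lebesgue_step (lebesgue_tuple R k')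
  end.

Section fourier.
Context (R : realType) (t T : R).

Definition L2 (g : R -> R) : Prop :=
  measurable_fun `[t, T] g /\
  (\int[lebesgue_measure]_(x in `[t, T]) (g x ^+ 2)%:E < +oo)%E.

(* Completeness: the linear span of the system is dense in L2([t, T]). *)
Definition complete_orthonormal (phi : nat -> R -> R) : Prop :=
  [/\ forall j, L2 (phi j),
      forall j j' : nat,
        \int[lebesgue_measure]_(x in `[t, T]) (phi j x * phi j' x)
        = (j == j')%:R
    & forall g, L2 g -> forall e : R, 0 < e ->
        exists (q : nat) (c : nat -> R),
        (\int[lebesgue_measure]_(x in `[t, T])
           ((g x - \sum_(j < q) c j * phi j x) ^+ 2)%:E < e%:E)%E].

Definition cube (k : nat) : set (k.-tuple (measurableTypeR R)) :=
  [set x | forall l : 'I_k, t <= tnth x l <= T].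

Definition kernel (k : nat) (psi : 'I_k -> R -> R)
    (x : k.-tuple (measurableTypeR R)) : R :=
  if [forall l : 'I_k, forall l' : 'I_k,
        (l < l')%N ==> (tnth x l < tnth x l')]
  then \prod_(l < k) psi l (tnth x l) else 0.

(* The multi-index j stands for (j_1, ..., j_k). *)
Definition fourier_coef (k : nat) (psi : 'I_k -> R -> R) (phi : nat -> R -> R)
    (j : 'I_k -> nat) : R :=
  \int[lebesgue_tuple R k]_(x in @cube k)
    (kernel psi x * \prod_(l < k) phi (j l) (tnth x l)).

Definition partition_of (a b : R) (q : nat) (s : nat -> R) : Prop :=
  [/\ s 0%N = a, s q = b & forall j, (j < q)%N -> s j < s j.+1].

End fourier.

Section stochastic.
Context (R : realType) (d : measure_display) (Omega : measurableType d)
  (P : probability Omega R).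

Definition measurable_wrt (G : set_system Omega) (X : Omega -> R) : Prop :=
  preimage_set_system setT X measurable `<=` G.

Definition filtration (T : R) (F : R -> set_system Omega) : Prop :=
  [/\ forall s, 0 <= s <= T -> sigma_algebra setT (F s),
      forall s, 0 <= s <= T -> F s `<=` measurable,
      forall s u, 0 <= s -> s <= u -> u <= T -> F s `<=` F u
    & forall s, 0 <= s < T -> F s = \bigcap_(u in `]s, T]) F u].

Definition sigma_gen (I : Type) (D : set I) (X : I -> Omega -> R) :
    set_system Omega :=
  <<s \bigcup_(a in D) preimage_set_system setT (X a) measurable >>.

(* m-dimensional standard Wiener process with respect to the filtration F.    *)
(* Independence of the increments from the past of F is part of the notion:   *)
(* the Ito integral of F-adapted integrands is not defined without it.        *)
Record wiener (T : R) (F : R -> set_system Omega) (m : nat)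
    (f : 'I_m -> R -> Omega -> R) : Prop := Wiener {
  wiener_adapted : forall i s, 0 <= s <= T -> measurable_wrt (F s) (f i s);
  wiener_0 : forall i, {ae P, forall w, f i 0 w = 0};
  wiener_continuous : forall i,
    {ae P, forall w, {within `[0, T], continuous (fun s => f i s w)}};
  wiener_normal : forall i s u, 0 <= s -> s < u -> u <= T ->
    forall B : set R, measurable B ->
      P ((fun w => f i u w - f i s w) @^-1` B)
      = normal_prob 0 (Num.sqrt (u - s)) B;
  wiener_indep_past : forall s u, 0 <= s -> s <= u -> u <= T ->
    forall A B, F s A ->
      sigma_gen setT (fun i w => f i u w - f i s w) B ->
      P (A `&` B) = (P A * P B)%E;
  wiener_indep_components : forall A : 'I_m -> set Omega,
    (forall i, sigma_gen `[0, T] (f i) (A i)) ->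
    P (\bigcap_(i in setT) A i) = (\prod_(i < m) P (A i))%E
}.

Definition lim_ms (X : nat -> Omega -> R) (Y : Omega -> R) : Prop :=
  measurable_fun setT Y /\
  ('E_P[fun w => ((X N w - Y w) ^+ 2)%R] @[N --> \oo] --> 0)%E.

(* The class M_2 of integrands on [a, b]. *)
Definition ito_integrand (F : R -> set_system Omega) (a b : R)
    (xi : R -> Omega -> R) : Prop :=
  [/\ measurable_fun (`[a, b] `*` [set: Omega])
        (fun p : measurableTypeR R * Omega => xi p.1 p.2),
      forall s, a <= s <= b -> measurable_wrt (F s) (xi s)
    & (\int[lebesgue_measure]_(s in `[a, b])
         'E_P[fun w => (xi s w ^+ 2)%R] < +oo)%E].

Definition step_process (q : nat) (s : nat -> R) (h : nat -> Omega -> R)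
    (r : R) (w : Omega) : R :=
  \sum_(j < q) h j w * \1_(`[s j, s j.+1[%classic) r.

(* I is (a version of) the Ito integral of xi over [a, b] with respect to W:  *)
(* the mean-square limit of the integrals of adapted step processes that      *)
(* converge to xi in L2([a, b] x Omega).                                      *)
Definition is_ito (F : R -> set_system Omega) (W : R -> Omega -> R)
    (a b : R) (xi : R -> Omega -> R) (I : Omega -> R) : Prop :=
  ito_integrand F a b xi /\
  exists (q : nat -> nat) (s : nat -> nat -> R) (h : nat -> nat -> Omega -> R),
  [/\ forall N, partition_of a b (q N) (s N),
      forall N j, (j < q N)%N ->
        measurable_wrt (F (s N j)) (h N j) /\
        ('E_P[fun w => (h N j w ^+ 2)%R] < +oo)%E,
      (\int[lebesgue_measure]_(r in `[a, b])
         'E_P[fun w => ((step_process (q N) (s N) (h N) r w - xi r w) ^+ 2)%R]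
         @[N --> \oo] --> 0)%E
    & lim_ms
        (fun N w => \sum_(j < q N) h N j w * (W (s N j.+1) w - W (s N j) w))
        I].

(* Y l s is the l-fold iterated integral with upper limit s, so that          *)
(* Y l.+1 s = int_t^s psi_(l+1)(r) Y_l(r) df_r^(i_(l+1)); indices in 'I_k     *)
(* start from 0.                                                              *)
Definition is_iterated_ito (F : R -> set_system Omega) (m : nat)
    (f : 'I_m -> R -> Omega -> R) (t T : R) (k : nat) (i : 'I_k -> 'I_m)
    (psi : 'I_k -> R -> R) (J : Omega -> R) : Prop :=
  exists Y : nat -> R -> Omega -> R,
  [/\ forall s w, Y 0%N s w = 1,
      forall (l : 'I_k) s, t <= s <= T ->
        is_ito F (f (i l)) t s (fun r w => psi l r * Y l r w) (Y l.+1 s)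
    & J = Y k T].

(* The index sets H_k, L_k, G_k. *)
Definition idxH (k N : nat) : {set {ffun 'I_k -> 'I_N}} := setTfor _.
Definition idxL (k N : nat) : {set {ffun 'I_k -> 'I_N}} :=
  finset (fun l : {ffun 'I_k -> 'I_N} =>
    [forall g, forall r, (g != r) ==> (l g != l r)]).
Definition idxG (k N : nat) : {set {ffun 'I_k -> 'I_N}} :=
  (idxH k N :\: idxL k N)%SET.

Definition sumG (m : nat) (f : 'I_m -> R -> Omega -> R) (k : nat)
    (i : 'I_k -> 'I_m) (phi : nat -> R -> R) (tau : nat -> nat -> R)
    (j : 'I_k -> nat) (N : nat) (w : Omega) : R :=
  \sum_(l in idxG k N) \prod_(r < k)
    (phi (j r) (tau N (l r)) *
     (f (i r) (tau N (l r).+1) w - f (i r) (tau N (l r)) w)).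

(* The sums over 0 <= j_l <= p_l, l = 1, ..., k, are indexed by dependent     *)
(* finite functions; D j stands for the mean-square limit of sumG at j.       *)
Definition J_approx (t T : R) (m k : nat) (i : 'I_k -> 'I_m)
    (psi : 'I_k -> R -> R) (phi : nat -> R -> R)
    (zeta : nat -> 'I_m -> Omega -> R) (D : ('I_k -> nat) -> Omega -> R)
    (p : 'I_k -> nat) (w : Omega) : R :=
  \sum_(j : {dffun forall l : 'I_k, 'I_(p l).+1})
    let jj := fun l : 'I_k => nat_of_ord (j l) in
    fourier_coef t T psi phi jj *
    (\prod_(l < k) zeta (jj l) (i l) w - D jj w).

End stochastic.

Definition fourier_residual (R : realType) (t T : R) (k : nat)
    (psi : 'I_k -> R -> R) (phi : nat -> R -> R) (p : 'I_k -> nat) : R :=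
  \int[lebesgue_tuple R k]_(x in @cube R t T k) (kernel psi x ^+ 2) -
  \sum_(j : {dffun forall l : 'I_k, 'I_(p l).+1})
    fourier_coef t T psi phi (fun l => nat_of_ord (j l)) ^+ 2.

(* Main.v *)
Require Import Defs.
From mathcomp Require Import all_boot all_order all_algebra.
From mathcomp Require Import all_classical all_reals all_analysis.
From mathcomp Require Import perm measurable_realfun ring lra.
Import Order.TTheory GRing.Theory Num.Theory.
Import numFieldNormedType.Exports.

Set Implicit Arguments.
Unset Strict Implicit.
Unset Printing Implicit Defensive.

Local Open Scope classical_set_scope.
Local Open Scope ring_scope.

(** On a partition tau of [t, T] with N cells, let X be the sum over pairwise
distinct indices l_1, ..., l_k of
(K - K_p)(tau_{l_1}, ..., tau_{l_k}) times the product of the increments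
f^(i_r)(tau_{l_r + 1}) - f^(i_r)(tau_{l_r}), where K_p is the truncated Fourier
series of the kernel K. As the mesh tends to 0, X converges in mean square to
J - J^p, and the Fourier residual bounds the limit of the weighted l2 norm of the
coefficients of X.

The moments of X are bounded on the grid, before any limit is taken. Sorting the
indices (sum_idxL) writes X as a sum over the k! permutations of sums over
increasing indices. Such a sum is built up one increment at a time, and that
increment is Gaussian and independent of the past, so the one-step inequality
E (M + Y dW)^(2n) <= (A + (2n - 1) du B)^n, valid when E M^(2n) <= A^n and
E Y^(2n) <= B^n (hypercontractive_step), gives by induction the factor
(2n - 1)^(nk) (chaos_moment). The Cauchy-Schwarz inequality over the
permutations costs (k!)^n (multiple_sum_moment).

In mean square, X tends to J - J^p. The sum with K alone is a discrete iterated
integral (multiple_sum_kernel). It converges to the iterated Ito integral because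
an Ito integral stays as close to any simple integral as its integrand does to
the simple integrand (ito_estimate), an estimate that passes from each level of
iteration to the next (grid_iterated_cvg). The sum with a product of basis
functions is the full sum minus the sum over G_k (sumGE). The full sum is a
product of k single sums, which converge in all moments; hence its limit is the
product of the zetas (off_diagonal_msconv). The existence of the limits of the
sums over G_k comes from the same estimates, compared between two partitions, and
the completeness of L2 (sumG_limit). Moment bounds survive mean-square limits
(moment_msconv).

The weighted l2 norm is at most a Riemann sum of (K - K_p)^2, a function that
jumps only across the diagonals. The Riemann sums tend to its integral
(riemann_sum_limit), which is the Fourier residual by Bessel's identity
(bessel_identity). The residual tends to 0 since K is an L2 limit of finite sums
of products of functions of one variable (step_L2), for which Parseval's identity
on [t, T] suffices (tensor_small, residual_small). *)

(** * Convexity of powers *)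

Section powers.
Context (R : realFieldType).
Implicit Types x y z w a c : R.

(** Convexity of y ^ n on the half-line, as the graph lying above its tangents. *)
Lemma tangent_ge0 n y w : 0 <= y -> 0 <= w ->
  w ^+ n + n%:R * w ^+ n.-1 * (y - w) <= y ^+ n.
Proof.
move=> y0 w0; elim: n => [|n IH]; first by rewrite !expr0 !mul0r addr0.
rewrite [leRHS]exprS (le_trans _ (ler_wpM2l y0 IH))//= -subr_ge0.
case: n {IH} => [|n] /=; first by rewrite !expr0 !mul0r expr1; lra.
have -> : y * (w ^+ n.+1 + n.+1%:R * w ^+ n * (y - w)) -
    (w ^+ n.+2 + n.+2%:R * w ^+ n.+1 * (y - w)) =
    n.+1%:R * w ^+ n * (y - w) ^+ 2.
  by rewrite -(natr1 n.+1) !exprS expr0; ring.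
by rewrite mulr_ge0 ?sqr_ge0// mulr_ge0 ?exprn_ge0.
Qed.

Lemma tangent_even n x z :
  z ^+ (2 * n) + (2 * n)%:R * z ^+ (2 * n).-1 * (x - z) <= x ^+ (2 * n).
Proof.
have := tangent_ge0 n (sqr_ge0 x) (sqr_ge0 z); rewrite -!exprM.
apply: le_trans; case: n => [|n]; first by rewrite muln0 !mul0r.
rewrite lerD2l mulnS /= -subr_ge0.
have -> : n.+1%:R * z ^+ (2 * n) * (x ^+ 2 - z ^+ 2) -
   (2 + 2 * n)%:R * z ^+ (2 * n).+1 * (x - z) =
   n.+1%:R * z ^+ (2 * n) * (x - z) ^+ 2.
  by rewrite -mulnS natrM (exprS _ (2 * n)); ring.
by rewrite exprM mulr_ge0 ?sqr_ge0// mulr_ge0// exprn_ge0// sqr_ge0.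
Qed.

(** x + y is (a + c) times the average of x / a and y / c with weights a and c. *)
Lemma convex_expr n a c x y : 0 < a -> 0 < c -> 0 <= x -> 0 <= y ->
  (x + y) ^+ n.+1 <=
  (a + c) ^+ n * (a * (x / a) ^+ n.+1 + c * (y / c) ^+ n.+1).
Proof.
move=> a0 c0 x0 y0; have ac0 : 0 < a + c by rewrite addr_gt0.
pose z := (x + y) / (a + c).
have z0 : 0 <= z by apply: divr_ge0; [exact: addr_ge0|exact: ltW].
have xyE : x + y = (a + c) * z by rewrite mulrCA divff ?mulr1 ?gt_eqF.
have hx := tangent_ge0 n.+1 (divr_ge0 x0 (ltW a0)) z0.
have hy := tangent_ge0 n.+1 (divr_ge0 y0 (ltW c0)) z0.
rewrite {1}xyE exprMn exprSr -mulrA ler_wpM2l ?exprn_ge0 ?(ltW ac0)//.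
have := lerD (ler_wpM2l (ltW a0) hx) (ler_wpM2l (ltW c0) hy).
apply: le_trans; rewrite le_eqVlt; apply/orP; left; apply/eqP.
have ax : a * (x / a) = x by rewrite mulrCA divff ?mulr1 ?gt_eqF.
have cy : c * (y / c) = y by rewrite mulrCA divff ?mulr1 ?gt_eqF.
transitivity ((a + c) * z ^+ n.+1 +
  n.+1%:R * z ^+ n * (a * (x / a) + c * (y / c) - (a + c) * z)).
  by rewrite ax cy xyE subrr mulr0 addr0.
by rewrite /=; ring.
Qed.

(** Continuity of the power, in the form used to remove the slack e. *)
Lemma expr_limit n a c : 0 <= a ->
  (forall e, 0 < e -> c <= (a + e) ^+ n) -> c <= a ^+ n.
Proof.
move=> a0 H; apply/ler_addgt0Pr => e e0.
pose K := n%:R * (a + 1) ^+ n.-1.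
have K0 : 0 <= K by rewrite mulr_ge0// exprn_ge0// addr_ge0.
pose h := Num.min 1 (e / (K + 1)).
have K1 : 0 < K + 1 by rewrite ltr_wpDl.
have h0 : 0 < h by rewrite lt_min ltr01 divr_gt0.
have h1 : h <= 1 by rewrite ge_min lexx.
have hK : K * h <= e.
  have : h <= e / (K + 1) by rewrite ge_min lexx orbT.
  rewrite ler_pdivlMr// => hh; apply: le_trans hh.
  by rewrite mulrC ler_wpM2l ?(ltW h0)// lerDl.
have ah : 0 <= a + h by rewrite addr_ge0// ltW.
have := tangent_ge0 n a0 ah.
have -> : a - (a + h) = - h by ring.
rewrite mulrN lerBlDr => t; apply: le_trans (H h h0) _; apply: le_trans t _.
rewrite lerD2l (le_trans _ hK)// ler_wpM2r ?(ltW h0)// ler_wpM2l//.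
by rewrite lerXn2r ?nnegrE// ?addr_ge0// lerD2l.
Qed.

End powers.

(** * Integrals of real-valued functions *)

Section real_integrals.
Context d (T : measurableType d) (R : realType).
Variable mu : {measure set T -> \bar R}.
Variable D : set T.
Hypothesis mD : measurable D.
Implicit Types f g : T -> R.

Lemma integrableR_measurable f :
  mu.-integrable D (EFin \o f) -> measurable_fun D f.
Proof. by move=> /measurable_int/measurable_EFinP. Qed.

Lemma integrableR_le f g : measurable_fun D f ->
  (forall x, D x -> `|f x| <= g x) ->
  mu.-integrable D (EFin \o g) -> mu.-integrable D (EFin \o f).
Proof.
move=> mf fg ig; apply: le_integrable ig => //; first exact/measurable_EFinP.
by move=> x Dx /=; rewrite lee_fin (le_trans (fg _ Dx))// ler_norm.
Qed.

Lemma integrableRD f g : mu.-integrable D (EFin \o f) ->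
  mu.-integrable D (EFin \o g) ->
  mu.-integrable D (EFin \o (fun x => f x + g x)).
Proof. by move=> jf jg; have := integrableD mD jf jg. Qed.

Lemma integrableRZ (c : R) f : mu.-integrable D (EFin \o f) ->
  mu.-integrable D (EFin \o (fun x => c * f x)).
Proof. by move=> jf; have := integrableZl mD c jf. Qed.

Lemma integrableRB f g : mu.-integrable D (EFin \o f) ->
  mu.-integrable D (EFin \o g) ->
  mu.-integrable D (EFin \o (fun x => f x - g x)).
Proof. by move=> jf jg; have := integrableB mD jf jg. Qed.

Lemma integrableR_sum I (s : seq I) (Q : pred I) (h : I -> T -> R) :
  (forall i, Q i -> mu.-integrable D (EFin \o h i)) ->
  mu.-integrable D (EFin \o (fun x => \sum_(i <- s | Q i) h i x)).
Proof.
move=> jh; have := integrable_sum mD s jh; apply: eq_integrable => // x _ /=.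
by rewrite sumEFin.
Qed.

Lemma Rintegral_sum I (s : seq I) (Q : pred I) (h : I -> T -> R) :
  (forall i, Q i -> mu.-integrable D (EFin \o h i)) ->
  \int[mu]_(x in D) (\sum_(i <- s | Q i) h i x) =
  \sum_(i <- s | Q i) \int[mu]_(x in D) h i x.
Proof.
move=> jh; elim: s => [|a s IH].
  under eq_Rintegral do rewrite big_nil.
  by rewrite big_nil /Rintegral integral0.
rewrite big_cons; under eq_Rintegral do rewrite big_cons.
case: ifP => // Qa; rewrite RintegralD ?IH//; first exact: jh.
exact: integrableR_sum.
Qed.

Lemma integrableR_ge0 f : measurable_fun D f -> (forall x, D x -> 0 <= f x) ->
  (\int[mu]_(x in D) (f x)%:E < +oo)%E -> mu.-integrable D (EFin \o f).
Proof.
move=> mf f0 fy; apply/integrableP; split; first exact/measurable_EFinP.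
rewrite (eq_integral (fun x => (f x)%:E))// => x; rewrite inE => Dx /=.
by rewrite ger0_norm// f0.
Qed.

Lemma RintegralE f : mu.-integrable D (EFin \o f) ->
  (\int[mu]_(x in D) (f x)%:E)%E = (\int[mu]_(x in D) f x)%:E.
Proof. by move=> jf; rewrite /Rintegral fineK//; exact: integrable_fin_num. Qed.

End real_integrals.

(** * Square-integrable random variables and random variables with all moments *)

Section random_variables.
Context d (Omega : measurableType d) (R : realType) (P : probability Omega R).
Implicit Types X Y Z : Omega -> R.

Local Notation rint X := (P.-integrable setT (EFin \o X)).
Local Notation E X := (\int[P]_w X w).

Lemma expectationE X : rint X -> ('E_P[X])%E = (E X)%:E.
Proof. by move=> iX; rewrite expectation.unlock RintegralE. Qed.

Lemma rint_cst (c : R) : rint (fun=> c).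
Proof.
apply: finite_measure_integrable_cst => //.
Qed.

Lemma E_cst (c : R) : E (fun=> c) = c.
Proof.
rewrite Rintegral_cst//.
transitivity (c * fine (1%E : \bar R)); last by rewrite mulr1.
congr (_ * fine _); exact: probability_setT.
Qed.

Definition sqint X := measurable_fun setT X /\ rint (fun w => X w ^+ 2).

Lemma sqintM X Y : sqint X -> sqint Y -> rint (fun w => X w * Y w).
Proof.
move=> [mX iX] [mY iY].
apply: (integrableR_le _ _ _ (integrableRD _ iX iY)) => //.
  exact: measurable_funM.
move=> w _ /=; rewrite normrM.
have := sqr_ge0 (`|X w| - `|Y w|); rewrite sqrrB !real_normK ?num_real//.
have := normr_ge0 (X w); have := normr_ge0 (Y w); nra.
Qed.

Lemma sqintD X Y : sqint X -> sqint Y -> sqint (fun w => X w + Y w).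
Proof.
move=> sX sY; split; first by apply: measurable_funD; [case: sX|case: sY].
have := integrableRD measurableT (integrableRD measurableT sX.2 sY.2)
  (integrableRZ measurableT 2 (sqintM sX sY)).
by apply: eq_integrable => // w _ /=; congr EFin; ring.
Qed.

Lemma sqintZ (c : R) X : sqint X -> sqint (fun w => c * X w).
Proof.
move=> [mX iX]; split; first exact: measurable_funM.
have := integrableRZ measurableT (c ^+ 2) iX.
by apply: eq_integrable => // w _ /=; rewrite exprMn.
Qed.

Lemma sqintB X Y : sqint X -> sqint Y -> sqint (fun w => X w - Y w).
Proof.
move=> sX sY; have := sqintD sX (sqintZ (-1) sY).
by under [in X in X -> _]eq_fun do rewrite mulN1r.
Qed.

Lemma sqint_cst (c : R) : sqint (fun=> c).
Proof. by split => //; exact: rint_cst. Qed.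

Lemma sqint_sum I (s : seq I) (Q : pred I) (h : I -> Omega -> R) :
  (forall i, Q i -> sqint (h i)) -> sqint (fun w => \sum_(i <- s | Q i) h i w).
Proof.
move=> sh; elim: s => [|a s IH].
  by under eq_fun do rewrite big_nil; exact: sqint_cst.
under eq_fun do rewrite big_cons; case Qa : (Q a) => //.
by apply: sqintD => //; exact: sh.
Qed.

Lemma E_sqrD X Y : sqint X -> sqint Y ->
  E (fun w => (X w + Y w) ^+ 2) <=
  2 * E (fun w => X w ^+ 2) + 2 * E (fun w => Y w ^+ 2).
Proof.
move=> sX sY; rewrite -(RintegralZl 2 measurableT sX.2) -(RintegralZl 2 measurableT sY.2).
rewrite -RintegralD//; try exact/integrableRZ/sX.2; try exact/integrableRZ/sY.2.
apply: le_Rintegral => //; first exact: (sqintD sX sY).2.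
  by apply: integrableRD => //; apply: integrableRZ => //; [case: sX|case: sY].
by move=> w _; have := sqr_ge0 (X w - Y w); nra.
Qed.

Lemma E_sqrB X Y : sqint X -> sqint Y ->
  E (fun w => (X w - Y w) ^+ 2) <=
  2 * E (fun w => X w ^+ 2) + 2 * E (fun w => Y w ^+ 2).
Proof.
move=> sX sY; have := E_sqrD sX (sqintZ (-1) sY).
under [in X in X <= _ -> _]eq_Rintegral do rewrite mulN1r.
by under [in X in _ <= _ + X -> _]eq_Rintegral do rewrite mulN1r sqrrN.
Qed.

Lemma cauchy_schwarz X Y : sqint X -> sqint Y ->
  E (fun w => X w * Y w) ^+ 2 <=
  E (fun w => X w ^+ 2) * E (fun w => Y w ^+ 2).
Proof.
move=> sX sY; have iXY := sqintM sX sY.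
set b := E (fun w => X w * Y w); set a := E (fun w => X w ^+ 2).
set c := E (fun w => Y w ^+ 2).
have q s : 0 <= a - 2 * s * b + s ^+ 2 * c.
  have : 0 <= E (fun w => (X w - s * Y w) ^+ 2).
    by apply: Rintegral_ge0 => w _; exact: sqr_ge0.
  congr (_ <= _).
  have e1 : E (fun w => 2 * s * (X w * Y w)) = 2 * s * b.
    exact: RintegralZl.
  have e2 : E (fun w => s ^+ 2 * Y w ^+ 2) = s ^+ 2 * c.
    by apply: RintegralZl => //; exact: sY.2.
  have i1 : rint (fun w => 2 * s * (X w * Y w)) by exact: integrableRZ.
  have i2 : rint (fun w => s ^+ 2 * Y w ^+ 2).
    by apply: integrableRZ => //; exact: sY.2.
  rewrite -e1 -e2 -RintegralB//; last exact: sX.2.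
  rewrite -RintegralD//; last by apply: integrableRB => //; exact: sX.2.
  by apply: eq_Rintegral => w _; ring.
have c0 : 0 <= c by apply: Rintegral_ge0 => w _; exact: sqr_ge0.
have [cE|cn0] := eqVneq c 0.
  have [->|b0] := eqVneq b 0; first by rewrite cE mulr0 expr0n.
  (* With c = 0 the quadratic is affine; it takes the value -1 here. *)
  have := q ((a + 1) / (2 * b)); rewrite cE mulr0 addr0.
  have -> : 2 * ((a + 1) / (2 * b)) * b = a + 1 by field.
  by lra.
have c1 : 0 < c by rewrite lt_neqAle eq_sym cn0.
have := q (b / c).
have -> : a - 2 * (b / c) * b + (b / c) ^+ 2 * c = a - b ^+ 2 / c by field.
by rewrite subr_ge0 ler_pdivrMr.
Qed.

(** All integer moments are integrable; by the Cauchy-Schwarz inequality this class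
is closed under products, which square integrability is not. *)
Definition allmom X :=
  measurable_fun setT X /\ forall q, rint (fun w => X w ^+ q).

Lemma allmom_even X : measurable_fun setT X ->
  (forall q, rint (fun w => X w ^+ (2 * q))) -> allmom X.
Proof.
move=> mX H; split=> // q.
apply: (integrableR_le _ _ _ (integrableRD _ (rint_cst 1) (H q))) => //.
  exact: measurable_funX.
move=> w _; rewrite normrX mulnC exprM -[X in 1 + X]real_normK ?num_real// -normrX.
have := sqr_ge0 (`|X w ^+ q| - 1); have := normr_ge0 (X w ^+ q); rewrite normrX.
by nra.
Qed.

Lemma rint_normX X q : allmom X -> rint (fun w => `|X w| ^+ q).
Proof.
move=> [mX H]; apply: (integrableR_le _ _ _ (integrableRD _ (rint_cst 1) (H (2 * q)%N))) => //.
  by apply: measurable_funX; exact: measurableT_comp.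
move=> w _; rewrite -normrX normr_id mulnC exprM.
rewrite -[X in 1 + X]real_normK ?num_real//.
have := sqr_ge0 (`|X w ^+ q| - 1); have := normr_ge0 (X w ^+ q).
by nra.
Qed.

Lemma allmom_sqint X : allmom X -> sqint X.
Proof. by move=> [mX H]; split=> //; exact: H. Qed.

Lemma allmom_cst (c : R) : allmom (fun=> c).
Proof. by split=> // q; exact: rint_cst. Qed.

Lemma allmomX X q : allmom X -> allmom (fun w => X w ^+ q).
Proof.
move=> [mX H]; split; first exact: measurable_funX.
by move=> r; under eq_fun do rewrite -exprM; exact: H.
Qed.

Lemma allmomM X Y : allmom X -> allmom Y -> allmom (fun w => X w * Y w).
Proof.
move=> aX aY; split; first by apply: measurable_funM; [case: aX|case: aY].
move=> q; under eq_fun do rewrite exprMn.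
by apply: sqintM; apply: allmom_sqint; exact: allmomX.
Qed.

Lemma allmomZ (c : R) X : allmom X -> allmom (fun w => c * X w).
Proof. by move=> aX; apply: allmomM => //; exact: allmom_cst. Qed.

Lemma norm_exprD_le (x y : R) q :
  `|x + y| ^+ q <= 2 ^+ q * (`|x| ^+ q + `|y| ^+ q).
Proof.
wlog xy : x y / `|x| <= `|y|.
  move=> H; have [|/ltW] := lerP `|x| `|y|; first exact: H.
  by move=> /H; rewrite addrC [X in _ * X]addrC.
apply: (@le_trans _ _ ((2 * `|y|) ^+ q)).
  rewrite lerXn2r ?nnegrE ?mulr_ge0//.
  by rewrite (le_trans (ler_normD _ _))// mulr2n mulrDl mul1r lerD2r.
by rewrite exprMn ler_wpM2l ?exprn_ge0// lerDr exprn_ge0.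
Qed.

Lemma allmomD X Y : allmom X -> allmom Y -> allmom (fun w => X w + Y w).
Proof.
move=> aX aY.
have m : measurable_fun setT (fun w => X w + Y w).
  by apply: measurable_funD; [case: aX|case: aY].
split => // q.
apply: (integrableR_le _ _ _ (integrableRZ _ (2 ^+ q) (integrableRD _
   (rint_normX q aX) (rint_normX q aY)))) => //.
  exact: measurable_funX.
by move=> w _; rewrite normrX; exact: norm_exprD_le.
Qed.

Lemma allmomB X Y : allmom X -> allmom Y -> allmom (fun w => X w - Y w).
Proof.
move=> aX aY; have := allmomD aX (allmomZ (-1) aY).
by under [in X in X -> _]eq_fun do rewrite mulN1r.
Qed.

Lemma allmom_sum I (s : seq I) (Q : pred I) (h : I -> Omega -> R) :
  (forall i, Q i -> allmom (h i)) ->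
  allmom (fun w => \sum_(i <- s | Q i) h i w).
Proof.
move=> sh; elim: s => [|a s IH].
  by under eq_fun do rewrite big_nil; exact: allmom_cst.
under eq_fun do rewrite big_cons; case Qa : (Q a) => //.
by apply: allmomD => //; exact: sh.
Qed.

Lemma allmom_rint X : allmom X -> rint X.
Proof. by move=> [_ /(_ 1%N)]; under eq_fun do rewrite expr1. Qed.

(** The triangle inequality in L^n for nonnegative variables, by convexity. *)
Lemma E_exprD_le n (X Y : Omega -> R) (a c : R) :
  allmom X -> allmom Y -> (forall w, 0 <= X w) -> (forall w, 0 <= Y w) ->
  0 <= a -> 0 <= c ->
  E (fun w => X w ^+ n) <= a ^+ n -> E (fun w => Y w ^+ n) <= c ^+ n ->
  E (fun w => (X w + Y w) ^+ n) <= (a + c) ^+ n.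
Proof.
case: n => [|n]; first by move=> *; rewrite expr0 E_cst.
move=> aX aY X0 Y0.
wlog : a c / 0 < a /\ 0 < c.
  move=> H a0 c0 Xa Yc; apply: expr_limit; first exact: addr_ge0.
  move=> e e0; have -> : a + c + e = (a + e / 2) + (c + e / 2) by field.
  have e2 : 0 < e / 2 by rewrite divr_gt0.
  have ae : 0 <= a + e / 2 by rewrite addr_ge0// ltW.
  have ce : 0 <= c + e / 2 by rewrite addr_ge0// ltW.
  apply: H => //.
  - by rewrite !ltr_wpDl.
  - by rewrite (le_trans Xa)// lerXn2r ?nnegrE// lerDl ltW.
  - by rewrite (le_trans Yc)// lerXn2r ?nnegrE// lerDl ltW.
move=> [a0 c0] _ _ Xa Yc.
have iX := (allmomX 1 aX).2 n.+1; have iY := (allmomX 1 aY).2 n.+1.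
set K := (a + c) ^+ n.
have K0 : 0 <= K by rewrite exprn_ge0// ltW// addr_gt0.
apply: (@le_trans _ _ (E (fun w => K * a / a ^+ n.+1 * X w ^+ n.+1 +
    K * c / c ^+ n.+1 * Y w ^+ n.+1))).
  apply: le_Rintegral => //; first exact: (allmomD aX aY).2.
    by apply: integrableRD => //; exact: integrableRZ.
  move=> w _; apply: le_trans (convex_expr _ a0 c0 (X0 w) (Y0 w)) _.
  rewrite !exprMn !exprVn mulrDr le_eqVlt; apply/orP; left; apply/eqP.
  by rewrite -/K; ring.
rewrite RintegralD//; [|exact: integrableRZ|exact: integrableRZ].
rewrite (RintegralZl _ measurableT (aX.2 n.+1)) (RintegralZl _ measurableT (aY.2 n.+1)).
have -> : (a + c) ^+ n.+1 = K * a / a ^+ n.+1 * a ^+ n.+1 +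
    K * c / c ^+ n.+1 * c ^+ n.+1.
  rewrite !divfK ?expf_neq0 ?gt_eqF// -mulrDr exprSr//.
have a0' := ltW a0; have c0' := ltW c0.
apply: lerD; apply: ler_wpM2l => //; apply: divr_ge0 => //;
  by [exact: mulr_ge0|exact: exprn_ge0].
Qed.

Lemma E_expr_sum_le n I (s : seq I) (X : I -> Omega -> R) (a : I -> R) :
  (forall i, allmom (X i)) -> (forall i w, 0 <= X i w) ->
  (forall i, 0 <= a i) -> (forall i, E (fun w => X i w ^+ n) <= a i ^+ n) ->
  E (fun w => (\sum_(i <- s) X i w) ^+ n) <= (\sum_(i <- s) a i) ^+ n.
Proof.
move=> aX X0 a0 Xa; elim: s => [|i s IH].
  under eq_Rintegral do rewrite big_nil.
  by rewrite big_nil E_cst.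
under eq_Rintegral do rewrite big_cons.
rewrite big_cons; apply: E_exprD_le => //.
- exact: allmom_sum.
- by move=> w; apply: sumr_ge0.
- exact: sumr_ge0.
Qed.

End random_variables.

(** * Mean-square convergence *)

Section mean_square.
Context d (Omega : measurableType d) (R : realType) (P : probability Omega R).
Implicit Types X Y Z : Omega -> R.

Local Notation rint X := (P.-integrable setT (EFin \o X)).
Local Notation E X := (\int[P]_w X w).

(** Fatou's lemma for a sequence bounded in mean that converges almost surely. *)
Lemma fatou_ae (f : nat -> Omega -> R) (g : Omega -> R) (C : R) :
  (forall k, measurable_fun setT (f k)) -> (forall k w, 0 <= f k w) ->
  measurable_fun setT g -> (forall w, 0 <= g w) ->
  {ae P, forall w, f k w @[k --> \oo] --> g w} ->
  (forall k, (\int[P]_w (f k w)%:E <= C%:E)%E) ->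
  rint g /\ E g <= C.
Proof.
move=> mf f0 mg g0 fg fC.
have : (\int[P]_w (g w)%:E <= C%:E)%E.
  apply: (@le_trans _ _ (\int[P]_w limn_einf (fun k => (f k w)%:E))%E).
    apply: ae_ge0_le_integral => //.
    - by move=> w _; rewrite lee_fin.
    - exact/measurable_EFinP.
    - move=> w _; rewrite limn_einf_lim; apply: lime_ge.
        exact: is_cvg_einfs.
      apply: nearW => k; apply: le_ereal_inf_tmp => _ [j _ <-].
      by rewrite lee_fin.
    - rewrite (_ : (fun w => _) =
          (fun w => - limn_esup (fun k => - (f k w)%:E))%E); last first.
        by apply/funext => w; rewrite -[in RHS]limn_einfN /comp;
          congr limn_einf; apply/funext => k; rewrite oppeK.
      apply: measurableT_comp => //.
      apply: measurable_fun_limn_esup => k.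
      apply/measurableT_comp => //; exact/measurable_EFinP.
    - apply: filterS fg => w fgw _.
      have fgw' : (f k w)%:E @[k --> \oo] --> (g w)%:E.
        by apply: cvg_EFin => //; exact: nearW.
      by rewrite (cvg_limn_einf_sup fgw').1.
  apply: (le_trans (fatou _ _ _ _)) => //.
  - by move=> k; apply/measurable_EFinP.
  - by move=> k w _; rewrite lee_fin.
  - rewrite limn_einf_lim; apply: lime_le; first exact: is_cvg_einfs.
    apply: nearW => k; apply: le_trans (fC k).
    by apply: ereal_inf_lbound; exists k => /=.
move=> gC; have ig : rint g.
  by apply: integrableR_ge0 => //; exact: le_lt_trans gC (ltry _).
by split=> //; rewrite -lee_fin -RintegralE.
Qed.

(** Mean-square convergence in real-valued form: integrability is part of the
notion, since the real-valued integral is 0 when the integral is infinite. *)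
Definition msconv (X : nat -> Omega -> R) Y :=
  measurable_fun setT Y /\
  forall e, 0 < e -> exists N0, forall N, (N0 <= N)%N ->
    sqint P (fun w => X N w - Y w) /\ E (fun w => (X N w - Y w) ^+ 2) < e.

Lemma lim_msP (X : nat -> Omega -> R) Y :
  (forall N, measurable_fun setT (X N)) -> lim_ms P X Y <-> msconv X Y.
Proof.
move=> mX; split=> -[mY H]; split=> //.
  move=> e e0; move: H => /fine_cvgP[H1 /cvgr0Pnorm_lt/(_ _ e0) H2].
  case: H1 => N1 _ H1; case: H2 => N2 _ H2.
  exists (maxn N1 N2) => N; rewrite geq_max => /andP[N1N N2N].
  have m2 : measurable_fun setT (fun w => (X N w - Y w) ^+ 2).
    by apply: measurable_funX; exact: measurable_funB.
  have iN : rint (fun w => (X N w - Y w) ^+ 2).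
    apply: integrableR_ge0 => //; first by move=> w _; exact: sqr_ge0.
    have := H1 N N1N; rewrite expectation.unlock ge0_fin_numE//.
    by apply: integral_ge0 => w _; rewrite lee_fin sqr_ge0.
  split; first by split => //; exact: measurable_funB.
  by have := H2 N N2N; rewrite /= expectationE//=; apply: le_lt_trans; exact: ler_norm.
apply/fine_cvgP; split.
  have [N0 H0] := H _ ltr01; exists N0 => // N /= /H0[[_ iN] _].
  by rewrite expectationE.
apply/cvgr0Pnorm_lt => e e0; have [N0 H0] := H _ e0.
exists N0 => // N /= /H0[[_ iN] eN]; rewrite expectationE//= ger0_norm//.
by apply: Rintegral_ge0 => w _; exact: sqr_ge0.
Qed.

Lemma msconv_lt (X : nat -> Omega -> R) Y e : msconv X Y -> 0 < e ->
  exists N0, forall N, (N0 <= N)%N ->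
    sqint P (fun w => X N w - Y w) /\ E (fun w => (X N w - Y w) ^+ 2) < e.
Proof. by move=> [_ H] /H. Qed.

Lemma eq_msconv (X X' : nat -> Omega -> R) Y N1 :
  (forall N, (N1 <= N)%N -> X N = X' N) -> msconv X Y -> msconv X' Y.
Proof.
move=> XX' [mY H]; split=> // e /H[N0 H0]; exists (maxn N0 N1) => N.
by rewrite geq_max => /andP[/H0 ? /XX' <-].
Qed.

Lemma msconv_cst Y : measurable_fun setT Y -> msconv (fun=> Y) Y.
Proof.
move=> mY; split => // e e0; exists 0%N => N _.
under eq_fun do rewrite subrr.
split; first exact: sqint_cst.
by under eq_Rintegral do rewrite subrr expr0n; rewrite E_cst.
Qed.

Lemma msconvD (X X' : nat -> Omega -> R) Y Y' :
  msconv X Y -> msconv X' Y' ->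
  msconv (fun N w => X N w + X' N w) (fun w => Y w + Y' w).
Proof.
move=> [mY H] [mY' H']; split; first exact: measurable_funD.
move=> e e0; have e4 : 0 < e / 4 by rewrite divr_gt0.
have [N0 H0] := H _ e4; have [N1 H1] := H' _ e4.
exists (maxn N0 N1) => N; rewrite geq_max => /andP[/H0[s1 l1] /H1[s2 l2]].
have eq1 : (fun w => (X N w + X' N w) - (Y w + Y' w)) =
  (fun w => (X N w - Y w) + (X' N w - Y' w)) by apply/funext => w; ring.
split; first by rewrite eq1; exact: sqintD.
rewrite (@eq_Rintegral _ _ _ P setT (fun w => ((X N w - Y w) + (X' N w - Y' w)) ^+ 2)); last first.
  by move=> w _; congr (_ ^+ 2); ring.
apply: le_lt_trans (E_sqrD s1 s2) _; lra.
Qed.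

Lemma msconvZ (c : R) (X : nat -> Omega -> R) Y : msconv X Y ->
  msconv (fun N w => c * X N w) (fun w => c * Y w).
Proof.
move=> [mY H]; split; first exact: measurable_funM.
move=> e e0; have c1 : 0 < c ^+ 2 + 1 by rewrite ltr_wpDl ?sqr_ge0.
have [N0 H0] := H _ (divr_gt0 e0 c1).
exists N0 => N /H0[s1 l1].
split; first by under eq_fun do rewrite -mulrBr; exact: sqintZ.
under eq_Rintegral do rewrite -mulrBr exprMn.
rewrite (RintegralZl _ measurableT s1.2).
move: l1; rewrite ltr_pdivlMr//; apply: le_lt_trans.
rewrite mulrC ler_wpM2l//; last by rewrite lerDl.
by apply: Rintegral_ge0 => w _; exact: sqr_ge0.
Qed.

Lemma msconvB (X X' : nat -> Omega -> R) Y Y' :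
  msconv X Y -> msconv X' Y' ->
  msconv (fun N w => X N w - X' N w) (fun w => Y w - Y' w).
Proof.
move=> H /(msconvZ (-1)) H'; have := msconvD H H'.
congr msconv; first by apply/funext => N; apply/funext => w; rewrite mulN1r.
by apply/funext => w; rewrite mulN1r.
Qed.

Lemma msconv_sum I (s : seq I) (X : I -> nat -> Omega -> R) (Y : I -> Omega -> R) :
  (forall i, msconv (X i) (Y i)) ->
  msconv (fun N w => \sum_(i <- s) X i N w) (fun w => \sum_(i <- s) Y i w).
Proof.
move=> H; elim: s => [|a s IH].
  have := msconv_cst (measurable_cst (0 : R)).
  congr msconv; first by apply/funext => N; apply/funext => w; rewrite big_nil.
  by apply/funext => w; rewrite big_nil.
have := msconvD (H a) IH.
congr msconv; first by apply/funext => N; apply/funext => w; rewrite big_cons.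
by apply/funext => w; rewrite big_cons.
Qed.

(** Moment bounds pass to mean-square limits: bound the truncation of the limit
at level M, for which the tangent of x ^ (2 n) at the truncated value loses
only a multiple of the mean-square distance, and let M grow by Fatou. *)
Lemma moment_msconv (X : nat -> Omega -> R) Y n C : (0 < n)%N ->
  msconv X Y -> (forall N, allmom P (X N)) ->
  (forall e, 0 < e -> exists N0, forall N, (N0 <= N)%N ->
     E (fun w => X N w ^+ (2 * n)) <= C + e) ->
  rint (fun w => Y w ^+ (2 * n)) /\ E (fun w => Y w ^+ (2 * n)) <= C.
Proof.
move=> n0 [mY H] aX HC.
pose Z (M : nat) w := Num.max (- M%:R) (Num.min M%:R (Y w)).
have ZM M w : `|Z M w| <= M%:R.
  rewrite ler_norml /Z le_max lexx /= ge_max ge_min lexx /= andbT.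
  by apply: (@le_trans _ _ 0); rewrite ?oppr_le0 ler0n.
have mZ M : measurable_fun setT (Z M).
  by apply: measurable_funTS; apply: measurable_maxr => //; exact: measurable_minr.
have iZ M : rint (fun w => Z M w ^+ (2 * n)).
  apply: (integrableR_le _ _ _ (rint_cst P (M%:R ^+ (2 * n)))) => //.
    exact: measurable_funX.
  by move=> w _; rewrite normrX lerXn2r ?nnegrE.
have ZY M w : 0 <= Z M w ^+ (2 * n).-1 * (Y w - Z M w).
  case: n n0 HC iZ => // n _ _ _.
  rewrite mulnS /= exprS -mulrA mulrCA exprM.
  apply: mulr_ge0; first by rewrite exprn_ge0// sqr_ge0.
  rewrite /Z; have M0 : 0 <= M%:R :> R by rewrite ler0n.
  have [h1|/ltW h1] := leP (Y w) M%:R.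
    have [h2|/ltW h2] := leP (- M%:R) (Y w).
      by rewrite subrr mulr0.
    by nra.
  rewrite (max_idPr _).
    by rewrite mulr_ge0// subr_ge0.
  by apply: (@le_trans _ _ 0); rewrite ?oppr_le0.
have EZ M : E (fun w => Z M w ^+ (2 * n)) <= C.
  apply/ler_addgt0Pr => e e0.
  pose K : R := (2 * n)%:R * M%:R ^+ (2 * n).-1.
  have K0 : 0 <= K by rewrite mulr_ge0// exprn_ge0.
  (* The cross term K |X - Y| is at most K h + (K / h) (X - Y)^2, and both parts
  are small when E (X - Y)^2 < h^2 and K h <= e / 4. *)
  pose h := e / (4 * (K + 1)).
  have K1 : 0 < K + 1 by rewrite ltr_wpDl.
  have h0 : 0 < h by rewrite divr_gt0// mulr_gt0.
  have [N1 H1] := H _ (mulr_gt0 h0 h0).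
  have [N2 H2] := HC _ (divr_gt0 e0 (ltr0n R 2)).
  have [s1 l1] := H1 _ (leq_maxl N1 N2); have := H2 _ (leq_maxr N1 N2).
  set N := maxn N1 N2 in s1 l1 * => l2.
  have i2 : rint (fun w => K * h + K / h * (X N w - Y w) ^+ 2).
    apply: integrableRD => //; first exact: rint_cst.
    by apply: integrableRZ => //; exact: s1.2.
  apply: (@le_trans _ _ (E (fun w => X N w ^+ (2 * n) +
      (K * h + K / h * (X N w - Y w) ^+ 2)))).
    apply: le_Rintegral => //.
      by apply: integrableRD => //; exact: (aX N).2.
    move=> w _; have := tangent_even n (X N w) (Z M w).
    set a := X N w - Y w.
    have -> : X N w - Z M w = a + (Y w - Z M w) by rewrite /a; ring.
    rewrite -!mulrA mulrDr => t.
    have zy := mulr_ge0 (ler0n R (2 * n)) (ZY M w).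
    have aK : - (K * `|a|) <= (2 * n)%:R * (Z M w ^+ (2 * n).-1 * a).
      rewrite lerNl -mulrN (le_trans (ler_norm _))// normrM normr_nat normrN normrM.
      rewrite mulrA ler_wpM2r// ler_wpM2l// normrX lerXn2r ?nnegrE//.
    have a2 : K * `|a| <= K * h + K / h * a ^+ 2.
      rewrite -mulrA -mulrDr ler_wpM2l// -[a ^+ 2]real_normK ?num_real//.
      have -> : h + h^-1 * `|a| ^+ 2 = (h ^+ 2 + `|a| ^+ 2) / h.
        by field; rewrite gt_eqF.
      rewrite ler_pdivlMr//; have := sqr_ge0 (h - `|a|).
      have := mulr_ge0 (ltW h0) (normr_ge0 a); nra.
    rewrite mulrDr in t; rewrite /K in aK a2; lra.
  rewrite RintegralD//; last exact: (aX N).2.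
  rewrite RintegralD//; [|exact: rint_cst|by apply: integrableRZ => //; exact: s1.2].
  rewrite E_cst (RintegralZl _ measurableT s1.2).
  have b1 : K / h * E (fun w => (X N w - Y w) ^+ 2) <= K * h.
    apply: (@le_trans _ _ (K / h * (h * h))).
      by apply: ler_wpM2l; [apply: divr_ge0 => //; exact: ltW|exact: ltW].
    by rewrite mulrA divfK ?gt_eqF.
  have b2 : K * h <= e / 4.
    have -> : K * h = e / 4 * (K / (K + 1)) by rewrite /h; field; rewrite gt_eqF.
    by rewrite ler_piMr ?divr_ge0 ?(ltW e0)// ler_pdivrMr// mul1r lerDl.
  simpl in *; lra.
have := @fatou_ae (fun M w => Z M w ^+ (2 * n)) (fun w => Y w ^+ (2 * n)) C.
apply.
- by move=> M; exact: measurable_funX.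
- by move=> M w; rewrite exprM exprn_ge0// sqr_ge0.
- exact: measurable_funX.
- by move=> w; rewrite exprM exprn_ge0// sqr_ge0.
- apply: aeW => w; apply: cvg_near_cst.
  near=> M; rewrite /Z.
  have YM : `|Y w| <= M%:R by near: M; exact: nbhs_infty_ger.
  move: YM; rewrite ler_norml => /andP[h1 h2].
  by rewrite (min_idPr h2) (max_idPr h1).
- by move=> M; rewrite RintegralE// lee_fin.
Unshelve. all: by end_near.
Qed.

End mean_square.

Section completeness.
Context d (Omega : measurableType d) (R : realType) (P : probability Omega R).
Implicit Types X Y Z : Omega -> R.

Local Notation rint X := (P.-integrable setT (EFin \o X)).
Local Notation E X := (\int[P]_w X w).

(** Completeness of L2: along a subsequence whose consecutive mean-square
distances are at most 4 ^ - k the increments are summable almost surely, and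
Fatou's lemma transfers the Cauchy estimate to the pointwise limit. *)
Lemma riesz_fischer (X : nat -> Omega -> R) :
  (forall N, sqint P (X N)) ->
  (forall e, 0 < e -> exists N0, forall n m, (N0 <= n)%N -> (N0 <= m)%N ->
     E (fun w => (X n w - X m w) ^+ 2) < e) ->
  exists Y, msconv P X Y.
Proof.
move=> sX cX.
have /choice[a aP] k : exists N0, forall n m, (N0 <= n)%N -> (N0 <= m)%N ->
    E (fun w => (X n w - X m w) ^+ 2) < 2^-1 ^+ (2 * k).
  by apply: cX; rewrite exprn_gt0// invr_gt0.
(* An increasing choice of indices that dominates a. *)
pose s k := (\sum_(j < k.+1) a j + k)%N.
have s_ge k j : (j <= k)%N -> (a j <= s k)%N.
  by rewrite -ltnS => jk; rewrite /s (bigD1 (Ordinal jk))//= -addnA leq_addr.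
pose D k w := X (s k.+1) w - X (s k) w.
have sD k : sqint P (D k) by exact: sqintB.
have mX k : measurable_fun setT (X k) by case: (sX k).
have mD k : measurable_fun setT (fun w => `|D k w|).
  by apply: measurableT_comp => //; exact: measurable_funB.
have ED k : (\int[P]_w `|D k w|%:E <= (2^-1 ^+ k)%:E)%E.
  have h0 : 0 < 2^-1 ^+ k :> R by rewrite exprn_gt0// invr_gt0.
  set h := 2^-1 ^+ k in h0 *.
  have iD : rint (fun w => h / 2 + (h * 2)^-1 * D k w ^+ 2).
    apply: integrableRD => //; first exact: rint_cst.
    by apply: integrableRZ => //; exact: (sD k).2.
  apply: (@le_trans _ _ (\int[P]_w (h / 2 + (h * 2)^-1 * D k w ^+ 2)%:E)%E).
    apply: ge0_le_integral => //.
    - exact/measurable_EFinP.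
    - apply/measurable_EFinP; exact: integrableR_measurable iD.
    - move=> w _; rewrite lee_fin.
      have -> : h / 2 + (h * 2)^-1 * D k w ^+ 2 = (h ^+ 2 + D k w ^+ 2) / (h * 2).
        by field; rewrite gt_eqF.
      rewrite ler_pdivlMr ?mulr_gt0// -[D k w ^+ 2]real_normK ?num_real//.
      have := sqr_ge0 (h - `|D k w|); nra.
  rewrite RintegralE// lee_fin RintegralD//; last 2 first.
    exact: rint_cst.
    by apply: integrableRZ => //; exact: (sD k).2.
  rewrite E_cst (RintegralZl _ measurableT (sD k).2).
  have : E (fun w => D k w ^+ 2) <= h ^+ 2.
    rewrite -exprM mulnC; apply/ltW/aP; exact: s_ge.
  move=> le; rewrite [leRHS]splitr lerD2l mulrC ler_pdivrMr ?mulr_gt0//.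
  by have -> : h / 2 * (h * 2) = h ^+ 2 by field.
pose S w := (\sum_(0 <= k <oo) `|D k w|%:E)%E.
have S0 w : (0 <= S w)%E by apply: nneseries_ge0 => k _ _; rewrite lee_fin.
have ES : (\int[P]_w S w < +oo)%E.
  rewrite integral_nneseries//; last by move=> k; exact/measurable_EFinP.
  apply: (@le_lt_trans _ _ (\sum_(0 <= k <oo) (geometric 1 2^-1 k)%:E)%E).
    apply: lee_nneseries; first by move=> k _ _; apply: integral_ge0 => w _; rewrite lee_fin.
    by move=> k _; rewrite /geometric /= mul1r.
  apply: (@le_lt_trans _ _ (2%:E)%E); last exact: ltry.
  apply: lime_le.
    by apply: is_cvg_nneseries => k _ _; rewrite lee_fin geometric_ge0.
  apply: nearW => n; rewrite sumEFin lee_fin.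
  rewrite [leRHS](_ : _ = 1 / (1 - 2^-1) :> R); last by field.
  have h2 : 0 < 2^-1 :> R by rewrite invr_gt0.
  have h3 : `|2^-1| < 1 :> R by rewrite gtr0_norm// invf_lt1// ltr1n.
  exact: (geometric_le_lim n ler01 h2 h3).
have iS : P.-integrable setT S.
  apply/integrableP; split.
    apply: ge0_emeasurable_sum => //; move=> k _; exact/measurable_EFinP.
  by rewrite (eq_integral S)// => w _; rewrite gee0_abs.
have aeS := integrable_ae measurableT iS.
(* The upper limit makes the limit measurable, also where X does not converge. *)
pose Y w := fine (limn_esup (fun k => (X (s k) w)%:E)).
have mY : measurable_fun setT Y.
  apply: measurableT_comp => //; apply: measurable_fun_limn_esup => k.
  exact/measurable_EFinP.
have XY : {ae P, forall w, X (s k) w @[k --> \oo] --> Y w}.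
  apply: filterS aeS => w /(_ I) Sfin.
  have cD : cvgn (series (fun k => D k w)).
    apply: normed_cvg; apply: (@nnseries_is_cvg _ (fun k => `|D k w|)) => //.
    have : (S w < +oo)%E by rewrite -ge0_fin_numE.
    by [].
  have sE n : X (s n) w = X (s 0%N) w + series (fun k => D k w) n.
    elim: n => [|n IH]; first by rewrite /series /= big_nil addr0.
    by rewrite seriesSr addrA -IH /D addrC subrK.
  have [l lP] : exists l : R, X (s k) w @[k --> \oo] --> l.
    exists (X (s 0%N) w + limn (series (fun k => D k w))).
    rewrite (funext sE : (fun k => X (s k) w) = _).
    by apply: cvgD; [exact: cvg_cst|exact: cD].
  have lP' : (X (s k) w)%:E @[k --> \oo] --> l%:E.
    by apply: cvg_EFin => //; exact: nearW.
  by rewrite /Y (cvg_limn_einf_sup lP').2.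
exists Y; split => // e e0.
have [N0 H0] := cX _ (divr_gt0 e0 (ltr0n R 2)).
exists N0 => N NN0.
have sN k : (k <= s k)%N by rewrite leq_addl.
have [i1 l1] : rint (fun w => (X N w - Y w) ^+ 2) /\
    E (fun w => (X N w - Y w) ^+ 2) <= e / 2.
  apply: (@fatou_ae _ _ _ P (fun k w => (X N w - X (s (N0 + k)%N) w) ^+ 2)).
  - by move=> k; apply: measurable_funX; exact: measurable_funB.
  - by move=> k w; exact: sqr_ge0.
  - by apply: measurable_funX; exact: measurable_funB.
  - by move=> w; exact: sqr_ge0.
  - apply: filterS XY => w XYw.
    have XY2 : X (s (N0 + k)%N) w @[k --> \oo] --> Y w.
      under eq_fun do rewrite addnC.
      by move: (XYw); rewrite -(cvg_shiftn N0); apply.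
    apply: (@cvg_comp _ _ _ (fun k => X N w - X (s (N0 + k)%N) w)
      (fun x => x ^+ 2) _ (nbhs (X N w - Y w))); last exact: exprn_continuous.
    by apply: cvgB => //; exact: cvg_cst.
  - move=> k; rewrite RintegralE//; last exact: (sqintB (sX _) (sX _)).2.
    by rewrite lee_fin; apply/ltW/H0 => //; rewrite (leq_trans _ (sN _))// leq_addr.
split; first by split => //; exact: measurable_funB.
by rewrite (le_lt_trans l1)// ltr_pdivrMr// ltr_pMr// ltr1n.
Qed.
End completeness.

Section all_moments.
Context d (Omega : measurableType d) (R : realType) (P : probability Omega R).
Implicit Types X Y Z : Omega -> R.

Local Notation rint X := (P.-integrable setT (EFin \o X)).
Local Notation E X := (\int[P]_w X w).

(** Convergence to 0 of all even moments, of positive order as the moment of order 0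
is always 1. *)
Definition vanishing (U : nat -> Omega -> R) :=
  (forall N, allmom P (U N)) /\
  forall q e, 0 < e -> exists N0, forall N, (N0 <= N)%N ->
    E (fun w => U N w ^+ (2 * q.+1)) < e.

Lemma vanishingD U V : vanishing U -> vanishing V ->
  vanishing (fun N w => U N w + V N w).
Proof.
move=> [aU U0] [aV V0]; split; first by move=> N; exact: allmomD.
move=> q e e0; pose K : R := 2 ^+ (2 * q.+1).
have K0 : 0 < K by rewrite exprn_gt0.
have h0 : 0 < e / (2 * K) by rewrite divr_gt0// mulr_gt0.
have [N1 H1] := U0 q _ h0; have [N2 H2] := V0 q _ h0.
exists (maxn N1 N2) => N; rewrite geq_max => /andP[/H1 l1 /H2 l2].
have iU := (aU N).2 (2 * q.+1)%N; have iV := (aV N).2 (2 * q.+1)%N.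
apply: (@le_lt_trans _ _ (E (fun w => K * (U N w ^+ (2 * q.+1) + V N w ^+ (2 * q.+1))))).
  apply: le_Rintegral => //; first exact: (allmomD (aU N) (aV N)).2.
    by apply: integrableRZ => //; exact: integrableRD.
  move=> w _; have := norm_exprD_le (U N w) (V N w) (2 * q.+1).
  by rewrite -!normrX !ger0_norm// exprM exprn_ge0// sqr_ge0.
rewrite (RintegralZl _ measurableT (integrableRD measurableT iU iV)) RintegralD//.
rewrite -ltr_pdivlMl//; apply: (lt_le_trans (ltrD l1 l2)).
by rewrite le_eqVlt; apply/orP; left; apply/eqP; field; rewrite gt_eqF.
Qed.

(** Cauchy-Schwarz, for even powers. *)
Lemma vanishingM_bounded U (V : nat -> Omega -> R) :
  vanishing U -> (forall N, allmom P (V N)) ->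
  (forall q, exists C N1, forall N, (N1 <= N)%N ->
     E (fun w => V N w ^+ (2 * q)) <= C) ->
  vanishing (fun N w => U N w * V N w).
Proof.
move=> [aU U0] aV bV; split; first by move=> N; exact: allmomM.
move=> q e e0; have [C [N1 CP]] := bV (2 * q.+1)%N.
have C0 : 0 <= C.
  apply: le_trans (CP N1 (leqnn _)); apply: Rintegral_ge0 => w _.
  by rewrite exprM exprn_ge0// sqr_ge0.
have h0 : 0 < e ^+ 2 / (C + 1) by rewrite divr_gt0 ?exprn_gt0// ltr_wpDl.
have [N0 H0] := U0 (2 * q).+1%N _ h0; exists (maxn N0 N1) => N.
rewrite geq_max => /andP[NN0 NN1].
have := cauchy_schwarz (allmom_sqint (allmomX (2 * q.+1) (aU N)))
                       (allmom_sqint (allmomX (2 * q.+1) (aV N))).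
under eq_Rintegral do rewrite -exprMn.
move=> cs.
have EW : 0 <= E (fun w => (U N w * V N w) ^+ (2 * q.+1)).
  by apply: Rintegral_ge0 => w _; rewrite exprM exprn_ge0// sqr_ge0.
rewrite -(@ltr_pXn2r _ 2)// ?nnegrE ?(ltW e0)//.
apply: (le_lt_trans cs).
have := H0 _ NN0; rewrite ltr_pdivlMr ?ltr_wpDl//; apply: le_lt_trans.
have e1 : E (fun w => (U N w ^+ (2 * q.+1)) ^+ 2) =
          E (fun w => U N w ^+ (2 * (2 * q).+2)).
  by apply: eq_Rintegral => w _; rewrite -exprM mulnC mulnS add2n.
have e2 : E (fun w => (V N w ^+ (2 * q.+1)) ^+ 2) <= C.
  rewrite (le_trans _ (CP N NN1))// le_eqVlt; apply/orP; left; apply/eqP.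
  by apply: eq_Rintegral => w _; rewrite -exprM [in RHS]mulnC.
have U4 : 0 <= E (fun w => U N w ^+ (2 * (2 * q).+2)).
  by apply: Rintegral_ge0 => w _; rewrite exprM exprn_ge0// sqr_ge0.
by rewrite e1 ler_wpM2l// (le_trans e2)// lerDl.
Qed.

(** Convergence in every L^q with q finite: unlike mean-square convergence it is
compatible with products. *)
Definition lpconv (X : nat -> Omega -> R) Y :=
  [/\ forall N, allmom P (X N), allmom P Y &
      vanishing (fun N w => X N w - Y w)].

Lemma lpconv_msconv (X : nat -> Omega -> R) Y : lpconv X Y -> msconv P X Y.
Proof.
move=> [aX aY [_ H]]; split; first by case: aY.
move=> e /(H 0%N)[N0 H0]; exists N0 => N NN0; split; last exact: H0.
by apply: allmom_sqint; exact: allmomB.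
Qed.

Lemma lpconv_cst Y : allmom P Y -> lpconv (fun=> Y) Y.
Proof.
move=> aY; split=> //; split; first by move=> N; exact: allmomB.
move=> q e e0; exists 0%N => N _.
by under eq_Rintegral do rewrite subrr expr0n; rewrite E_cst.
Qed.

Lemma vanishing_eq U V : (forall N w, U N w = V N w) -> vanishing U -> vanishing V.
Proof. by move=> /(fun h => funext (fun N => funext (h N))) ->. Qed.

Lemma lpconvM (X X' : nat -> Omega -> R) Y Y' : lpconv X Y -> lpconv X' Y' ->
  lpconv (fun N w => X N w * X' N w) (fun w => Y w * Y' w).
Proof.
move=> [aX aY cX] [aX' aY' cX']; split.
- by move=> N; exact: allmomM.
- exact: allmomM.
have h1 : vanishing (fun N w => (X N w - Y w) * Y' w).
  by apply: vanishingM_bounded => // q; exists (E (fun w => Y' w ^+ (2 * q))), 0%N.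
have h2 : vanishing (fun N w => (X' N w - Y' w) * Y w).
  by apply: vanishingM_bounded => // q; exists (E (fun w => Y w ^+ (2 * q))), 0%N.
have h3 : vanishing (fun N w => (X N w - Y w) * (X' N w - Y' w)).
  apply: vanishingM_bounded => //; first by move=> N; exact: allmomB.
  case=> [|q]; first by exists 1, 0%N => N _; under eq_Rintegral do rewrite expr0; rewrite E_cst.
  have [N1 H1] := cX'.2 q _ ltr01.
  by exists 1, N1 => N /H1/ltW.
apply: vanishing_eq (vanishingD (vanishingD h1 h2) h3) => N w; ring.
Qed.

(** Interpolation: the moment of order 2 q + 2 of the difference is at most the
geometric mean of its second moment and of a bounded higher moment. *)
Lemma msconv_lpconv (X : nat -> Omega -> R) Y : (forall N, allmom P (X N)) ->
  (forall q, exists C, forall N, E (fun w => X N w ^+ (2 * q)) <= C) ->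
  msconv P X Y -> lpconv X Y.
Proof.
move=> aX bX cXY; have mY := cXY.1.
have aY : allmom P Y.
  apply: allmom_even => // -[|q].
    by under eq_fun do rewrite muln0 expr0; exact: rint_cst.
  have [C CP] := bX q.+1.
  apply: (moment_msconv (C := C) (ltn0Sn q) cXY aX _).1 => e e0.
  by exists 0%N => N _; rewrite (le_trans (CP N))// lerDl ltW.
split=> //; split; first by move=> N; exact: allmomB.
move=> q e e0; pose r := (2 * q).+1.
have [C CP] := bX r.
pose B := 2 ^+ (2 * r) * (C + E (fun w => Y w ^+ (2 * r))).
have EB N : E (fun w => (X N w - Y w) ^+ (2 * r)) <= B.
  have iX := (aX N).2 (2 * r)%N; have iY := aY.2 (2 * r)%N.
  apply: (@le_trans _ _ (E (fun w => 2 ^+ (2 * r) * (X N w ^+ (2 * r) + Y w ^+ (2 * r))))).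
    apply: le_Rintegral => //; first exact: (allmomB (aX N) aY).2.
      by apply: integrableRZ => //; exact: integrableRD.
    move=> w _; have := norm_exprD_le (X N w) (- Y w) (2 * r).
    by rewrite normrN -!normrX !ger0_norm// exprM exprn_ge0// sqr_ge0.
  rewrite (RintegralZl _ measurableT (integrableRD measurableT iX iY)) RintegralD//.
  by rewrite /B ler_wpM2l ?exprn_ge0// lerD2r.
have B0 : 0 <= B.
  apply: le_trans (EB 0%N); apply: Rintegral_ge0 => w _.
  by rewrite exprM exprn_ge0// sqr_ge0.
have h0 : 0 < e ^+ 2 / (B + 1) by rewrite divr_gt0 ?exprn_gt0// ltr_wpDl.
have [N0 H0] := cXY.2 _ h0; exists N0 => N /H0[s1 l1].
have aZ := allmomB (aX N) aY.
have := cauchy_schwarz s1 (allmom_sqint (allmomX r aZ)).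
have -> : E (fun w => (X N w - Y w) * (X N w - Y w) ^+ r) =
    E (fun w => (X N w - Y w) ^+ (2 * q.+1)).
  by apply: eq_Rintegral => w _; rewrite -exprS /r mulnS add2n.
have -> : E (fun w => ((X N w - Y w) ^+ r) ^+ 2) =
    E (fun w => (X N w - Y w) ^+ (2 * r)).
  by apply: eq_Rintegral => w _; rewrite -exprM mulnC.
move=> cs.
have EW : 0 <= E (fun w => (X N w - Y w) ^+ (2 * q.+1)).
  by apply: Rintegral_ge0 => w _; rewrite exprM exprn_ge0// sqr_ge0.
rewrite -(@ltr_pXn2r _ 2)// ?nnegrE ?(ltW e0)//.
apply: (le_lt_trans cs).
move: l1; rewrite ltr_pdivlMr ?ltr_wpDl//; apply: le_lt_trans.
apply: ler_wpM2l; first by apply: Rintegral_ge0 => w _; exact: sqr_ge0.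
by rewrite (le_trans (EB N))// lerDl.
Qed.

Lemma lpconv_prod I (s : seq I) (X : I -> nat -> Omega -> R) (Y : I -> Omega -> R) :
  (forall i, lpconv (X i) (Y i)) ->
  lpconv (fun N w => \prod_(i <- s) X i N w) (fun w => \prod_(i <- s) Y i w).
Proof.
move=> H; elim: s => [|a s IH].
  have := lpconv_cst (allmom_cst P 1).
  congr lpconv; first by apply/funext => N; apply/funext => w; rewrite big_nil.
  by apply/funext => w; rewrite big_nil.
have := lpconvM (H a) IH.
congr lpconv; first by apply/funext => N; apply/funext => w; rewrite big_cons.
by apply/funext => w; rewrite big_cons.
Qed.

End all_moments.

(** * Product measures and independence *)

Section tensor.
Context d1 d2 (T1 : measurableType d1) (T2 : measurableType d2) (R : realType).
Variables (m1 : {sigma_finite_measure set T1 -> \bar R})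
  (m2 : {sigma_finite_measure set T2 -> \bar R}).
Variables (f : T1 -> R) (g : T2 -> R).
Hypothesis intf : m1.-integrable setT (EFin \o f).
Hypothesis intg : m2.-integrable setT (EFin \o g).

Lemma measurable_tensor : measurable_fun setT (fun z : T1 * T2 => f z.1 * g z.2).
Proof.
apply: measurable_funM.
  exact: measurableT_comp (integrableR_measurable intf) measurable_fst.
exact: measurableT_comp (integrableR_measurable intg) measurable_snd.
Qed.

Lemma integrable_tensor :
  (m1 \x m2)%E.-integrable setT (EFin \o (fun z => f z.1 * g z.2)).
Proof.
apply/integrable12ltyP; first by apply/measurable_EFinP; exact: measurable_tensor.
have ng : (\int[m2]_y `|(g y)%:E| < +oo)%E by have /integrableP[] := intg.
have nf : (\int[m1]_x `|(f x)%:E| < +oo)%E by have /integrableP[] := intf.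
rewrite (eq_integral (fun x => `|(f x)%:E| * \int[m2]_y `|(g y)%:E|)%E); last first.
  move=> x _; rewrite -ge0_integralZl//.
  - by apply: eq_integral => y _ /=; rewrite normrM.
  - by apply: measurableT_comp => //; exact: measurable_int intg.
rewrite ge0_integralZr//.
- apply: lte_mul_pinfty => //; first exact: integral_ge0.
  by rewrite ge0_fin_numE//; exact: integral_ge0.
- by apply: measurableT_comp => //; exact: measurable_int intf.
- exact: integral_ge0.
Qed.

Lemma Rintegral_tensor :
  Rintegral (m1 \x m2)%E setT (fun z => f z.1 * g z.2) =
  Rintegral m1 setT f * Rintegral m2 setT g.
Proof.
rewrite -RintegralZr//.
apply: EFin_inj; rewrite -!RintegralE//; last 2 first.
  have := integrableRZ measurableT (Rintegral m2 setT g) intf.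
  by under [in X in X -> _]eq_fun do rewrite mulrC.
  exact: integrable_tensor.
rewrite -(integral12_prod_meas1 integrable_tensor).
apply: eq_integral => x _; rewrite /fubini_F /=.
transitivity (\int[m2]_y ((f x)%:E * (g y)%:E))%E; first by apply: eq_integral.
by rewrite integralZl// RintegralE.
Qed.

End tensor.

Section independence.
Context d (Omega : measurableType d) (R : realType) (P : probability Omega R).
Variables (X Y : Omega -> R).
Local Notation rint X := (P.-integrable setT (EFin \o X)).
Local Notation E X := (\int[P]_w X w).
Hypothesis rX : rint X.
Hypothesis rY : rint Y.
Hypothesis XY : forall A B : set R, measurable A -> measurable B ->
  P (X @^-1` A `&` Y @^-1` B) = (P (X @^-1` A) * P (Y @^-1` B))%E.

(** Independence makes the joint law of X and Y the product of their laws. *)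
Lemma independent_E : rint (fun w => X w * Y w) /\
  E (fun w => X w * Y w) = E X * E Y.
Proof.
have mX := integrableR_measurable rX; have mY := integrableR_measurable rY.
pose X' := mfun_Sub (mem_set mX : X \in mfun).
pose Y' := mfun_Sub (mem_set mY : Y \in mfun).
have mZ : measurable_fun setT (fun w => (X w, Y w)) by exact: measurable_fun_pair.
pose Z' := mfun_Sub (mem_set mZ : (fun w => (X w, Y w)) \in mfun).
pose m1 := distribution P X'; pose m2 := distribution P Y'.
pose m := distribution P Z'.
have iX : m1.-integrable setT (EFin \o (fun x : R => x)).
  by apply: integrable_pushforward => //; exact/measurable_EFinP.
have iY : m2.-integrable setT (EFin \o (fun x : R => x)).
  by apply: integrable_pushforward => //; exact/measurable_EFinP.
have mE A : measurable A -> (m1 \x m2)%E A = m A.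
  apply: product_measure_unique => // B C mB mC.
  rewrite /m /m1 /m2 /distribution /pushforward /=.
have iT := integrable_tensor iX iY.
have mT := measurable_tensor iX iY.
have iZ : rint (fun w => X w * Y w).
  apply/integrableP; split; first exact/measurable_EFinP/measurable_funM.
  have /integrableP[_] := iT.
  rewrite (@eq_measure_integral _ _ _ _ m); last by move=> A mA _; exact: mE.
  rewrite /m ge0_integral_distribution//.
  by apply: measurableT_comp => //; exact/measurable_EFinP.
split=> //.
have := Rintegral_tensor iX iY; rewrite {1}/Rintegral.
rewrite (@eq_measure_integral _ _ _ _ m); last by move=> A mA _; exact: mE.
rewrite integral_distribution//; last exact/measurable_EFinP.
have e1 : Rintegral m1 setT (fun x : R => x) = E X.
  by rewrite /Rintegral integral_distribution//; exact/measurable_EFinP.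
have e2 : Rintegral m2 setT (fun x : R => x) = E Y.
  by rewrite /Rintegral integral_distribution//; exact/measurable_EFinP.
by rewrite e1 e2.
Qed.

End independence.

(** * Moments of Gaussian variables *)

Section gaussian_moments.
Context (R : realType) (s : R).
Hypothesis s0 : s != 0.
Local Notation mu := (@lebesgue_measure R).
Local Notation pdf := (normal_pdf 0 s).

(** The density is the Radon-Nikodym derivative of the law. *)
Lemma integral_normal_prob (f : R -> \bar R) (U : set R) :
  measurable U -> measurable_fun U f ->
  (\int[normal_prob 0 s]_(x in U) `|f x| < +oo)%E ->
  (\int[normal_prob 0 s]_(x in U) f x =
   \int[mu]_(x in U) (f x * (pdf x)%:E))%E.
Proof.
move=> mU mf finf.
rewrite -(Radon_Nikodym_change_of_variables (normal_prob_dominates 0 s))//=; last first.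
  by apply/integrableP; split.
apply: ae_eq_integral => //.
- apply: emeasurable_funM => //; apply: (measurable_int mu).
  apply: (integrableS _ _ (@subsetT _ _)) => //=.
  by apply: Radon_Nikodym_integrable; exact: normal_prob_dominates.
- apply: emeasurable_funM => //=; apply/measurableT_comp => //=.
  by apply/measurable_funTS; exact: measurable_normal_pdf.
- apply: ae_eqe_mul2l => /=.
  rewrite Radon_NikodymE//=; first exact: normal_prob_dominates.
  move=> abmu; case: cid => /= h [h1 h2 h3].
  apply: integral_ae_eq => //=.
  + exact: integrableS h2.
  + by apply/measurable_funTS/measurableT_comp =>//; exact: measurable_normal_pdf.
  + by move=> E E01 mE; rewrite -h3.
Qed.

Lemma is_derive_monomial_pdf p (x : R) :
  is_derive x 1 (fun x : R => x ^+ p * pdf x)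
    (p%:R * x ^+ p.-1 * pdf x - x ^+ p.+1 * pdf x / s ^+ 2).
Proof.
have -> : (fun x : R => x ^+ p * pdf x) = (@idfun R ^+ p) *
    (cst (normal_peak s) * (expR \o (cst (- (s ^+ 2 *+ 2)^-1) * (@idfun R ^+ 2)))).
  apply/funext => y; rewrite normal_pdfE// /normal_fun subr0 /=.
  rewrite fctE fctE; congr (_ * (_ * expR _)).
  by rewrite fctE fctE /= mulrC mulrN mulNr.
apply: is_derive_eq.
rewrite normal_pdfE// /normal_fun subr0.
rewrite /= ?fctE /GRing.scale /=.
rewrite -(mulr_natr (s ^+ 2)) !mulr0 !addr0 !mulr1 expr1.
rewrite (_ : - (s ^+ 2 * 2)^-1 * x ^+ 2 = - x ^+ 2 / (s ^+ 2 * 2)); last first.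
  by rewrite mulNr mulrC mulNr.
by rewrite (exprS x p); move: (expR _) (x ^+ p) (x ^+ p.-1) => e u v; field.
Qed.

Lemma continuous_monomial_pdf p : continuous (fun x : R => x ^+ p * pdf x).
Proof.
by move=> x; apply: differentiable_continuous; apply/derivable1_diffP;
  have [] := is_derive_monomial_pdf p x.
Qed.

(** Moments are first taken over [- A, A], where everything is continuous on a
compact interval and integration by parts applies. *)
Definition truncated_moment (A : R) p := \int[mu]_(x in `[- A, A]) (x ^+ p * pdf x).

Lemma integrable_monomial_pdf (a b : R) p :
  mu.-integrable `[a, b] (EFin \o (fun x : R => x ^+ p * pdf x)).
Proof.
apply: continuous_compact_integrable; first exact: segment_compact.
by apply: continuous_subspaceT => x; exact: continuous_monomial_pdf.
Qed.

(** Integration by parts: the derivative of x ^ p times the density. *)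
Lemma truncated_moment_rec A p : 0 < A ->
  p%:R * truncated_moment A p.-1 - truncated_moment A p.+1 / s ^+ 2 =
  (A ^+ p - (- A) ^+ p) * pdf A.
Proof.
move=> A0.
have i1 := integrable_monomial_pdf (- A) A p.-1.
have i2 := integrable_monomial_pdf (- A) A p.+1.
pose f x : R := p%:R * (x ^+ p.-1 * pdf x) - (s ^+ 2)^-1 * (x ^+ p.+1 * pdf x).
have j1 : mu.-integrable `[- A, A] (EFin \o (fun x => p%:R * (x ^+ p.-1 * pdf x))).
  by apply: integrableRZ => //; exact: i1.
have j2 : mu.-integrable `[- A, A] (EFin \o (fun x => (s ^+ 2)^-1 * (x ^+ p.+1 * pdf x))).
  by apply: integrableRZ => //; exact: i2.
have -> : p%:R * truncated_moment A p.-1 - truncated_moment A p.+1 / s ^+ 2 =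
    \int[mu]_(x in `[- A, A]) f x.
  rewrite RintegralB//.
  have -> : \int[mu]_(x in `[- A, A]) (p%:R * (x ^+ p.-1 * pdf x)) =
    p%:R * truncated_moment A p.-1 by apply: RintegralZl => //; exact: i1.
  have -> : \int[mu]_(x in `[- A, A]) ((s ^+ 2)^-1 * (x ^+ p.+1 * pdf x)) =
    (s ^+ 2)^-1 * truncated_moment A p.+1 by apply: RintegralZl => //; exact: i2.
  by congr (_ - _); exact: mulrC.
have pdfN : pdf (- A) = pdf A by rewrite normal_pdfE// /normal_fun !subr0 sqrrN.
have fE (x : R) : is_derive x 1 (fun x : R => x ^+ p * pdf x) (f x).
  apply: is_derive_eq (is_derive_monomial_pdf p x) _.
  by rewrite /f mulrA [X in _ - X]mulrC.
have := @continuous_FTC2 R f (fun x => x ^+ p * pdf x) (- A) A.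
rewrite /Rintegral => ->.
- by rewrite /= pdfN mulrBl.
- by rewrite gtrN.
- apply: continuous_subspaceT => x.
  apply: cvgB.
    by apply: cvgM; [exact: cvg_cst|exact: continuous_monomial_pdf].
  by apply: cvgM; [exact: cvg_cst|exact: continuous_monomial_pdf].
- split.
  + by move=> x _; have [] := fE x.
  + by apply: cvg_at_right_filter; exact: continuous_monomial_pdf.
  + by apply: cvg_at_left_filter; exact: continuous_monomial_pdf.
- by move=> x _; rewrite derive1E; have [_ ->] := fE x.
Qed.

Lemma truncated_moment_odd A p : 0 < A -> truncated_moment A (2 * p).+1 = 0.
Proof.
move=> A0; have s2 : (s ^+ 2)^-1 != 0 by rewrite invr_eq0 expf_neq0.
elim: p => [|p IH].
  have := truncated_moment_rec 0 A0.
  rewrite mul0r sub0r !expr0 subrr mul0r => /eqP.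
  by rewrite oppr_eq0 mulf_eq0 (negbTE s2) orbF => /eqP.
have := truncated_moment_rec (2 * p.+1) A0.
have -> : (2 * p.+1).-1 = (2 * p).+1 by rewrite mulnS.
rewrite IH mulr0 sub0r exprM exprM sqrrN subrr mul0r => /eqP.
by rewrite oppr_eq0 mulf_eq0 (negbTE s2) orbF => /eqP.
Qed.

(** The boundary term has a favourable sign, so truncation only decreases the
moments; the bound is (2 p - 1)!! s ^ (2 p). *)
Lemma truncated_moment_even_le A p : 0 < A ->
  truncated_moment A (2 * p) <= (\prod_(a < p) (2 * a + 1)%:R) * s ^+ (2 * p).
Proof.
move=> A0; elim: p => [|p IH].
  rewrite big_ord0 mul1r expr0 -lee_fin -RintegralE//; last first.
    exact: integrable_monomial_pdf.
  rewrite -(@integral_normal_pdf R 0 s).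
  under eq_integral do rewrite expr0 mul1r.
  apply: ge0_subset_integral => //; first by apply/measurable_EFinP; exact: measurable_normal_pdf.
  by move=> x _; rewrite lee_fin normal_pdf_ge0.
have := truncated_moment_rec (2 * p).+1 A0.
rewrite [_.-1]/= -[(2 * p).+2]/(2 + 2 * p)%N -mulnS.
have b0 : 0 <= (A ^+ (2 * p).+1 - (- A) ^+ (2 * p).+1) * pdf A.
  rewrite !exprS !exprM sqrrN mulNr opprK.
  by rewrite mulr_ge0 ?normal_pdf_ge0// addr_ge0 ?mulr_ge0 ?exprn_ge0 ?ltW// sqr_ge0.
move=> e; have s20 : 0 < s ^+ 2 by rewrite exprn_even_gt0.
have : truncated_moment A (2 * p.+1) / s ^+ 2 <=
    (2 * p).+1%:R * truncated_moment A (2 * p) by rewrite -subr_ge0 e.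
rewrite ler_pdivrMr// => h; apply: (le_trans h).
rewrite (_ : _ * s ^+ (2 * p.+1) =
    (2 * p).+1%:R * ((\prod_(a < p) (2 * a + 1)%:R) * s ^+ (2 * p)) * s ^+ 2).
  by apply: ler_wpM2r; [exact: ltW|apply: ler_wpM2l].
by rewrite big_ord_recr /= mulnS addn1 exprD; ring.
Qed.

(** The boundary terms of the second truncated moment are at most a constant
over the truncation level. *)
Lemma truncated_moment2_ge A : 0 < A ->
  s ^+ 2 * truncated_moment A 0 - 4 * s ^+ 4 * normal_peak s / A <=
  truncated_moment A 2.
Proof.
move=> A0; have s20 : 0 < s ^+ 2 by rewrite exprn_even_gt0.
have := truncated_moment_rec 1 A0; rewrite mul1r [_.-1]/= !expr1 opprK => e.
have -> : truncated_moment A 2 = s ^+ 2 * truncated_moment A 0 -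
    s ^+ 2 * ((A + A) * pdf A).
  by rewrite -e; field.
rewrite lerD2l lerN2 normal_pdfE// /normal_fun subr0.
set u := A ^+ 2 / (s ^+ 2 *+ 2).
have u0 : 0 < u by rewrite divr_gt0 ?exprn_gt0// pmulrn_lgt0.
(* exp (- u) <= 1 / u is enough decay for the boundary term. *)
have eu : expR (- A ^+ 2 / (s ^+ 2 *+ 2)) <= u^-1.
  rewrite mulNr expRN lef_pV2 ?posrE ?expR_gt0//.
  by apply: le_trans (expR_ge1Dx u); rewrite lerDr.
apply: (@le_trans _ _ (s ^+ 2 * ((A + A) * (normal_peak s * u^-1)))).
  apply: ler_wpM2l; first exact: ltW.
  apply: ler_wpM2l; first by rewrite addr_ge0// ltW.
  by apply: ler_wpM2l => //; exact: normal_peak_ge0.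
rewrite le_eqVlt; apply/orP; left; apply/eqP.
by rewrite /u -mulr_natr; field; rewrite s0 gt_eqF.
Qed.

End gaussian_moments.

Section gaussian_variable.
Context d (Omega : measurableType d) (R : realType) (P : probability Omega R).
Variables (Y : Omega -> R) (s : R).
Hypothesis s0 : s != 0.
Hypothesis mY : measurable_fun setT Y.
Hypothesis lawY : forall B : set R, measurable B -> P (Y @^-1` B) = normal_prob 0 s B.
Local Notation rint X := (P.-integrable setT (EFin \o X)).
Local Notation E X := (\int[P]_w X w).

Let trunc (A : R) p w := \1_(`[- A, A]%classic) (Y w) * Y w ^+ p.

Let measurable_trunc A p : measurable_fun setT (trunc A p).
Proof.
apply: measurable_funM; last exact: measurable_funX.
by apply: measurableT_comp => //; exact: measurable_indic.
Qed.

Let truncE A p : 0 < A -> rint (trunc A p) /\ E (trunc A p) = truncated_moment s A p.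
Proof.
move=> A0; have tA w : `|trunc A p w| <= A ^+ p.
  rewrite /trunc indicE; case: (boolP (_ \in _)) => [|_]; last first.
    by rewrite mul0r normr0 exprn_ge0// ltW.
  rewrite inE /= in_itv /= => YA; rewrite mul1r normrX lerXn2r ?nnegrE ?(ltW A0)//.
  by rewrite ler_norml.
have it : rint (trunc A p).
  apply: (integrableR_le _ _ _ (rint_cst P (A ^+ p))) => //.
split=> //; apply: EFin_inj; rewrite -RintegralE//.
have mY0 : @measurable_fun _ _ Omega (measurableTypeR R) setT Y by exact: mY.
pose Y' := @mfun_Sub _ _ Omega (measurableTypeR R) Y (mem_set mY0).
pose g (x : measurableTypeR R) : R := \1_(`[- A, A]%classic) x * x ^+ p.
have mg : measurable_fun setT g.
  by apply: measurable_funM; [exact: measurable_indic|exact: measurable_funX].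
transitivity (\int[distribution P Y']_x (g x)%:E)%E.
  by rewrite integral_distribution//; exact/measurable_EFinP.
have eN (h : measurableTypeR R -> \bar R) :
    (\int[distribution P Y']_x h x = \int[normal_prob 0 s]_x h x)%E.
  exact: (@eq_measure_integral _ (measurableTypeR R) R setT (normal_prob 0 s)
    (distribution P Y') h (fun B mB _ => lawY mB)).
rewrite eN.
rewrite integral_normal_prob//; last 2 first.
  exact/measurable_EFinP.
  rewrite -eN.
  rewrite ge0_integral_distribution//; last first.
    by apply: measurableT_comp => //; exact/measurable_EFinP.
  by have /integrableP[] := it.
rewrite /truncated_moment -RintegralE//; last exact: integrable_monomial_pdf.
rewrite [RHS]integral_mkcond; apply: eq_integral => x _.
rewrite /g patchE indicE; case: (x \in _); rewrite ?mul1r//.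
by rewrite !mul0r mul0e.
Qed.

Lemma gaussian_even_le p : rint (fun w => Y w ^+ (2 * p)) /\
  E (fun w => Y w ^+ (2 * p)) <= (\prod_(a < p) (2 * a + 1)%:R) * s ^+ (2 * p).
Proof.
apply: (@fatou_ae _ _ _ P (fun k => trunc k.+1%:R (2 * p))).
- by move=> k.
- move=> k w; rewrite /trunc indicE mulr_ge0//.
  by rewrite exprM exprn_ge0// sqr_ge0.
- exact: measurable_funX.
- by move=> w; rewrite exprM exprn_ge0// sqr_ge0.
- apply: aeW => w; apply: cvg_near_cst; near=> k.
  rewrite /trunc indicE mem_set ?mul1r//= in_itv/= -ler_norml.
  rewrite (@le_trans _ _ k%:R)// ?ler_nat//.
  near: k; exact: nbhs_infty_ger.
- move=> k; have [i1 e1] := @truncE k.+1%:R (2 * p) (ltr0Sn _ _).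
  by rewrite RintegralE// e1 lee_fin; exact: truncated_moment_even_le.
Unshelve. all: by end_near.
Qed.

Lemma gaussian_allmom : allmom P Y.
Proof. by apply: allmom_even => // q; have [] := gaussian_even_le q. Qed.

Lemma truncated_moment_cvg p :
  truncated_moment s k.+1%:R p @[k --> \oo] --> E (fun w => Y w ^+ p).
Proof.
have [_ iY] := gaussian_allmom.
have [|||||_ _] := @dominated_convergence _ _ _ P setT measurableT
  (fun k => EFin \o trunc k.+1%:R p) (EFin \o (fun w => Y w ^+ p))
  (EFin \o (fun w => `|Y w| ^+ p)).
- by move=> k; exact/measurable_EFinP.
- by apply/measurable_EFinP; exact: measurable_funX.
- apply: aeW => w _; apply: cvg_near_cst; near=> k.
  rewrite /trunc /= indicE mem_set ?mul1r//= in_itv/= -ler_norml.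
  rewrite (@le_trans _ _ k%:R)// ?ler_nat//.
  near: k; exact: nbhs_infty_ger.
- exact: rint_normX gaussian_allmom.
- apply: aeW => w k _ /=; rewrite lee_fin /trunc normrM normrX.
  by rewrite ler_piMl// indicE; case: (_ \in _); rewrite ?normr1 ?normr0.
rewrite RintegralE// => /fine_cvgP[_].
apply: cvg_trans; apply: near_eq_cvg; apply: nearW => k /=.
by have [_ <-] := @truncE k.+1%:R p (ltr0Sn _ _).
Unshelve. all: by end_near.
Qed.

Lemma gaussian_odd p : E (fun w => Y w ^+ (2 * p).+1) = 0.
Proof.
have h := @truncated_moment_cvg (2 * p).+1.
have e : (fun k => truncated_moment s k.+1%:R (2 * p).+1) = cst 0.
  by apply/funext => k; apply: truncated_moment_odd.
rewrite e in h; have := cvg_lim (@Rhausdorff R) h; by rewrite lim_cst// => <-.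
Qed.

Lemma gaussian_sqr : E (fun w => Y w ^+ 2) = s ^+ 2.
Proof.
apply/eqP; rewrite eq_le; apply/andP; split.
  have [_] := gaussian_even_le 1; rewrite big_ord_recl big_ord0 !mulr1 muln0 add0n mul1r.
  by [].
have h0 := @truncated_moment_cvg 0; have h2 := @truncated_moment_cvg 2.
have e0 : E (fun w => Y w ^+ 0) = 1.
  by under eq_Rintegral do rewrite expr0; exact: E_cst.
rewrite e0 in h0.
have hl : s ^+ 2 * truncated_moment s k.+1%:R 0 - 4 * s ^+ 4 * normal_peak s / k.+1%:R
    @[k --> \oo] --> s ^+ 2 * 1 - 4 * s ^+ 4 * normal_peak s * 0.
  apply: cvgB; first by apply: cvgM => //; exact: cvg_cst.
  by apply: cvgM; [exact: cvg_cst|exact: cvg_harmonic].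
rewrite mulr1 mulr0 subr0 in hl.
apply: ler_cvg_to hl h2 _; apply: nearW => k.
exact: truncated_moment2_ge.
Qed.

End gaussian_variable.

(** * Increments of the Wiener process *)

Section measurability_wrt.
Context (R : realType) d (Omega : measurableType d).
Variable (G : set_system Omega).
Hypothesis sG : sigma_algebra setT G.

(** Adapted variables are the measurable functions of another measurable structure,
which gives access to their closure properties. *)
Lemma measurable_wrtP (X : Omega -> R) :
  measurable_wrt G X <->
  @measurable_fun _ _ (g_sigma_algebraType G) R setT X.
Proof.
split=> [h _ B mB|h A [B mB <-]].
  by apply: sub_sigma_algebra; apply: h; exists B.
by have := h measurableT B mB; rewrite /measurable /= (sigma_algebra_id sG).
Qed.

Lemma measurable_wrt_cst (c : R) : measurable_wrt G (fun=> c).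
Proof. by apply/measurable_wrtP; exact: measurable_cst. Qed.

Lemma measurable_wrtD (X Y : Omega -> R) : measurable_wrt G X ->
  measurable_wrt G Y -> measurable_wrt G (fun w => X w + Y w).
Proof.
move=> /measurable_wrtP mX /measurable_wrtP mY; apply/measurable_wrtP.
exact: measurable_funD.
Qed.

Lemma measurable_wrtB (X Y : Omega -> R) : measurable_wrt G X ->
  measurable_wrt G Y -> measurable_wrt G (fun w => X w - Y w).
Proof.
move=> /measurable_wrtP mX /measurable_wrtP mY; apply/measurable_wrtP.
exact: measurable_funB.
Qed.

Lemma measurable_wrtM (X Y : Omega -> R) : measurable_wrt G X ->
  measurable_wrt G Y -> measurable_wrt G (fun w => X w * Y w).
Proof.
move=> /measurable_wrtP mX /measurable_wrtP mY; apply/measurable_wrtP.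
exact: measurable_funM.
Qed.

Lemma measurable_wrtX (X : Omega -> R) p : measurable_wrt G X ->
  measurable_wrt G (fun w => X w ^+ p).
Proof. by move=> /measurable_wrtP mX; apply/measurable_wrtP; exact: measurable_funX. Qed.

Lemma measurable_wrtZ (c : R) (X : Omega -> R) : measurable_wrt G X ->
  measurable_wrt G (fun w => c * X w).
Proof. by move=> /measurable_wrtP mX; apply/measurable_wrtP; exact: measurable_funM. Qed.

Lemma measurable_wrt_sum I (s : seq I) (h : I -> Omega -> R) :
  (forall i, measurable_wrt G (h i)) ->
  measurable_wrt G (fun w => \sum_(i <- s) h i w).
Proof.
move=> H; elim: s => [|a s IH].
  by under eq_fun do rewrite big_nil; exact: measurable_wrt_cst.
under eq_fun do rewrite big_cons; exact: measurable_wrtD.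
Qed.

End measurability_wrt.

Section increments.
Context (R : realType) d (Omega : measurableType d) (P : probability Omega R).
Variables (T : R) (F : R -> set_system Omega) (m : nat) (f : 'I_m -> R -> Omega -> R).
Hypothesis hF : filtration T F.
Hypothesis hW : wiener P T F f.
Local Notation rint X := (P.-integrable setT (EFin \o X)).
Local Notation E X := (\int[P]_w X w).

Lemma filtration_sigma s : 0 <= s <= T -> sigma_algebra setT (F s).
Proof. by move=> sT; have [H _ _ _] := hF; exact: H. Qed.

Lemma adapted_le s u (X : Omega -> R) : 0 <= s -> s <= u -> u <= T ->
  measurable_wrt (F s) X -> measurable_wrt (F u) X.
Proof.
move=> s0 su uT mX A XA; have [_ _ H _] := hF.
by apply: (H s u) => //; exact: mX.
Qed.

Lemma adapted_measurable s (X : Omega -> R) : 0 <= s <= T ->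
  measurable_wrt (F s) X -> measurable_fun setT X.
Proof.
move=> sT mX _ B mB; have [_ H _ _] := hF.
by apply: (H s sT); apply: mX; exists B.
Qed.

Definition increment i s u w := f i u w - f i s w.

Lemma increment_adapted i s u : 0 <= s -> s <= u -> u <= T ->
  measurable_wrt (F u) (increment i s u).
Proof.
move=> s0 su uT; apply: measurable_wrtB; first by apply: filtration_sigma; rewrite uT (le_trans s0).
- by apply: (wiener_adapted hW); rewrite uT (le_trans s0).
- by apply: (adapted_le s0 su uT); apply: (wiener_adapted hW); rewrite s0 (le_trans su).
Qed.

Lemma measurable_increment i s u : 0 <= s -> s <= u -> u <= T ->
  measurable_fun setT (increment i s u).
Proof.
move=> s0 su uT; apply: (@adapted_measurable u); first by rewrite uT (le_trans s0).
exact: increment_adapted.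
Qed.

Lemma increment_moments i s u : 0 <= s -> s <= u -> u <= T ->
  [/\ allmom P (increment i s u),
      forall p, E (fun w => increment i s u w ^+ (2 * p).+1) = 0,
      E (fun w => increment i s u w ^+ 2) = u - s &
      forall p, E (fun w => increment i s u w ^+ (2 * p)) <=
        (\prod_(a < p) (2 * a + 1)%:R) * (u - s) ^+ p].
Proof.
move=> s0; rewrite le_eqVlt => /predU1P[<- uT|su uT].
  have e w : increment i s s w = 0 by rewrite /increment subrr.
  rewrite (funext e : increment i s s = (fun=> 0)); split.
  - exact: allmom_cst.
  - by move=> p; under eq_Rintegral do rewrite expr0n; rewrite E_cst.
  - by under eq_Rintegral do rewrite expr0n; rewrite E_cst subrr.
  - move=> p; under eq_Rintegral do rewrite expr0n; rewrite E_cst subrr expr0n.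
    rewrite muln_eq0 /=; case: p => [|p]; first by rewrite big_ord0 mul1r.
    by rewrite mulr0.
have su0 : 0 < u - s by rewrite subr_gt0.
have n0 : Num.sqrt (u - s) != 0 by rewrite gt_eqF// sqrtr_gt0.
have mI := measurable_increment i s0 (ltW su) uT.
have law := wiener_normal hW i s0 su uT.
have sq : Num.sqrt (u - s) ^+ 2 = u - s by rewrite sqr_sqrtr// ltW.
split.
- exact: (gaussian_allmom n0 mI law).
- exact: (gaussian_odd n0 mI law).
- by rewrite (gaussian_sqr n0 mI law).
- move=> p; have [_] := gaussian_even_le n0 mI law p.
  by rewrite [Num.sqrt _ ^+ _]exprM sq.
Qed.

(** The increments after time s are independent of the past of s. *)
Lemma increment_indep i s u (X : Omega -> R) p : 0 <= s -> s <= u -> u <= T ->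
  measurable_wrt (F s) X -> rint X ->
  rint (fun w => X w * increment i s u w ^+ p) /\
  E (fun w => X w * increment i s u w ^+ p) =
  E X * E (fun w => increment i s u w ^+ p).
Proof.
move=> s0 su uT mX iX; have [aI _ _ _] := increment_moments i s0 su uT.
apply: independent_E => //; first exact: aI.2.
move=> A B mA mB.
apply: (wiener_indep_past hW s0 su uT).
  by apply: mX; exists A => //; rewrite setTI.
apply: sub_sigma_algebra; exists i => //.
exists ((fun x : R => x ^+ p) @^-1` B).
  by rewrite -[X in measurable X]setTI; exact: exprn_measurable.
by rewrite setTI.
Qed.

Lemma E_increment i s u (X : Omega -> R) : 0 <= s -> s <= u -> u <= T ->
  measurable_wrt (F s) X -> rint X ->
  rint (fun w => X w * increment i s u w) /\
  E (fun w => X w * increment i s u w) = 0.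
Proof.
move=> s0 su uT mX iX; have [_ o _ _] := increment_moments i s0 su uT.
have [] := increment_indep i 1 s0 su uT mX iX.
have := o 0%N; rewrite muln0 => ->; rewrite mulr0.
by split.
Qed.

Lemma E_increment_sqr i s u (X : Omega -> R) : 0 <= s -> s <= u -> u <= T ->
  measurable_wrt (F s) X -> rint X ->
  rint (fun w => X w * increment i s u w ^+ 2) /\
  E (fun w => X w * increment i s u w ^+ 2) = E X * (u - s).
Proof.
move=> s0 su uT mX iX; have [_ _ <- _] := increment_moments i s0 su uT.
exact: increment_indep.
Qed.

Lemma sqint_increment i s u (X : Omega -> R) : 0 <= s -> s <= u -> u <= T ->
  measurable_wrt (F s) X -> sqint P X ->
  sqint P (fun w => X w * increment i s u w).
Proof.
move=> s0 su uT mX [mX' iX]; split.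
  by apply: measurable_funM => //; exact: measurable_increment.
under eq_fun do rewrite exprMn.
apply: (E_increment_sqr i s0 su uT _ iX).1.
by apply: measurable_wrtX => //; apply: filtration_sigma; rewrite s0 (le_trans su).
Qed.

(** Two increments starting at the same time share the shorter one. *)
Lemma E_increment2 i s c e (X : Omega -> R) : 0 <= s -> s <= c -> c <= e -> e <= T ->
  measurable_wrt (F s) X -> rint X ->
  rint (fun w => X w * (increment i s c w * increment i s e w)) /\
  E (fun w => X w * (increment i s c w * increment i s e w)) = E X * (c - s).
Proof.
move=> s0 sc ce eT mX iX; have cT := le_trans ce eT; have c0 := le_trans s0 sc.
have [i1 e1] := E_increment_sqr i s0 sc cT mX iX.
have [j _] := E_increment i s0 sc cT mX iX.
have mXc : measurable_wrt (F c) (fun w => X w * increment i s c w).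
  apply: measurable_wrtM; first by apply: filtration_sigma; rewrite c0.
    exact: adapted_le mX.
  exact: increment_adapted.
have [i2 e2] := E_increment i c0 ce eT mXc j.
have eq w : X w * (increment i s c w * increment i s e w) =
    X w * increment i s c w ^+ 2 + X w * increment i s c w * increment i c e w.
  by rewrite /increment; ring.
rewrite (funext eq); split; first exact: integrableRD.
by rewrite RintegralD// e1 e2 addr0.
Qed.

(** The length of the intersection of [u, v] and [u', v']. *)
Definition overlap (u v u' v' : R) := Num.max 0 (Num.min v v' - Num.max u u').

Lemma overlapC u v u' v' : overlap u v u' v' = overlap u' v' u v.
Proof. by rewrite /overlap minC maxC [Num.max u u']maxC [RHS]maxC. Qed.

(** Bilinear form of the Ito isometry: only the part of the two intervals that
they share contributes. Stated for pairs of intervals, it applies to families of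
overlapping intervals without refining them. *)
Lemma E_increment_pair i u v u' v' (h h' : Omega -> R) :
  0 <= u -> u <= v -> v <= T -> 0 <= u' -> u' <= v' -> v' <= T ->
  measurable_wrt (F u) h -> measurable_wrt (F u') h' ->
  sqint P h -> sqint P h' ->
  E (fun w => (h w * increment i u v w) * (h' w * increment i u' v' w)) =
  E (fun w => h w * h' w) * overlap u v u' v'.
Proof.
wlog uu' : u v u' v' h h' / u <= u'.
  move=> H; have [|/ltW] := leP u u'; first exact: H.
  move=> le u0 uv vT u0' uv' vT' mh mh' sh sh'.
  rewrite overlapC; have := H _ _ _ _ _ _ le u0' uv' vT' u0 uv vT mh' mh sh' sh.
  have -> : E (fun w => h' w * h w) = E (fun w => h w * h' w).
    by apply: eq_Rintegral => w _; exact: mulrC.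
  by move=> <-; apply: eq_Rintegral => w _; exact: mulrC.
move=> u0 uv vT u0' uv' vT' mh mh' sh sh'.
have uT' : u' <= T := le_trans uv' vT'.
have mh2 : measurable_wrt (F u') h := adapted_le u0 uu' uT' mh.
have sF : sigma_algebra setT (F u') by apply: filtration_sigma; rewrite u0'.
have shD := sqint_increment i u0 uv vT mh sh.
have [vu|uv2] := leP v u'.
  have -> : overlap u v u' v' = 0.
    rewrite /overlap; apply/max_idPl.
    by rewrite (max_idPr uu') (min_idPl (le_trans vu uv')) subr_le0.
  rewrite mulr0.
  have [_ <-] := E_increment (X := fun w => (h w * increment i u v w) * h' w)
    i u0' uv' vT' (measurable_wrtM sF (measurable_wrtM sF mh2
      (adapted_le (le_trans u0 uv) vu uT' (@increment_adapted i _ _ u0 uv vT))) mh')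
    (sqintM shD sh').
  by apply: eq_Rintegral => w _; rewrite mulrA.
have uv2' := ltW uv2.
have shD1 := sqint_increment i u0 uu' uT' mh sh.
have mhh : measurable_wrt (F u') (fun w => h w * h' w) by exact: measurable_wrtM.
have ihh := sqintM sh sh'.
have [i1 e1] := E_increment (X := fun w => (h w * increment i u u' w) * h' w)
    i u0' uv' vT' (measurable_wrtM sF (measurable_wrtM sF mh2
      (@increment_adapted i _ _ u0 uu' uT')) mh') (sqintM shD1 sh').
have [i2 e2] : rint (fun w => h w * h' w * (increment i u' v w * increment i u' v' w)) /\
    E (fun w => h w * h' w * (increment i u' v w * increment i u' v' w)) =
    E (fun w => h w * h' w) * overlap u v u' v'.
  rewrite /overlap (max_idPr uu').
  have [vv|/ltW vv] := leP v v'.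
    rewrite (max_idPr _) ?subr_ge0//.
    exact: (E_increment2 i u0' uv2' vv vT' mhh ihh).
  rewrite (max_idPr _) ?subr_ge0//.
  have [j1 j2] := E_increment2 i u0' uv' vv vT mhh ihh.
  have eq w : h w * h' w * (increment i u' v w * increment i u' v' w) =
    h w * h' w * (increment i u' v' w * increment i u' v w) by ring.
  by rewrite (funext eq).
rewrite -e2 -[RHS]add0r -e1 -RintegralD//.
by apply: eq_Rintegral => w _; rewrite /increment; ring.
Qed.

End increments.

(** * The Ito isometry *)

Section ito.
Context (R : realType) d (Omega : measurableType d) (P : probability Omega R).
Variables (T : R) (F : R -> set_system Omega) (m : nat) (f : 'I_m -> R -> Omega -> R).
Hypothesis hF : filtration T F.
Hypothesis hW : wiener P T F f.
Local Notation rint X := (P.-integrable setT (EFin \o X)).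
Local Notation E X := (\int[P]_w X w).
Local Notation mu := (@lebesgue_measure R).

(** Integral of a simple process carried by an arbitrary finite family of
intervals. The intervals may overlap, so that simple processes can be added
without a common partition. *)
Definition simple_int (J : finType) (W : R -> Omega -> R) (u v : J -> R)
    (h : J -> Omega -> R) (w : Omega) : R :=
  \sum_(j : J) h j w * (W (v j) w - W (u j) w).

Definition simple_proc (J : finType) (u v : J -> R) (h : J -> Omega -> R)
    (r : R) (w : Omega) : R :=
  \sum_(j : J) h j w * \1_(`[u j, v j[%classic) r.

Definition simple_family (a b : R) (J : finType) (u v : J -> R)
    (h : J -> Omega -> R) :=
  forall j, [/\ a <= u j, u j <= v j, v j <= b,
    measurable_wrt (F (u j)) (h j) & sqint P (h j)].

Lemma integrable_indic2 (a b u v u' v' : R) :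
  mu.-integrable `[a, b] (EFin \o (fun r : R => \1_(`[u, v[%classic) r * \1_(`[u', v'[%classic) r)).
Proof.
apply: measurable_bounded_integrable => //.
- by rewrite /= lebesgue_measure_itv /=; case: ifP => _; rewrite ?ltry// -EFinB ltry.
- by apply: measurable_funM; apply: measurable_funTS; exact: measurable_indic.
- exists 1; split; first exact: num_real.
  move=> M M1 r _; rewrite /= !indicE; apply: le_trans (ltW M1).
  by case: (_ \in _); case: (_ \in _); rewrite ?(mulr1, mulr0, mul0r, normr1, normr0).
Qed.

Lemma Rintegral_indic2 (a b u v u' v' : R) : a <= u -> v <= b ->
  \int[mu]_(r in `[a, b]) (\1_(`[u, v[%classic) r * \1_(`[u', v'[%classic) r)
  = overlap u v u' v'.
Proof.
move=> au vb.
have -> : (fun r : R => \1_(`[u, v[%classic) r * \1_(`[u', v'[%classic) r) =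
    (\1_(`[Num.max u u', Num.min v v'[%classic) : R -> R).
  apply/funext => r; rewrite !indicE -natrM mulnb; congr (_%:R); congr nat_of_bool.
  rewrite !mem_setE !in_itv /= ge_max lt_min.
  by case: (u <= r); case: (u' <= r); case: (r < v); case: (r < v').
rewrite /Rintegral integral_indic//= setIidl; last first.
  move=> r /=; rewrite !in_itv/= ge_max lt_min => /andP[/andP[ur _] /andP[rv _]].
  by rewrite (le_trans au ur) (le_trans (ltW rv) vb).
rewrite lebesgue_measure_itv /= lte_fin /overlap; case: ltP => h.
  by rewrite -EFinB /=; apply/esym/max_idPr; rewrite subr_ge0 ltW.
by apply/esym/max_idPl; rewrite subr_le0.
Qed.

Section simple_family.
Variables (a b : R) (J : finType) (i : 'I_m) (u v : J -> R) (h : J -> Omega -> R).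
Hypotheses (a0 : 0 <= a) (bT : b <= T).
Hypothesis fam : simple_family a b u v h.

Let sq j : sqint P (fun w => h j w * (f i (v j) w - f i (u j) w)).
Proof.
have [au uv vb mh sh] := fam j.
by apply: (sqint_increment hF hW) => //; [exact: le_trans au|exact: le_trans bT].
Qed.

Lemma sqint_simple_int : sqint P (simple_int (f i) u v h).
Proof. by apply: sqint_sum => j _; exact: sq. Qed.

Lemma sqint_simple_proc r : sqint P (simple_proc u v h r).
Proof.
apply: sqint_sum => j _; under eq_fun do rewrite mulrC; apply: sqintZ.
by have [] := fam j.
Qed.

Lemma E_simple_proc_sqr r :
  E (fun w => simple_proc u v h r w ^+ 2) =
  \sum_j \sum_j' E (fun w => h j w * h j' w) *
    (\1_(`[u j, v j[%classic) r * \1_(`[u j', v j'[%classic) r).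
Proof.
have hh j j' : rint (fun w => h j w * h j' w).
  by apply: sqintM; [have [] := fam j|have [] := fam j'].
transitivity (E (fun w => \sum_j \sum_j'
    (\1_(`[u j, v j[%classic) r * \1_(`[u j', v j'[%classic) r) * (h j w * h j' w))).
  apply: eq_Rintegral => w _; rewrite expr2 big_distrlr /=.
  by apply: eq_bigr => j _; apply: eq_bigr => j' _; ring.
rewrite Rintegral_sum//; last first.
  by move=> j _; apply: integrableR_sum => // j' _; exact: integrableRZ.
apply: eq_bigr => j _; rewrite Rintegral_sum//; last by move=> j' _; exact: integrableRZ.
by apply: eq_bigr => j' _; rewrite (RintegralZl _ measurableT (hh j j')) mulrC.
Qed.

Lemma integrable_E_simple_proc :
  mu.-integrable `[a, b] (EFin \o (fun r => E (fun w => simple_proc u v h r w ^+ 2))).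
Proof.
rewrite (funext E_simple_proc_sqr).
apply: integrableR_sum => // j _; apply: integrableR_sum => // j' _.
by apply: integrableRZ => //; exact: integrable_indic2.
Qed.

(** Both sides expand over pairs of intervals; the integral of the product of two
indicators is the length of their overlap. *)
Lemma isometry_simple :
  E (fun w => simple_int (f i) u v h w ^+ 2) =
  \int[mu]_(r in `[a, b]) E (fun w => simple_proc u v h r w ^+ 2).
Proof.
rewrite (funext E_simple_proc_sqr).
rewrite Rintegral_sum//; last first.
  move=> j _; apply: integrableR_sum => // j' _.
  by apply: integrableRZ => //; exact: integrable_indic2.
under [RHS]eq_bigr do (rewrite Rintegral_sum//; last
  by move=> j' _; apply: integrableRZ => //; exact: integrable_indic2).
transitivity (E (fun w => \sum_j \sum_j'
    (h j w * (f i (v j) w - f i (u j) w)) * (h j' w * (f i (v j') w - f i (u j') w)))).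
  by apply: eq_Rintegral => w _; rewrite expr2 big_distrlr.
rewrite Rintegral_sum//; last first.
  by move=> j _; apply: integrableR_sum => // j' _; exact: sqintM.
apply: eq_bigr => j _; rewrite Rintegral_sum//; last by move=> j' _; exact: sqintM.
apply: eq_bigr => j' _.
have [au uv vb mh sh] := fam j; have [au' uv' vb' mh' sh'] := fam j'.
rewrite RintegralZl//; last exact: integrable_indic2.
rewrite Rintegral_indic2//.
by apply: (E_increment_pair hF hW) => //;
  by [exact: le_trans au|exact: le_trans bT|exact: le_trans au'].
Qed.

Lemma isometry_le A : a <= b -> 0 <= A ->
  (forall r, a <= r < b -> E (fun w => simple_proc u v h r w ^+ 2) <= A) ->
  E (fun w => simple_int (f i) u v h w ^+ 2) <= A * (b - a).
Proof.
move=> ab A0 H; rewrite isometry_simple.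
have -> : A * (b - a) = \int[mu]_(r in `[a, b]) A.
  rewrite Rintegral_cst// /= lebesgue_measure_itv /= lte_fin.
  case: ltP => [|ba]; first by rewrite -EFinB.
  by rewrite (@le_anti _ _ a b) ?subrr// ab.
apply: le_Rintegral => //.
- exact: integrable_E_simple_proc.
- apply: continuous_compact_integrable; first exact: segment_compact.
  by apply: continuous_subspaceT => x; exact: cvg_cst.
- move=> r /=; rewrite in_itv /= => /andP[ar]; rewrite le_eqVlt => /predU1P[->|rb].
    rewrite (@eq_Rintegral _ _ _ P setT (fun=> 0)); first by rewrite E_cst.
    move=> w _; rewrite /simple_proc big1 ?expr0n// => j _.
    have [_ _ vb _ _] := fam j.
    by rewrite indicE memNset ?mulr0//= in_itv /= ltNge vb andbF.
  by apply: H; rewrite ar.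
Qed.

End simple_family.

Section difference.
Variables (a b : R) (J J' : finType) (W : R -> Omega -> R).
Variables (u v : J -> R) (h : J -> Omega -> R).
Variables (u' v' : J' -> R) (h' : J' -> Omega -> R).

Let U (j : J + J') := match j with inl x => u x | inr x => u' x end.
Let V (j : J + J') := match j with inl x => v x | inr x => v' x end.
Let H (j : J + J') := match j with inl x => h x | inr x => (fun w => - h' x w) end.

(** Disjoint union of the two families, with the sign changed on the second. *)
Lemma simple_family_sub (aT : 0 <= a <= T) (bT : b <= T) :
  simple_family a b u v h -> simple_family a b u' v' h' ->
  exists (K : finType) (u0 v0 : K -> R) (h0 : K -> Omega -> R),
  [/\ simple_family a b u0 v0 h0,
   forall w, simple_int W u0 v0 h0 w = simple_int W u v h w - simple_int W u' v' h' w &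
   forall r w, simple_proc u0 v0 h0 r w = simple_proc u v h r w - simple_proc u' v' h' r w].
Proof.
move=> f1 f2; exists (J + J')%type, U, V, H; split.
- case=> j /=; first exact: f1.
  have [au uv vb mh sh] := f2 j; split=> //.
    have sF : sigma_algebra setT (F (u' j)).
      apply: (filtration_sigma hF); case/andP: aT => a0 _.
      by rewrite (le_trans a0 au) (le_trans uv (le_trans vb bT)).
    by have := measurable_wrtZ sF (c := -1) mh; under [in X in X -> _]eq_fun do rewrite mulN1r.
  by have := sqintZ (-1) sh; under [in X in X -> _]eq_fun do rewrite mulN1r.
- move=> w; rewrite /simple_int big_sumType /=; congr (_ + _).
  by rewrite -sumrN; apply: eq_bigr => j _; rewrite mulNr.
- move=> r w; rewrite /simple_proc big_sumType /=; congr (_ + _).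
  by rewrite -sumrN; apply: eq_bigr => j _; rewrite mulNr.
Qed.

End difference.

End ito.

Section ito_estimate.
Context (R : realType) d (Omega : measurableType d) (P : probability Omega R).
Variables (T : R) (F : R -> set_system Omega) (m : nat) (f : 'I_m -> R -> Omega -> R).
Hypothesis hF : filtration T F.
Hypothesis hW : wiener P T F f.
Local Notation rint X := (P.-integrable setT (EFin \o X)).
Local Notation E X := (\int[P]_w X w).
Local Notation mu := (@lebesgue_measure R).

Lemma partition_le (a b : R) q (s : nat -> R) j j' : partition_of a b q s ->
  (j <= j')%N -> (j' <= q)%N -> s j <= s j'.
Proof.
move=> [_ _ H]; elim: j' => [|j' IH]; first by rewrite leqn0 => /eqP ->.
rewrite leq_eqVlt => /predU1P[->//|jj' j'q].
by apply: le_trans (ltW (H _ j'q)); apply: IH => //; exact: ltnW.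
Qed.

Lemma sqint_expectation (X : Omega -> R) : measurable_fun setT X ->
  ('E_P[fun w => (X w ^+ 2)%R] < +oo)%E -> sqint P X.
Proof.
move=> mX; rewrite expectation.unlock => H; split=> //.
apply: integrableR_ge0 => //; first exact: measurable_funX.
by move=> w _; exact: sqr_ge0.
Qed.

(** Tonelli's theorem, after extending X by 0 outside of [a, b]. *)
Lemma measurable_E_sqr (a b : R) (X : R -> Omega -> R) :
  measurable_fun (`[a, b] `*` [set: Omega])
    (fun p : measurableTypeR R * Omega => X p.1 p.2) ->
  @measurable_fun _ _ (measurableTypeR R) _ (`[a, b]%classic : set (measurableTypeR R))
    (fun r => 'E_P[fun w => (X r w ^+ 2)%R])%E.
Proof.
move=> mX; rewrite expectation.unlock.
pose D : set (measurableTypeR R * Omega) := `[a, b] `*` [set: Omega].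
have mD : measurable D by apply: measurableX => //; exact: measurable_itv.
have mk : measurable_fun setT
    (fun p => ((((fun p : measurableTypeR R * Omega => X p.1 p.2) \_ D) p) ^+ 2)%:E).
  by apply/measurable_EFinP/measurable_funX/(measurable_restrictT _ mD).
have k0 p : (0 <= ((((fun p : measurableTypeR R * Omega => X p.1 p.2) \_ D) p) ^+ 2)%:E)%E.
  by rewrite lee_fin sqr_ge0.
have := @measurable_fun_fubini_tonelli_F _ _ (measurableTypeR R) Omega R P _ mk k0.
move=> /(measurable_funTS (D := `[a, b]%classic)).
apply: eq_measurable_fun => r rab; apply: eq_integral => w _.
rewrite patchE mem_set//=; split=> //.
by move: rab; rewrite inE.
Qed.

(** The Ito integral stays within the mean-square distance of its integrand
from any adapted simple process, however that process is partitioned. *)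
Lemma ito_estimate (a b : R) i (xi : R -> Omega -> R) (I0 : Omega -> R)
    (J : finType) (u v : J -> R) (h : J -> Omega -> R) (A : R) :
  0 <= a -> a <= b -> b <= T ->
  is_ito P F (f i) a b xi I0 ->
  simple_family P F a b u v h ->
  0 <= A ->
  (forall r, a <= r < b ->
     ('E_P[fun w => ((simple_proc u v h r w - xi r w) ^+ 2)%R] <= A%:E)%E) ->
  sqint P (fun w => simple_int (f i) u v h w - I0 w) /\
  E (fun w => (simple_int (f i) u v h w - I0 w) ^+ 2) <= 4 * A * (b - a).
Proof.
move=> a0 ab bT [[mxi axi _] [q [s [hh [part had cvgh lims]]]]] fam A0 HA.
pose uN N (j : 'I_(q N)) := s N j; pose vN N (j : 'I_(q N)) := s N j.+1.
pose hN N (j : 'I_(q N)) := hh N j.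
have aT : 0 <= a <= T by rewrite a0 (le_trans ab).
have famN N : simple_family P F a b (uN N) (vN N) (hN N).
  move=> j; have [e1 e2 _] := part N; have jq := ltn_ord j.
  have l1 : a <= s N j by rewrite -e1; apply: (partition_le (part N)) => //; exact: ltnW.
  have l2 : s N j <= s N j.+1 by apply: (partition_le (part N)).
  have l3 : s N j.+1 <= b by rewrite -e2; apply: (partition_le (part N)).
  have [mh ih] := had N j jq; split=> //.
  apply: sqint_expectation => //; apply: (adapted_measurable hF _ mh).
  by rewrite (le_trans a0 l1) (le_trans l2 (le_trans l3 bT)).
have sI N := sqint_simple_int hF hW i a0 bT (famN N).
have msI : msconv P (fun N => simple_int (f i) (uN N) (vN N) (hN N)) I0.
  by apply/lim_msP => // N; case: (sI N).
have cvg2 e : 0 < e -> exists N0, forall N, (N0 <= N)%N ->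
   (\int[mu]_(r in `[a, b])
     'E_P[fun w => ((simple_proc (uN N) (vN N) (hN N) r w - xi r w) ^+ 2)%R] < e%:E)%E.
  move=> e0; move: cvgh => /fine_cvgP[[N1 _ H1] /cvgr0Pnorm_lt/(_ _ e0)[N2 _ H2]].
  exists (maxn N1 N2) => N; rewrite geq_max => /andP[/H1 fN /H2 /= lN].
  rewrite -(fineK fN) lte_fin; apply: le_lt_trans lN; exact: ler_norm.
have sS := sqint_simple_int hF hW i a0 bT fam.
(* Isometry for the difference with the N-th step process that defines the Ito
integral, for N large; the integrand xi itself is never integrated. *)
have main e : 0 < e -> sqint P (fun w => simple_int (f i) u v h w - I0 w) /\
    E (fun w => (simple_int (f i) u v h w - I0 w) ^+ 2) <= 4 * A * (b - a) + 6 * e.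
  move=> e0; have [N1 H1] := msconv_lt msI e0; have [N2 H2] := cvg2 _ e0.
  have [s1 l1] := H1 _ (leq_maxl N1 N2); have l2 := H2 _ (leq_maxr N1 N2).
  set N := maxn N1 N2 in s1 l1 l2.
  have [K [u0 [v0 [h0 [fam0 int0 proc0]]]]] :=
    simple_family_sub hF (f i) aT bT fam (famN N).
  pose Q r := ('E_P[fun w => ((simple_proc (uN N) (vN N) (hN N) r w - xi r w) ^+ 2)%R])%E.
  have Q0 r : (0 <= Q r)%E.
    by rewrite /Q expectation.unlock; apply: integral_ge0 => w _; rewrite lee_fin sqr_ge0.
  have mQ : measurable_fun (`[a, b]%classic : set (measurableTypeR R)) Q.
    apply: measurable_E_sqr; apply: measurable_funB => //.
    apply: measurable_funTS; apply: measurable_sum => j.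
    have mhj : measurable_fun setT (hN N j) by have [_ _ _ _ []] := famN N j.
    apply: measurable_funM; first exact: measurableT_comp mhj measurable_snd.
    apply: measurableT_comp measurable_fst; exact: measurable_indic.
  have mx r : a <= r <= b -> measurable_fun setT (xi r).
    move=> /andP[ar rb]; apply: (adapted_measurable hF _ (axi r _)); last by rewrite ar.
    by rewrite (le_trans a0 ar) (le_trans rb bT).
  have pw r : a <= r < b ->
      ((E (fun w => simple_proc u0 v0 h0 r w ^+ 2))%:E <= (2 * A)%:E + 2%:E * Q r)%E.
    move=> rab; have s0 := sqint_simple_proc fam0 r.
    have rab' : a <= r <= b by case/andP: rab => -> /ltW.
    have sp := sqint_simple_proc fam r; have sN := sqint_simple_proc (famN N) r.
    pose X1 w := simple_proc u v h r w - xi r w.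
    pose X2 w := simple_proc (uN N) (vN N) (hN N) r w - xi r w.
    have m1 : measurable_fun setT (fun w => (X1 w ^+ 2)%:E).
      by apply/measurable_EFinP/measurable_funX/measurable_funB; [exact: sp.1|exact: mx].
    have m2 : measurable_fun setT (fun w => (X2 w ^+ 2)%:E).
      by apply/measurable_EFinP/measurable_funX/measurable_funB; [exact: sN.1|exact: mx].
    rewrite -RintegralE//; last exact: s0.2.
    apply: (@le_trans _ _ (\int[P]_w (2%:E * (X1 w ^+ 2)%:E + 2%:E * (X2 w ^+ 2)%:E))%E).
      apply: ge0_le_integral => //.
      - by move=> w _; rewrite lee_fin sqr_ge0.
      - exact/measurable_EFinP/(integrableR_measurable s0.2).
      - by apply: emeasurable_funD; exact: measurable_funeM.
      - move=> w _; rewrite -!EFinM -EFinD lee_fin proc0 /X1 /X2.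
        set x := simple_proc u v h r w; set y := simple_proc _ _ _ r w; set z := xi r w.
        have := sqr_ge0 ((x - z) + (y - z)); lra.
    have p0 (X : Omega -> R) w : (0 <= 2%:E * (X w ^+ 2)%:E)%E.
      by rewrite mule_ge0// lee_fin sqr_ge0.
    have q0 (X : Omega -> R) w : (0 <= (X w ^+ 2)%:E)%E by rewrite lee_fin sqr_ge0.
    rewrite ge0_integralD//; [|exact: measurable_funeM|exact: measurable_funeM].
    rewrite !ge0_integralZl//.
    apply: leeD.
      rewrite EFinM; apply: lee_wpmul2l; first by rewrite lee_fin.
      have := HA r rab; by rewrite expectation.unlock.
    by rewrite /Q expectation.unlock.
  have E0 : E (fun w => simple_int (f i) u0 v0 h0 w ^+ 2) <= 2 * A * (b - a) + 2 * e.
    rewrite (isometry_simple hF hW i a0 bT fam0).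
    rewrite -lee_fin -RintegralE//; last exact: integrable_E_simple_proc.
    have io : mu.-integrable `[a, b[
        (EFin \o (fun r => E (fun w => simple_proc u0 v0 h0 r w ^+ 2))).
      apply: (integrableS _ _ _ (integrable_E_simple_proc fam0)) => //.
      by apply: subset_itvl; rewrite bnd_simp.
    have mo := integrableR_measurable io.
    rewrite -integral_itv_bndo_bndc; last exact/measurable_EFinP.
    have mQo : measurable_fun (`[a, b[%classic : set (measurableTypeR R)) Q.
      apply: measurable_funS mQ; [exact: measurable_itv|by apply: subset_itvl; rewrite bnd_simp].
    apply: (@le_trans _ _ (\int[mu]_(r in `[a, b[) ((2 * A)%:E + 2%:E * Q r))%E).
      apply: ge0_le_integral => //.
      - by move=> r _; rewrite lee_fin; apply: Rintegral_ge0 => w _; exact: sqr_ge0.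
      - exact/measurable_EFinP.
      - by apply: emeasurable_funD => //; exact: measurable_funeM.
    have A20 : (0 <= (2 * A)%:E)%E by rewrite lee_fin mulr_ge0.
    rewrite ge0_integralD//; last 2 first.
      by move=> r _; rewrite mule_ge0.
      exact: measurable_funeM.
    rewrite ge0_integralZl// integral_cst// [leRHS]EFinD; apply: leeD.
      rewrite [(2 * A * _)%:E]EFinM; apply: lee_wpmul2l => //=.
      rewrite lebesgue_measure_itv /= lte_fin; case: ltP => _; first by rewrite EFinB.
      by rewrite lee_fin subr_ge0.
    rewrite EFinM; apply: lee_wpmul2l; first by rewrite lee_fin.
    apply: le_trans (ltW l2); apply: ge0_subset_integral => //.
    by apply: subset_itvl; rewrite bnd_simp.
  have eqw w : simple_int (f i) u v h w - I0 w =
      simple_int (f i) u0 v0 h0 w + (simple_int (f i) (uN N) (vN N) (hN N) w - I0 w).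
    by rewrite int0; ring.
  have sK := sqint_simple_int hF hW i a0 bT fam0.
  split; first by rewrite (funext eqw); exact: sqintD.
  under eq_Rintegral do rewrite eqw.
  apply: le_trans (E_sqrD sK s1) _; lra.
split; first by have [] := main 1 ltr01.
apply/ler_addgt0Pr => e e0.
have [_] := main (e / 6) (divr_gt0 e0 (ltr0n R 6)).
by rewrite mulrCA divff// mulr1.
Qed.

End ito_estimate.

(** * Discrete iterated integrals *)

Section continuous_on_segment.
Context (R : realType) (t T : R) (g : R -> R).
Hypothesis cg : {within `[t, T], continuous g}.

Lemma segment_bounded : exists2 G, 0 <= G & forall x, t <= x <= T -> `|g x| <= G.
Proof.
have [M [_ HM]] := compact_bounded (continuous_compact cg (segment_compact (a := t) (b := T))).
exists (`|M| + 1); first by rewrite addr_ge0.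
move=> x xtT; apply: HM; first by rewrite (le_lt_trans (ler_norm M))// ltrDl.
by exists x => //=; rewrite in_itv.
Qed.

(** Heine's theorem. *)
Lemma segment_unif_continuous e : 0 < e -> exists2 dlt, 0 < dlt &
  forall x y, t <= x <= T -> t <= y <= T -> `|x - y| <= dlt -> `|g x - g y| <= e.
Proof.
move=> e0.
have /compact_near_coveringP K := segment_compact (a := t) (b := T).
have := K R (0 : R)^'+ (fun dl x => t <= x <= T -> forall y, t <= y <= T ->
   `|x - y| <= dl -> `|g x - g y| <= e) _.
have /subspace_continuousP cg' := cg.
case.
- move=> x; rewrite /= in_itv /= => xtT.
  have e2 : 0 < e / 2 by rewrite divr_gt0.
  have xtT' : `[t, T]%classic x by rewrite /= in_itv.
  have /cvgrPdist_lt/(_ _ e2) := cg' x xtT'.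
  rewrite near_withinE => /nbhs_ballP[r /= r0 H].
  have r2 : 0 < r / 2 by rewrite divr_gt0.
  near=> x' dl => x'tT y ytT x'y.
  have xx' : `|x - x'| < r / 2.
    by near: x'; apply: (@nbhsx_ballx R R).
  have dlr : dl < r / 2 by near: dl; apply: nbhs_right_lt.
  have h1 : `|g x - g x'| < e / 2.
    apply: H; last by rewrite /= in_itv.
    rewrite /ball /=; apply: lt_trans xx' _.
    by rewrite ltr_pdivrMr// ltr_pMr// ltr1n.
  have h2 : `|g x - g y| < e / 2.
    apply: H; last by rewrite /= in_itv.
    rewrite /ball /=.
    have -> : x - y = (x - x') + (x' - y) by ring.
    apply: (le_lt_trans (ler_normD _ _)); rewrite [ltRHS]splitr ltrD//.
    exact: le_lt_trans dlr.
  have -> : g x' - g y = (g x - g y) - (g x - g x') by ring.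
  apply: (le_trans (ler_normB _ _)); rewrite [leRHS]splitr.
  by apply/ltW/ltrD.
- move=> dl0 /= dl0_gt0 Hd.
  exists (dl0 / 2); first by rewrite divr_gt0.
  move=> x y xtT ytT xy.
  apply: (Hd (dl0 / 2)) => //=.
  + by rewrite sub0r normrN gtr0_norm ?divr_gt0// ltr_pdivrMr// ltr_pMr// ltr1n.
  + by rewrite divr_gt0.
Unshelve. all: by end_near.
Qed.

End continuous_on_segment.

Section discrete_process.
Context (R : realType) d (Omega : measurableType d) (P : probability Omega R).
Variables (t T : R) (F : R -> set_system Omega) (m : nat) (f : 'I_m -> R -> Omega -> R).
Hypothesis hF : filtration T F.
Hypothesis hW : wiener P T F f.
Hypothesis t0 : 0 <= t.
Hypothesis tT : t < T.
Variables (g : nat -> R -> R) (iota : nat -> 'I_m).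
Hypothesis cg : forall l, {within `[t, T], continuous (g l)}.
Local Notation rint X := (P.-integrable setT (EFin \o X)).
Local Notation E X := (\int[P]_w X w).

(** The iterated sums obtained by freezing every integrand at the left endpoint
of its cell. The upper limit s is arbitrary because the integrand of the next
level is evaluated inside the cells; a cell that starts after s contributes 0. *)
Fixpoint grid_iterated (N : nat) (sg : nat -> R) (l : nat) (s : R) (w : Omega) : R :=
  match l with
  | 0 => 1
  | l'.+1 => @simple_int R d Omega 'I_N (f (iota l'))
      (fun b => Num.min (sg b) s) (fun b => Num.min (sg b.+1) s)
      (fun b w => if sg b < s then g l' (sg b) * grid_iterated N sg l' (sg b) w else 0) w
  end.

Definition fine_grid (dlt : R) (N : nat) (sg : nat -> R) :=
  partition_of t T N sg /\ forall b, (b < N)%N -> sg b.+1 - sg b <= dlt.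

Lemma grid_bounds N sg b : partition_of t T N sg -> (b <= N)%N -> t <= sg b <= T.
Proof.
move=> part bN; have [e1 e2 _] := part.
apply/andP; split; first by rewrite -e1; exact: (partition_le part).
by rewrite -e2; exact: (partition_le part).
Qed.

Section fixed_grid.
Variables (N : nat) (sg : nat -> R).
Hypothesis part : partition_of t T N sg.

Local Notation proc := (grid_iterated N sg).
Local Notation hh l s := (fun (b : 'I_N) w =>
  if sg b < s then g l (sg b) * proc l (sg b) w else 0).
Local Notation uu s := (fun b : 'I_N => Num.min (sg b) s).
Local Notation vv s := (fun b : 'I_N => Num.min (sg b.+1) s).

Let le_min_min b s : (b < N)%N -> Num.min (sg b) s <= Num.min (sg b.+1) s.
Proof.
move=> bN; rewrite le_min ge_min (partition_le part (leqnSn b) bN) /=.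
by rewrite ge_min lexx orbT.
Qed.

Lemma grid_iterated_adapted l s : t <= s <= T ->
  allmom P (proc l s) /\ measurable_wrt (F s) (proc l s).
Proof.
elim: l s => [|l IH] s /andP[ts sT].
  have s0 := le_trans t0 ts.
  split; first exact: allmom_cst.
  by apply: measurable_wrt_cst; apply: filtration_sigma hF _ _; rewrite s0.
have s0 := le_trans t0 ts.
have sF : sigma_algebra setT (F s) by apply: filtration_sigma hF _ _; rewrite s0.
have hb (b : 'I_N) : allmom P (hh l s b) /\ measurable_wrt (F s) (hh l s b).
  have /andP[tb bT] := grid_bounds part (ltnW (ltn_ord b)).
  have [bs|bs] := ltP (sg b) s; last first.
    split; first exact: allmom_cst.
    exact: (measurable_wrt_cst sF).
  have [a1 a2] := IH (sg b) (grid_bounds part (ltnW (ltn_ord b))).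
  split; first exact: allmomZ.
  apply: measurable_wrtZ => //; apply: (adapted_le hF (le_trans t0 tb) (ltW bs)) => //.
have ub (b : 'I_N) : t <= Num.min (sg b) s.
  by rewrite le_min ts andbT; case/andP: (grid_bounds part (ltnW (ltn_ord b))).
have vb (b : 'I_N) : Num.min (sg b.+1) s <= s by rewrite ge_min lexx orbT.
split.
  apply: allmom_sum => b _; apply: allmomM; first by case: (hb b).
  have [] // := increment_moments hF hW (iota l) (s := Num.min (sg b) s) (u := Num.min (sg b.+1) s).
  - exact: le_trans (ub b).
  - exact: le_min_min.
  - exact: le_trans (vb b) sT.
apply: measurable_wrt_sum => // b; apply: measurable_wrtM => //; first by case: (hb b).
apply: (adapted_le hF (s := Num.min (sg b.+1) s)) => //.
  exact: le_trans (le_trans t0 (ub b)) (le_min_min _ _).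
apply: (increment_adapted hF hW) => //.
- exact: le_trans (ub b).
- exact: le_min_min.
- exact: le_trans (vb b) sT.
Qed.

Lemma grid_family l s : t <= s <= T ->
  simple_family P F t s (uu s) (vv s) (hh l s).
Proof.
move=> /andP[ts sT] b.
have /andP[tb bT] := grid_bounds part (ltnW (ltn_ord b)).
have [a1 a2] := grid_iterated_adapted l (grid_bounds part (ltnW (ltn_ord b))).
split.
- by rewrite le_min tb ts.
- exact: le_min_min.
- by rewrite ge_min lexx orbT.
- have [bs|bs] := ltP (sg b) s.
    apply: measurable_wrtZ => //.
    by apply: (filtration_sigma hF); rewrite (le_trans t0 tb).
  apply: measurable_wrt_cst; apply: (filtration_sigma hF).
  by rewrite (le_trans t0 ts).
- case: (sg b < s); last exact: sqint_cst.
  by apply: allmom_sqint; exact: allmomZ.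
Qed.

Lemma grid_cell r : t <= r < T ->
  exists b : 'I_N, sg b <= r < sg b.+1.
Proof.
move=> /andP[tr rT]; have [e1 e2 _] := part.
have ex : exists n, (r < sg n) && (n <= N)%N by exists N; rewrite e2 rT leqnn.
case: (ex_minnP ex) => -[|n] /andP[rn nN] nmin.
  by move: rn; rewrite e1 ltNge tr.
exists (Ordinal nN); rewrite /= rn andbT leNgt; apply/negP => rn'.
by have := nmin n; rewrite rn' (ltnW nN) ltnn => /(_ isT).
Qed.

Lemma grid_cell_uniq r (b b' : nat) : (b < N)%N -> (b' < N)%N ->
  sg b <= r < sg b.+1 -> sg b' <= r < sg b'.+1 -> b = b'.
Proof.
move=> bN bN' /andP[h1 h2] /andP[h3 h4]; apply/eqP; rewrite eqn_leq.
by apply/andP; split; rewrite leqNgt; apply/negP => lt;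
  [have := partition_le part lt (ltnW bN); rewrite leNgt (le_lt_trans h1 h4)
  |have := partition_le part lt (ltnW bN'); rewrite leNgt (le_lt_trans h3 h2)].
Qed.

(** Before time s, the minima with s in the bounds of the intervals are harmless. *)
Lemma grid_proc_cell l s r (b : 'I_N) w : t <= r -> r < s -> s <= T ->
  sg b <= r < sg b.+1 ->
  simple_proc (uu s) (vv s) (hh l s) r w = g l (sg b) * proc l (sg b) w.
Proof.
move=> tr rs sT rb; rewrite /simple_proc (bigD1 b)//= big1 ?addr0.
  have /andP[h1 h2] := rb.
  rewrite (le_lt_trans h1 rs) indicE mem_set ?mulr1//= in_itv /=.
  by rewrite ge_min h1 lt_min h2.
move=> b' b'b; rewrite indicE memNset ?mulr0//= in_itv /= ge_min lt_min.
rewrite [s <= r]leNgt rs orbF andbT => h.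
by move/eqP: b'b; apply; apply: val_inj; exact: (grid_cell_uniq _ _ h rb).
Qed.

Lemma sqint_cell l (b : 'I_N) : sqint P (fun w => g l (sg b) * proc l (sg b) w).
Proof.
have [a1 _] := grid_iterated_adapted l (grid_bounds part (ltnW (ltn_ord b))).
by apply: allmom_sqint; exact: allmomZ.
Qed.

Lemma grid_increment l (b : 'I_N) r w : sg b <= r <= sg b.+1 ->
  proc l.+1 r w - proc l.+1 (sg b) w =
  (g l (sg b) * proc l (sg b) w) * (f (iota l) r w - f (iota l) (sg b) w).
Proof.
move=> /andP[br rb] /=; rewrite /simple_int (bigD1 b)//= [X in _ - X](bigD1 b)//=.
rewrite ltxx mul0r add0r -addrA -[RHS]addr0; congr (_ + _).
  rewrite (min_idPl br) (min_idPr rb).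
  have [//|rb'] := ltP (sg b) r.
  have -> : r = sg b by apply/le_anti; rewrite rb' br.
  by rewrite subrr !mulr0.
apply/eqP; rewrite subr_eq0; apply/eqP; apply: eq_bigr => b' b'b.
have [lt|gt|/val_inj e] := ltngtP b' b; last by rewrite e eqxx in b'b.
  have h1 : sg b' < sg b.
    have [_ _ inc] := part.
    by apply: lt_le_trans (inc _ (ltn_ord b')) (partition_le part lt (ltnW (ltn_ord b))).
  have h2 := partition_le part lt (ltnW (ltn_ord b)).
  rewrite h1 (lt_le_trans h1 br) (min_idPl h2) (min_idPl (le_trans h2 br)).
  by rewrite (min_idPl (ltW h1)) (min_idPl (le_trans (ltW h1) br)).
have h1 := partition_le part gt (ltnW (ltn_ord b')).
by rewrite !ltNge (le_trans rb h1) (le_trans (le_trans br rb) h1) /= !mul0r.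
Qed.

End fixed_grid.

Lemma E_scale_sqr_le (c G : R) X : `|c| <= G -> sqint P X ->
  E (fun w => (c * X w) ^+ 2) <= G ^+ 2 * E (fun w => X w ^+ 2).
Proof.
move=> cG sX; under eq_Rintegral do rewrite exprMn.
rewrite (RintegralZl _ measurableT sX.2); apply: ler_wpM2r.
  by apply: Rintegral_ge0 => w _; exact: sqr_ge0.
rewrite -real_normK ?num_real//.
by rewrite lerXn2r ?nnegrE// (le_trans _ cG).
Qed.

(** Ito isometry, level by level. *)
Lemma grid_bound l : exists2 C, 0 <= C & forall N sg s,
  partition_of t T N sg -> t <= s <= T ->
  E (fun w => grid_iterated N sg l s w ^+ 2) <= C.
Proof.
elim: l => [|l [C C0 IH]].
  by exists 1 => // N sg s _ _ /=; under eq_Rintegral do rewrite expr1n; rewrite E_cst.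
have [G G0 GP] := segment_bounded (@cg l).
have A0 : 0 <= G ^+ 2 * C by rewrite mulr_ge0// exprn_ge0.
exists (G ^+ 2 * C * (T - t)) => [|N sg s part /[dup] stT /andP[ts sT]].
  by rewrite mulr_ge0// subr_ge0 ltW.
apply: (@le_trans _ _ (G ^+ 2 * C * (s - t))); last first.
  by apply: ler_wpM2l => //; rewrite lerD2r.
apply: (isometry_le hF hW _ t0 sT (grid_family part l stT) ts A0) => r /andP[tr rs].
have [|b rb] := @grid_cell N sg part r; first by rewrite tr (lt_le_trans rs).
under eq_Rintegral do rewrite (grid_proc_cell part _ _ tr rs sT rb).
have bd := grid_bounds part (ltnW (ltn_ord b)).
apply: (le_trans (E_scale_sqr_le (GP _ bd) _)).
  by apply: allmom_sqint; have [] := grid_iterated_adapted part l bd.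
apply: ler_wpM2l; first by rewrite exprn_ge0.
exact: IH.
Qed.

(** Within a cell the iterated sum moves by its frozen integrand times one
increment. *)
Lemma grid_modulus l : exists2 K, 0 <= K & forall N sg (b : 'I_N) r,
  partition_of t T N sg -> sg b <= r <= sg b.+1 ->
  E (fun w => (grid_iterated N sg l r w - grid_iterated N sg l (sg b) w) ^+ 2)
  <= K * (r - sg b).
Proof.
case: l => [|l].
  exists 0 => // N sg b r _ _ /=; under eq_Rintegral do rewrite subrr expr0n.
  by rewrite E_cst mul0r.
have [C C0 CP] := grid_bound l; have [G G0 GP] := segment_bounded (@cg l).
exists (G ^+ 2 * C); first by rewrite mulr_ge0// exprn_ge0.
move=> N sg b r part /[dup] rb' /andP[br rb].
have bd := grid_bounds part (ltnW (ltn_ord b)); have /andP[tb bT] := bd.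
have /andP[tb1 bT1] := grid_bounds part (ltn_ord b).
under eq_Rintegral do rewrite (grid_increment part _ _ rb') exprMn.
have [a1 a2] := grid_iterated_adapted part l bd.
have sF : sigma_algebra setT (F (sg b)).
  by apply: (filtration_sigma hF); rewrite (le_trans t0 tb).
have [_ ->] := E_increment_sqr hF hW (iota l) (le_trans t0 tb) br (le_trans rb bT1)
  (measurable_wrtX (p := 2) sF (measurable_wrtZ sF (c := g l (sg b)) a2)) (sqint_cell part l b).2.
apply: ler_wpM2r; first by rewrite subr_ge0.
apply: (le_trans (E_scale_sqr_le (GP _ bd) (allmom_sqint a1))).
by apply: ler_wpM2l; [rewrite exprn_ge0|exact: CP].
Qed.

Local Notation frozen N sg l s := (simple_proc
  (fun b : 'I_N => Num.min (sg b) s) (fun b : 'I_N => Num.min (sg b.+1) s)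
  (fun b w => if sg b < s then g l (sg b) * grid_iterated N sg l (sg b) w else 0)).

(** Freezing the integrand at the left end of its cell costs the modulus of
continuity of g and the growth of the previous level within the cell. *)
Lemma grid_freezing l e : 0 < e -> exists2 dlt, 0 < dlt &
  forall N sg s r, fine_grid dlt N sg -> t <= r -> r < s -> s <= T ->
  sqint P (fun w => frozen N sg l s r w -
      g l r * grid_iterated N sg l r w) /\
  E (fun w => (frozen N sg l s r w -
      g l r * grid_iterated N sg l r w) ^+ 2) <= e.
Proof.
move=> e0; have [C C0 CP] := grid_bound l; have [G G0 GP] := segment_bounded (@cg l).
have [K K0 KP] := grid_modulus l.
pose om := Num.min 1 (e / (4 * (C + 1))).
have om0 : 0 < om by rewrite lt_min ltr01 divr_gt0// mulr_gt0// ltr_wpDl.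
have omC : 2 * (om ^+ 2 * C) <= e / 2.
  have h1 : om <= 1 by rewrite ge_min lexx.
  have h2 : om <= e / (4 * (C + 1)) by rewrite ge_min lexx orbT.
  rewrite ler_pdivlMr in h2; last by rewrite mulr_gt0// ltr_wpDl.
  have h3 : om ^+ 2 <= om by rewrite expr2 ger_pMl.
  have h4 : om ^+ 2 * C <= om * (C + 1).
    by apply: ler_pM => //; [exact: sqr_ge0|rewrite lerDl].
  lra.
have [d1 d10 H1] := segment_unif_continuous (@cg l) om0.
pose B := G ^+ 2 * K; have B0 : 0 <= B by rewrite mulr_ge0// exprn_ge0.
pose d2 := e / (4 * (B + 1)).
have d20 : 0 < d2 by rewrite divr_gt0// mulr_gt0// ltr_wpDl.
have d2B : 2 * (B * d2) <= e / 2.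
  have -> : 2 * (B * d2) = e / 2 * (B / (B + 1)).
    by rewrite /d2; field; rewrite gt_eqF// ltr_wpDl.
  rewrite ler_piMr//; first by rewrite divr_ge0// ltW.
  by rewrite ler_pdivrMr ?ltr_wpDl// mul1r lerDl.
exists (Num.min d1 d2); first by rewrite lt_min d10.
move=> N sg s r [part mesh] tr rs sT.
have rtT : t <= r <= T by rewrite tr (le_trans (ltW rs)).
have [|b rb] := @grid_cell N sg part r; first by rewrite tr (lt_le_trans rs).
have bd := grid_bounds part (ltnW (ltn_ord b)).
have [a1 _] := grid_iterated_adapted part l bd.
have [a2 _] := grid_iterated_adapted part l rtT.
have /andP[br rb1] := rb.
have rd : r - sg b <= Num.min d1 d2.
  by apply: le_trans (mesh b (ltn_ord b)); rewrite lerD2r ltW.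
have eqw w : frozen N sg l s r w -
      g l r * grid_iterated N sg l r w =
    (g l (sg b) - g l r) * grid_iterated N sg l (sg b) w -
    g l r * (grid_iterated N sg l r w - grid_iterated N sg l (sg b) w).
  by rewrite (grid_proc_cell part _ _ tr rs sT rb); ring.
have sA := sqintZ (g l (sg b) - g l r) (allmom_sqint a1).
have sD := sqintB (allmom_sqint a2) (allmom_sqint a1).
have sB := sqintZ (g l r) sD.
split; first by rewrite (funext eqw); exact: sqintB.
under eq_Rintegral do rewrite eqw.
apply: le_trans (E_sqrB sA sB) _; rewrite [leRHS]splitr; apply: lerD.
  apply: le_trans omC; apply: ler_wpM2l => //.
  apply: le_trans (E_scale_sqr_le _ (allmom_sqint a1)) _.
    apply: H1 => //; rewrite distrC ger0_norm ?subr_ge0//.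
    by rewrite (le_trans rd)// ge_min lexx.
  by apply: ler_wpM2l; [exact: sqr_ge0|exact: CP].
apply: le_trans d2B; apply: ler_wpM2l => //.
apply: le_trans (E_scale_sqr_le (GP _ rtT) sD) _.
rewrite /B -mulrA; apply: ler_wpM2l; first exact: sqr_ge0.
apply: le_trans (KP _ _ _ _ part _) _; first by rewrite br ltW.
apply: ler_wpM2l => //.
by rewrite (le_trans rd)// ge_min lexx orbT.
Qed.

(** Z satisfies up to e the only property of the iterated Ito integral that is
used: each level is close to every simple integral whose integrand is close to
the previous level. Both the iterated Ito integral and the grid sums qualify. *)
Definition approx_iterated (e : R) (k : nat) (Z : nat -> R -> Omega -> R) :=
  (forall s w, Z 0%N s w = 1) /\
  forall l s, (l < k)%N -> t <= s <= T ->
  forall (J : finType) (u v : J -> R) (h : J -> Omega -> R) A,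
  simple_family P F t s u v h -> 0 <= A ->
  (forall r, t <= r < s ->
     sqint P (fun w => simple_proc u v h r w - g l r * Z l r w) /\
     E (fun w => (simple_proc u v h r w - g l r * Z l r w) ^+ 2) <= A) ->
  sqint P (fun w => simple_int (f (iota l)) u v h w - Z l.+1 s w) /\
  E (fun w => (simple_int (f (iota l)) u v h w - Z l.+1 s w) ^+ 2) <= 4 * A * (s - t) + e.

Lemma approx_iterated_ito k (Z : nat -> R -> Omega -> R) :
  (forall s w, Z 0%N s w = 1) ->
  (forall l s, (l < k)%N -> t <= s <= T ->
     is_ito P F (f (iota l)) t s (fun r w => g l r * Z l r w) (Z l.+1 s)) ->
  approx_iterated 0 k Z.
Proof.
move=> Z0 H; split=> // l s lk /[dup] stT /andP[ts sT] J u v h A fam A0 HA.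
rewrite addr0; apply: (ito_estimate hF hW t0 ts sT (H l s lk stT) fam A0) => r /HA[sr lr].
by rewrite expectationE ?lee_fin//; exact: sr.2.
Qed.

Lemma approx_iterated_grid k e : 0 < e -> exists2 dlt, 0 < dlt &
  forall N sg, fine_grid dlt N sg -> approx_iterated e k (grid_iterated N sg).
Proof.
move=> e0; have Tt0 : 0 < T - t by rewrite subr_gt0.
pose e1 := e / (2 * (T - t)).
have e10 : 0 < e1 by rewrite divr_gt0// mulr_gt0.
have [dl dl0 HD] : exists2 dlt, 0 < dlt & forall l, (l < k)%N ->
    forall N sg s r, fine_grid dlt N sg -> t <= r -> r < s -> s <= T ->
  sqint P (fun w => frozen N sg l s r w -
      g l r * grid_iterated N sg l r w) /\
  E (fun w => (frozen N sg l s r w -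
      g l r * grid_iterated N sg l r w) ^+ 2) <= e1.
  elim: k => [|k [dl dl0 IH]]; first by exists 1.
  have [dl' dl'0 H] := grid_freezing k e10.
  exists (Num.min dl dl'); first by rewrite lt_min dl0.
  move=> l; rewrite ltnS leq_eqVlt => /predU1P[->|lk] N sg s r [part mesh].
    by apply: H; split=> // b /mesh; rewrite le_min => /andP[].
  by apply: IH => //; split=> // b /mesh; rewrite le_min => /andP[].
exists dl => // N sg fg; have [part _] := fg.
split=> // l s lk /[dup] stT /andP[ts sT] J u v h A fam A0 HA.
have [K [u0 [v0 [h0 [fam0 int0 proc0]]]]] := simple_family_sub hF (f (iota l))
  (introT andP (conj t0 (ltW tT))) sT fam (grid_family part l stT).
have eqi w : simple_int (f (iota l)) u v h w - grid_iterated N sg l.+1 s w =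
  simple_int (f (iota l)) u0 v0 h0 w by rewrite int0.
rewrite (funext eqi); split; first exact: (sqint_simple_int hF hW _ t0 sT fam0).
under eq_Rintegral do rewrite eqi.
apply: (@le_trans _ _ ((2 * A + 2 * e1) * (s - t))).
  apply: (isometry_le hF hW _ t0 sT fam0 ts).
    by apply: addr_ge0; apply: mulr_ge0 => //; exact: ltW.
  move=> r /andP[tr rs]; have [s1 l1] := HD l lk N sg s r fg tr rs sT.
  have [s2 l2] := HA r (introT andP (conj tr rs)).
  under eq_Rintegral do rewrite proc0.
  rewrite (@eq_Rintegral _ _ _ P setT (fun w =>
    ((simple_proc u v h r w - g l r * grid_iterated N sg l r w) -
     (frozen N sg l s r w - g l r * grid_iterated N sg l r w)) ^+ 2)); last first.
    by move=> w _; congr (_ ^+ 2); ring.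
  apply: le_trans (E_sqrB s2 s1) _; lra.
rewrite mulrDl; apply: lerD.
  by apply: ler_wpM2r; [rewrite subr_ge0|rewrite ler_wpM2r// ler_nat].
apply: (@le_trans _ _ (2 * e1 * (T - t))).
  by apply: ler_wpM2l; [rewrite mulr_ge0// ltW|rewrite lerD2r].
by rewrite le_eqVlt; apply/orP; left; apply/eqP; rewrite /e1; field; rewrite gt_eqF.
Qed.

(** By induction on the level: if the l-th levels are close, the frozen integrand of
the grid sum is close to the integrand of Z, which is what the hypothesis on Z
turns into closeness of the next levels. *)
Lemma grid_iterated_cvg k l e : (l <= k)%N -> 0 < e -> exists2 dlt, 0 < dlt &
  forall N sg Z, fine_grid dlt N sg -> approx_iterated dlt k Z ->
  forall s, t <= s <= T ->
  sqint P (fun w => grid_iterated N sg l s w - Z l s w) /\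
  E (fun w => (grid_iterated N sg l s w - Z l s w) ^+ 2) <= e.
Proof.
elim: l e => [|l IH] e lk e0.
  exists 1 => // N sg Z _ [Z0 _] s _ /=.
  have eqw w : 1 - Z 0%N s w = 0 by rewrite Z0 subrr.
  rewrite (funext eqw); split; first exact: sqint_cst.
  by under eq_Rintegral do rewrite eqw expr0n; rewrite E_cst ltW.
have Tt0 : 0 < T - t by rewrite subr_gt0.
(* With this A, 4 * A * (T - t) is e / 2. *)
pose A := e / (8 * (T - t)).
have A0 : 0 < A by rewrite divr_gt0// mulr_gt0.
have A4 : 0 < A / 4 by rewrite divr_gt0.
have [G G0 GP] := segment_bounded (@cg l).
have G1 : 0 < G ^+ 2 + 1 by rewrite ltr_wpDl ?sqr_ge0.
have [d1 d10 H1] := grid_freezing l A4.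
have [d2 d20 H2] := IH (A / 4 / (G ^+ 2 + 1)) (ltnW lk) (divr_gt0 A4 G1).
exists (Num.min (Num.min d1 d2) (e / 2)).
  by rewrite !lt_min d10 d20 divr_gt0.
move=> N sg Z [part mesh] [Z0 ZP] s /[dup] stT /andP[ts sT].
have fg1 : fine_grid d1 N sg.
  by split=> // b /mesh; rewrite !le_min => /andP[/andP[]].
have fg2 : fine_grid d2 N sg.
  by split=> // b /mesh; rewrite !le_min => /andP[/andP[]].
have aZ : approx_iterated d2 k Z.
  split=> // l' s' lk' st' J u v h A' fam A'0 HA'.
  have [q1 q2] := ZP l' s' lk' st' J u v h A' fam A'0 HA'.
  split=> //; apply: (le_trans q2); rewrite lerD2l.
  by rewrite !ge_min lexx orbT.
have [|q1 q2] := ZP l s lk stT _ _ _ _ A (grid_family part l stT) (ltW A0).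
  move=> r /andP[tr rs].
  have rT : t <= r <= T by rewrite tr (le_trans (ltW rs)).
  have [s1 l1] := H1 N sg s r fg1 tr rs sT.
  have [s2 l2] := H2 N sg Z fg2 aZ r rT.
  have eqw w : frozen N sg l s r w - g l r * Z l r w =
    (frozen N sg l s r w - g l r * grid_iterated N sg l r w) +
    g l r * (grid_iterated N sg l r w - Z l r w) by ring.
  have s3 := sqintZ (g l r) s2.
  rewrite (funext eqw); split; first exact: sqintD.
  under eq_Rintegral do rewrite eqw.
  apply: le_trans (E_sqrD s1 s3) _.
  have h3 : E (fun w => (g l r * (grid_iterated N sg l r w - Z l r w)) ^+ 2) <= A / 4.
    apply: le_trans (E_scale_sqr_le (GP _ rT) s2) _.
    apply: (@le_trans _ _ (G ^+ 2 * (A / 4 / (G ^+ 2 + 1)))).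
      by apply: ler_wpM2l => //; exact: sqr_ge0.
    rewrite mulrA ler_pdivrMr// mulrC; apply: ler_wpM2l; first exact: ltW.
    by rewrite lerDl.
  lra.
split=> //; apply: (le_trans q2); rewrite [leRHS]splitr; apply: lerD.
  apply: (@le_trans _ _ (4 * A * (T - t))).
    by apply: ler_wpM2l; [rewrite mulr_ge0// ltW|rewrite lerD2r].
  by rewrite le_eqVlt; apply/orP; left; apply/eqP; rewrite /A; field; rewrite gt_eqF.
by rewrite ge_min lexx orbT.
Qed.

End discrete_process.

(** * Sums over increasing and over injective multi-indices *)

Section nested_sums.
Variable V : zmodType.
Implicit Types G H : seq nat -> V.

(** A sum over increasing sequences, with the largest entry peeled off first: it
indexes the latest increment, which is independent of all the others. *)
Fixpoint nest (k b : nat) G : V :=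
  if k is k'.+1 then \sum_(c < b) nest k' c (fun s => G (rcons s c)) else G [::].

Lemma eq_nest k b G H : (forall s, size s = k -> G s = H s) ->
  nest k b G = nest k b H.
Proof.
elim: k b G H => [|k IH] b G H GH /=; first exact: GH.
by apply: eq_bigr => c _; apply: IH => s sk; apply: GH; rewrite size_rcons sk.
Qed.

Fixpoint increasing_seqs (k b : nat) : seq (seq nat) :=
  if k is k'.+1 then
    [seq rcons s c | c <- iota 0 b, s <- increasing_seqs k' c]
  else [:: [::]].

Lemma nestE k b G : nest k b G = \sum_(s <- increasing_seqs k b) G s.
Proof.
elim: k b G => [|k IH] b G /=; first by rewrite big_seq1.
have -> : iota 0 b = index_iota 0 b by rewrite /index_iota subn0.
by rewrite big_allpairs_dep big_mkord; apply: eq_bigr => c _; exact: IH.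
Qed.

Lemma sorted_ltn_rcons (s : seq nat) c :
  sorted ltn (rcons s c) = all (fun x => x < c)%N s && sorted ltn s.
Proof. by rewrite !(sorted_pairwise ltn_trans) pairwise_rcons. Qed.

Lemma mem_increasing_seqs k b s : (s \in increasing_seqs k b) =
  [&& size s == k, sorted ltn s & all (fun x => x < b)%N s].
Proof.
elim: k b s => [|k IH] b s /=; first by rewrite inE; case: s.
apply/allpairsPdep/and3P => [[c [s' [cb s'i ->]]]|].
  move: s'i; rewrite IH => /and3P[/eqP ss' so al].
  move: cb; rewrite mem_iota add0n /= => cb.
  rewrite size_rcons ss' all_rcons cb /= sorted_ltn_rcons al; split=> //.
  by apply: sub_all al => x /= xc; exact: ltn_trans cb.
case: (lastP s) => [[//]|s' c]; rewrite size_rcons eqSS => -[sk].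
rewrite sorted_ltn_rcons => /andP[al so]; rewrite all_rcons => /andP[cb _].
exists c, s'; split=> //; first by rewrite mem_iota add0n.
by rewrite IH sk so.
Qed.

Lemma uniq_increasing_seqs k b : uniq (increasing_seqs k b).
Proof.
elim: k b => [//|k IH] b /=.
apply: allpairs_uniq_dep; first exact: iota_uniq.
  by move=> c _; exact: IH.
by move=> [c s] [c' s'] _ _ /= /eqP; rewrite eqseq_rcons => /andP[/eqP -> /eqP ->].
Qed.

Section injective_sums.
Variables (k N : nat) (Phi : ('I_k -> nat) -> V).

Let word (x : 'I_k -> nat) : seq nat := [seq x r | r <- enum 'I_k].

Let size_word x : size (word x) = k.
Proof. by rewrite size_map size_enum_ord. Qed.

Let nth_word x (r : 'I_k) : nth 0%N (word x) r = x r.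
Proof. by rewrite (nth_map r) ?size_enum_ord// nth_ord_enum. Qed.

Let words1 := [seq word (fun r => nat_of_ord (l r)) | l : {ffun 'I_k -> 'I_N} <- enum (idxL k N)].
Let words2 := [seq word (fun r => nth 0%N s (p r)) |
  p : 'S_k <- enum 'S_k, s <- increasing_seqs k N].

Let word_inj x y : word x = word y -> x =1 y.
Proof. by move=> e r; rewrite -(nth_word x) e nth_word. Qed.

Let uniq1 : uniq words1.
Proof.
rewrite map_inj_uniq ?enum_uniq// => l l' /word_inj e.
by apply/ffunP => r; apply: val_inj; exact: e.
Qed.

Let perm_word (p : 'S_k) s : size s = k ->
  perm_eq (word (fun r => nth 0%N s (p r))) s.
Proof.
move=> sk; pose u : k.-tuple nat := tcast sk (in_tuple s).
have us : u = s :> seq nat by rewrite val_tcast.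
rewrite -[X in perm_eq _ X]us; apply/tuple_permP; exists p.
rewrite /= /image_mem /word; apply: eq_map => r.
by rewrite (tnth_nth 0%N) us.
Qed.

Let uniq2 : uniq words2.
Proof.
apply: allpairs_uniq; [exact: enum_uniq|exact: uniq_increasing_seqs|].
move=> [p s] [p' s'] /allpairsP[[p1 s1] [_ h1 [_ e1]]] /allpairsP[[p2 s2] [_ h2 [_ e2]]] /= e.
rewrite /= -e1 in h1; rewrite /= -e2 in h2.
move: h1 h2; rewrite !mem_increasing_seqs => /and3P[/eqP k1 so1 _] /and3P[/eqP k2 so2 _].
have ss : s = s'.
  apply: (irr_sorted_eq ltn_trans ltnn so1 so2) => x.
  by rewrite -(perm_mem (perm_word p k1)) -(perm_mem (perm_word p' k2)) e.
rewrite -ss in e *; congr pair; apply/permP => r; apply: val_inj; apply/eqP.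
have u1 : uniq s by move: so1; rewrite ltn_sorted_uniq_leq => /andP[].
by have /eqP := word_inj e r; rewrite nth_uniq// k1; exact: ltn_ord.
Qed.

Let words12 : words1 =i words2.
Proof.
move=> q; apply/mapP/allpairsP => [[l lL ->]|[[p s] [_ si ->]]].
  move: lL; rewrite mem_enum inE => /forallP linj.
  pose q0 := word (fun r => nat_of_ord (l r)).
  have uq : uniq q0.
    rewrite map_inj_uniq ?enum_uniq// => r r' e; apply/eqP/negPn/negP => rr'.
    by have := linj r => /forallP/(_ r'); rewrite rr' /=; apply/negP/negPn/eqP/val_inj.
  pose s := sort leq q0.
  have sk : size s = k by rewrite size_sort size_word.
  have us : tcast sk (in_tuple s) = s :> seq nat by rewrite val_tcast.
  have /tuple_permP[p qp] : perm_eq q0 (tcast sk (in_tuple s)).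
    by rewrite us perm_sym perm_sort.
  exists (p, s); split=> //.
  - by rewrite mem_enum.
  - rewrite mem_increasing_seqs sk eqxx /= ltn_sorted_uniq_leq sort_uniq uq.
    rewrite (sort_sorted leq_total) all_sort; apply/allP => x /mapP[r _ ->].
    exact: ltn_ord.
  - rewrite /= -/q0 qp /= /image_mem; apply: eq_map => r.
    by rewrite (tnth_nth 0%N) us.
move: si; rewrite mem_increasing_seqs => /and3P[/eqP sk so al].
have lt (r : 'I_k) : (nth 0%N s (p r) < N)%N.
  by apply: (allP al); rewrite mem_nth// sk.
exists [ffun r => Ordinal (lt r)]; last by apply: eq_map => r; rewrite ffunE.
rewrite mem_enum inE; apply/forallP => r; apply/forallP => r'; apply/implyP => rr'.
rewrite !ffunE; apply/negP => /eqP[] /eqP; rewrite nth_uniq ?sk//; last first.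
  by move: so; rewrite ltn_sorted_uniq_leq => /andP[].
by move=> /eqP/val_inj/perm_inj/eqP; rewrite (negbTE rr').
Qed.

(** Sorting an injective multi-index writes it in a unique way as an increasing
one followed by a permutation. *)
Lemma sum_idxL :
  \sum_(l in idxL k N) Phi (fun r => nat_of_ord (l r)) =
  \sum_(p : 'S_k) nest k N (fun s => Phi (fun r => nth 0%N s (p r))).
Proof.
pose Psi (q : seq nat) := Phi (fun r => nth 0%N q r).
have PsiE x : Psi (word x) = Phi x.
  by congr Phi; apply/funext => r; rewrite nth_word.
transitivity (\sum_(q <- words1) Psi q).
  by rewrite big_map big_enum; apply: eq_bigr => l _; rewrite PsiE.
rewrite (perm_big words2); last exact: uniq_perm.
rewrite big_allpairs_dep big_enum; apply: eq_bigr => p _; rewrite nestE.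
by apply: eq_bigr => s _; rewrite PsiE.
Qed.

End injective_sums.

End nested_sums.

(** * Moment inequality for Gaussian sums *)

Section binomial_gaussian.

(** C(2n, 2i) (2i - 1)!! = C(n, i) (2n - 1)(2n - 3)...(2n - 2i + 1). *)
Lemma bin_double_factorial_le n i : (i <= n)%N ->
  ('C(2 * n, 2 * i) * \prod_(a < i) (2 * a + 1) <= 'C(n, i) * (2 * n - 1) ^ i)%N.
Proof.
elim: i => [|i IH] lin; first by rewrite big_ord0 !bin0.
have h1 := mul_bin_left (2 * n) (2 * i).+1.
have h2 := mul_bin_left (2 * n) (2 * i).
have h3 := mul_bin_left n i.
have {}IH := IH (ltnW lin).
have e2 : (2 * i.+1 = (2 * i).+2)%N by rewrite mulnS.
rewrite e2 big_ord_recr /=.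
move: (\prod_(a < i) _)%N IH => p IH.
have ni : (2 * n - 2 * i = 2 * (n - i))%N by rewrite mulnBr.
rewrite ni in h2.
have ni' : (2 * n - (2 * i).+1 <= 2 * n - 1)%N by apply: leq_sub2l.
set c0 := 'C(2 * n, 2 * i) in h2 IH; set c1 := 'C(2 * n, (2 * i).+1) in h1 h2.
set c2 := 'C(2 * n, (2 * i).+2) in h1 *.
set b0 := 'C(n, i) in h3 IH; set b1 := 'C(n, i.+1) in h3 *.
rewrite -(leq_pmul2l (m := (2 * i).+2)) //.
have -> : ((2 * i).+2 * (c2 * (p * (2 * i + 1))) =
  (2 * n - (2 * i).+1) * (2 * (n - i)) * (c0 * p))%N.
  transitivity (((2 * i).+2 * c2) * ((2 * i + 1) * p))%N; first by ring.
  rewrite h1 addn1; transitivity ((2 * n - (2 * i).+1) * ((2 * i).+1 * c1) * p)%N; first by ring.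
  by rewrite h2; ring.
have -> : ((2 * i).+2 * (b1 * (2 * n - 1) ^ i.+1) =
  (2 * n - 1) * (2 * (n - i)) * (b0 * (2 * n - 1) ^ i))%N.
  transitivity (2 * (i.+1 * b1) * (2 * n - 1) ^ i.+1)%N; first by rewrite -e2; ring.
  by rewrite h3 expnS; ring.
by rewrite leq_mul// leq_mul.
Qed.

(** Splits a sum according to the parity of the index. *)
Lemma sum_double (V : zmodType) n (a : nat -> V) :
  \sum_(j < (2 * n).+1) a j =
  \sum_(i < n.+1) a (2 * i)%N + \sum_(i < n) a (2 * i).+1.
Proof.
elim: n => [|n IH]; first by rewrite !big_ord1 big_ord0 addr0.
rewrite mulnS !add2n 2!big_ord_recr /= IH [in RHS]big_ord_recr [X in _ = _ + X]big_ord_recr /=.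
by rewrite mulnS add2n -addrA [X in _ + X = _]addrC addrACA.
Qed.

End binomial_gaussian.

Section hypercontractivity.
Context (R : realType) d (Omega : measurableType d) (P : probability Omega R).
Variables (t T : R) (F : R -> set_system Omega) (m : nat) (f : 'I_m -> R -> Omega -> R).
Hypothesis hF : filtration T F.
Hypothesis hW : wiener P T F f.
Local Notation rint X := (P.-integrable setT (EFin \o X)).
Local Notation E X := (\int[P]_w X w).

(** One step: expand, discard the odd moments of the increment, and compare the
even ones with the expansion of (M ^ 2 + (2n - 1)(u - s) X ^ 2) ^ n. *)
Lemma hypercontractive_step n i s u (M X : Omega -> R) (A B : R) :
  0 <= s -> s <= u -> u <= T ->
  allmom P M -> allmom P X -> measurable_wrt (F s) M -> measurable_wrt (F s) X ->
  0 <= A -> 0 <= B ->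
  E (fun w => M w ^+ (2 * n)) <= A ^+ n ->
  E (fun w => X w ^+ (2 * n)) <= B ^+ n ->
  E (fun w => (M w + X w * increment f i s u w) ^+ (2 * n)) <=
  (A + (2 * n - 1)%:R * (u - s) * B) ^+ n.
Proof.
move=> s0 su uT aM aX mM mX A0 B0 EM EX.
have [aD oD _ eD] := increment_moments hF hW i s0 su uT.
have sF : sigma_algebra setT (F s) by apply: (filtration_sigma hF); rewrite s0 (le_trans su).
have us0 : 0 <= u - s by rewrite subr_ge0.
pose c : R := (2 * n - 1)%:R * (u - s).
have c0 : 0 <= c by rewrite mulr_ge0.
have aMX p q : allmom P (fun w => M w ^+ p * X w ^+ q).
  by apply: allmomM; exact: allmomX.
have mMX p q : measurable_wrt (F s) (fun w => M w ^+ p * X w ^+ q).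
  by apply: measurable_wrtM => //; exact: measurable_wrtX.
pose D := increment f i s u.
pose term j w := 'C(2 * n, j)%:R * (M w ^+ (2 * n - j) * X w ^+ j * D w ^+ j).
have iterm j : rint (term j).
  apply: integrableRZ => //; apply: allmom_rint; apply: allmomM; first exact: aMX.
  exact: allmomX.
have Eterm j : E (term j) = 'C(2 * n, j)%:R *
    (E (fun w => M w ^+ (2 * n - j) * X w ^+ j) * E (fun w => D w ^+ j)).
  have [i1 e1] := increment_indep hF hW i j s0 su uT (mMX (2 * n - j)%N j) (allmom_rint (aMX _ _)).
  by rewrite (RintegralZl _ measurableT i1) e1.
have -> : E (fun w => (M w + X w * D w) ^+ (2 * n)) = \sum_(j < (2 * n).+1) E (term j).
  rewrite -Rintegral_sum//; apply: eq_Rintegral => w _.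
  by rewrite exprDn; apply: eq_bigr => j _; rewrite /term exprMn mulr_natl mulrA.
rewrite (sum_double n (fun j => E (term j))) [X in _ + X]big1 ?addr0; last first.
  by move=> j _; rewrite Eterm oD !mulr0.
apply: (@le_trans _ _ (E (fun w => (M w ^+ 2 + c * X w ^+ 2) ^+ n))); last first.
  apply: E_exprD_le => //.
  - exact: allmomX.
  - by apply: allmomZ; exact: allmomX.
  - by move=> w; exact: sqr_ge0.
  - by move=> w; rewrite mulr_ge0// sqr_ge0.
  - by rewrite mulr_ge0.
  - by under eq_Rintegral do rewrite -exprM.
  - under eq_Rintegral do rewrite exprMn -exprM.
    rewrite (RintegralZl _ measurableT (aX.2 _)) -/c [leRHS]exprMn.
    by apply: ler_wpM2l => //; rewrite exprn_ge0.
pose term' j w := 'C(n, j)%:R * c ^+ j * (M w ^+ (2 * n - 2 * j) * X w ^+ (2 * j)).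
have -> : E (fun w => (M w ^+ 2 + c * X w ^+ 2) ^+ n) = \sum_(j < n.+1) E (term' j).
  rewrite -Rintegral_sum//; last first.
    by move=> j _; apply: integrableRZ => //; apply: allmom_rint; exact: aMX.
  apply: eq_Rintegral => w _; rewrite exprDn; apply: eq_bigr => j _.
  by rewrite /term' [(c * _) ^+ _]exprMn -!exprM mulnBr -mulr_natl; ring.
apply: ler_sum => j _.
rewrite Eterm (RintegralZl _ measurableT (allmom_rint (aMX _ _))).
have EMX : 0 <= E (fun w => M w ^+ (2 * n - 2 * j) * X w ^+ (2 * j)).
  apply: Rintegral_ge0 => w _; rewrite -mulnBr !exprM.
  by rewrite mulr_ge0// exprn_ge0// sqr_ge0.
rewrite mulrA mulrAC mulrC [leRHS]mulrC; apply: ler_wpM2l => //.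
apply: (@le_trans _ _ ('C(2 * n, 2 * j)%:R * ((\prod_(a < j) (2 * a + 1)%:R) * (u - s) ^+ j))).
  by apply: ler_wpM2l => //; exact: eD.
rewrite mulrA exprMn mulrA; apply: ler_wpM2r; first by rewrite exprn_ge0.
rewrite -natr_prod -natrM -natrX -natrM ler_nat.
by apply: bin_double_factorial_le; rewrite -ltnS.
Qed.

Section grid_chaos.
Variables (N : nat) (sg : nat -> R).
Hypothesis t0 : 0 <= t.
Hypothesis part : partition_of t T N sg.

Local Notation D i c := (increment f i (sg c) (sg c.+1)).

(** A multiple sum over increasing indices below b; as b grows by 1 only the
increment over the cell b is new (chaosS). *)
Definition chaos (k : nat) (iota : nat -> 'I_m) (a : seq nat -> R) (b : nat) (w : Omega) : R :=
  nest k b (fun s => a s * \prod_(r < k) D (iota r) (nth 0%N s r) w).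

Definition chaos_norm (k : nat) (a : seq nat -> R) (b : nat) : R :=
  nest k b (fun s => a s ^+ 2 * \prod_(r < k) (sg (nth 0%N s r).+1 - sg (nth 0%N s r))).

Lemma chaosS k iota a b w : chaos k.+1 iota a b.+1 w =
  chaos k.+1 iota a b w + chaos k iota (fun s => a (rcons s b)) b w * D (iota k) b w.
Proof.
rewrite /chaos /= big_ord_recr /=; congr (_ + _).
rewrite !nestE mulr_suml big_seq [RHS]big_seq; apply: eq_bigr => s.
rewrite mem_increasing_seqs => /and3P[/eqP sk _ _].
rewrite big_ord_recr /= nth_rcons sk ltnn eqxx mulrA; congr (_ * _ * _).
by apply: eq_bigr => r _; rewrite nth_rcons sk ltn_ord.
Qed.

Lemma chaos_normS k a b : chaos_norm k.+1 a b.+1 =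
  chaos_norm k.+1 a b + chaos_norm k (fun s => a (rcons s b)) b * (sg b.+1 - sg b).
Proof.
rewrite /chaos_norm /= big_ord_recr /=; congr (_ + _).
rewrite !nestE mulr_suml big_seq [RHS]big_seq; apply: eq_bigr => s.
rewrite mem_increasing_seqs => /and3P[/eqP sk _ _].
rewrite big_ord_recr /= nth_rcons sk ltnn eqxx mulrA; congr (_ * _ * _).
by apply: eq_bigr => r _; rewrite nth_rcons sk ltn_ord.
Qed.

Let sg_mono b : (b < N)%N -> sg b <= sg b.+1.
Proof. by move=> bN; apply: (partition_le part). Qed.

Let sg_bounds b : (b <= N)%N -> 0 <= sg b <= T.
Proof.
move=> bN; have /andP[tb bT] := grid_bounds part bN.
by rewrite (le_trans t0 tb).
Qed.

Lemma chaos_norm_ge0 k a b : (b <= N)%N -> 0 <= chaos_norm k a b.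
Proof.
move=> bN; rewrite /chaos_norm nestE big_seq; apply: sumr_ge0 => s.
rewrite mem_increasing_seqs => /and3P[/eqP sk _ al].
rewrite mulr_ge0 ?sqr_ge0//; apply: prodr_ge0 => r _; rewrite subr_ge0.
apply: sg_mono; apply: leq_trans bN; apply: (allP al); rewrite mem_nth// sk.
exact: ltn_ord.
Qed.

Lemma chaos_adapted k iota a b : (b <= N)%N ->
  allmom P (chaos k iota a b) /\ measurable_wrt (F (sg b)) (chaos k iota a b).
Proof.
elim: k a b => [|k IHk] a b.
  move=> bN; have e w : chaos 0 iota a b w = a [::] by rewrite /chaos /= big_ord0 mulr1.
  rewrite (funext e : chaos 0 iota a b = _); split; first exact: allmom_cst.
  exact: (measurable_wrt_cst (filtration_sigma hF (sg_bounds bN))).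
elim: b => [|b IHb] bN.
  have e w : chaos k.+1 iota a 0 w = 0 by rewrite /chaos /= big_ord0.
  rewrite (funext e : chaos k.+1 iota a 0 = _); split; first exact: allmom_cst.
  exact: (measurable_wrt_cst (filtration_sigma hF (sg_bounds bN))).
have [a1 m1] := IHb (ltnW bN); have [a2 m2] := IHk (fun s => a (rcons s b)) b (ltnW bN).
have /andP[b0 bT] := sg_bounds (ltnW bN); have /andP[b10 b1T] := sg_bounds bN.
have bb := sg_mono bN.
have [aD _ _ _] := increment_moments hF hW (iota k) b0 bb b1T.
rewrite (funext (chaosS k iota a b)); split; first by apply: allmomD => //; exact: allmomM.
have sF := filtration_sigma hF (sg_bounds bN).
apply: measurable_wrtD => //; first exact: (adapted_le hF b0 bb b1T).
apply: measurable_wrtM => //; first exact: (adapted_le hF b0 bb b1T).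
exact: (increment_adapted hF hW b0 bb b1T).
Qed.

(** Double induction along chaosS: each new increment is one hypercontractive step,
and the bounds add up exactly as the norms do in chaos_normS. *)
Lemma chaos_moment n k iota a b : (b <= N)%N ->
  E (fun w => chaos k iota a b w ^+ (2 * n)) <=
  ((2 * n - 1)%:R ^+ k * chaos_norm k a b) ^+ n.
Proof.
elim: k a b => [|k IHk] a b.
  move=> bN; rewrite /chaos /chaos_norm /=.
  under eq_Rintegral do rewrite big_ord0 mulr1.
  by rewrite E_cst big_ord0 expr0 mul1r mulr1 exprM.
elim: b => [|b IHb] bN.
  rewrite /chaos /chaos_norm /=; under eq_Rintegral do rewrite big_ord0.
  by rewrite E_cst big_ord0 mulr0 !expr0n muln_eq0.
have [a1 m1] := chaos_adapted k.+1 iota a (ltnW bN).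
have [a2 m2] := chaos_adapted k iota (fun s => a (rcons s b)) (ltnW bN).
have /andP[b0 bT] := sg_bounds (ltnW bN); have /andP[b10 b1T] := sg_bounds bN.
under eq_Rintegral do rewrite chaosS.
have := hypercontractive_step (iota k) b0 (sg_mono bN) b1T a1 a2 m1 m2 _ _
  (IHb (ltnW bN)) (IHk _ _ (ltnW bN)).
have c0 : 0 <= (2 * n - 1)%:R :> R by [].
rewrite chaos_normS !mulr_ge0 ?exprn_ge0 ?chaos_norm_ge0//; try exact: ltnW.
move=> /(_ isT isT); congr (_ <= _); congr (_ ^+ _).
by rewrite mulrDr exprS; ring.
Qed.

End grid_chaos.
End hypercontractivity.

(** * Off-diagonal multiple sums *)

Lemma sqr_sum_le (R : realFieldType) (I : finType) (x : I -> R) :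
  (\sum_i x i) ^+ 2 <= #|I|%:R * \sum_i x i ^+ 2.
Proof.
set S := \sum_i x i; set Q := \sum_i x i ^+ 2; set c : R := #|I|%:R.
have [c0|c0] := eqVneq c 0.
  have /eqP I0 : #|I| == 0%N by move/eqP: c0; rewrite pnatr_eq0.
  rewrite /S big_pred0 ?expr0n ?c0 ?mul0r// => i.
  by have := card0_eq I0 i; rewrite inE.
have cp : 0 < c by rewrite lt_neqAle eq_sym c0 ler0n.
have : 0 <= \sum_i (c * x i - S) ^+ 2 by apply: sumr_ge0 => i _; exact: sqr_ge0.
have -> : \sum_i (c * x i - S) ^+ 2 = c * (c * Q - S ^+ 2).
  rewrite (eq_bigr (fun i => c ^+ 2 * x i ^+ 2 - 2 * c * S * x i + S ^+ 2)); last first.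
    by move=> i _; ring.
  rewrite big_split sumrB /= -!mulr_sumr -/S -/Q sumr_const -mulr_natl -/c.
  by ring.
by rewrite pmulr_rge0// subr_ge0.
Qed.

(** An increasing permutation satisfies r <= p r, and so does its inverse. *)
Lemma perm_increasing k (p : 'S_k) :
  (forall r r' : 'I_k, (r < r')%N -> (p r < p r')%N) -> p = 1%g.
Proof.
move=> H.
have ge (q : 'S_k) : (forall r r' : 'I_k, (r < r')%N -> (q r < q r')%N) ->
    forall r : 'I_k, (r <= q r)%N.
  move=> Hq [r rk]; elim: r rk => [//|r IH] rk.
  have := IH (ltnW rk); move=> /leq_ltn_trans; apply.
  exact: Hq.
have H' (r r' : 'I_k) : (r < r')%N -> (p^-1%g r < p^-1%g r')%N.
  move=> rr'; rewrite ltnNge; apply/negP; rewrite leq_eqVlt => /predU1P[/val_inj|].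
    by move=> /perm_inj e; rewrite e ltnn in rr'.
  by move=> /H; rewrite !permKV ltnNge (ltnW rr').
apply/permP => r; rewrite perm1; apply/val_inj/eqP; rewrite eqn_leq ge// andbT.
by have := ge _ H' (p r); rewrite permK.
Qed.

Section multiple_sums.
Context (R : realType) d (Omega : measurableType d) (P : probability Omega R).
Variables (t T : R) (F : R -> set_system Omega) (m : nat) (f : 'I_m -> R -> Omega -> R).
Hypothesis hF : filtration T F.
Hypothesis hW : wiener P T F f.
Hypothesis t0 : 0 <= t.
Local Notation rint X := (P.-integrable setT (EFin \o X)).
Local Notation E X := (\int[P]_w X w).
Variables (k0 : nat).
Local Notation k := k0.+1.
Variable (i : 'I_k -> 'I_m).
Implicit Types (a : ('I_k -> nat) -> R) (p : 'S_k).

Definition multiple_sum (N : nat) (sg : nat -> R) a (w : Omega) : R :=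
  \sum_(l in idxL k N) a (fun r => nat_of_ord (l r)) *
    \prod_(r < k) increment f (i r) (sg (l r)) (sg (l r).+1) w.

(** The component and the coefficient seen by the q-th smallest index. *)
Definition perm_component p (q : nat) : 'I_m := i (p^-1%g (inord q)).
Definition perm_coef a p (s : seq nat) : R := a (fun r => nth 0%N s (p r)).

Lemma multiple_sumE N sg a w : multiple_sum N sg a w =
  \sum_(p : 'S_k) chaos f sg k (perm_component p) (perm_coef a p) N w.
Proof.
rewrite /multiple_sum (sum_idxL N (fun x => a x *
  \prod_(r < k) increment f (i r) (sg (x r)) (sg (x r).+1) w)).
apply: eq_bigr => p _; apply: eq_nest => s sk; congr (_ * _).
rewrite (reindex_inj (@perm_inj _ (p^-1)%g)) /=; apply: eq_bigr => q _.
by rewrite /perm_component permKV inord_val.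
Qed.

Definition grid_norm (N : nat) (sg : nat -> R) a : R :=
  \sum_(l in idxL k N) a (fun r => nat_of_ord (l r)) ^+ 2 *
    \prod_(r < k) (sg (l r).+1 - sg (l r)).

Lemma grid_normE N sg a : grid_norm N sg a =
  \sum_(p : 'S_k) chaos_norm sg k (perm_coef a p) N.
Proof.
rewrite /grid_norm (sum_idxL N (fun x => a x ^+ 2 *
  \prod_(r < k) (sg (x r).+1 - sg (x r)))).
apply: eq_bigr => p _; apply: eq_nest => s sk; congr (_ * _).
rewrite (reindex_inj (@perm_inj _ (p^-1)%g)) /=; apply: eq_bigr => q _.
by rewrite permKV.
Qed.

Section grid.
Variables (N : nat) (sg : nat -> R).
Hypothesis part : partition_of t T N sg.

Lemma multiple_sum_allmom a : allmom P (multiple_sum N sg a).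
Proof.
rewrite (funext (multiple_sumE N sg a)); apply: allmom_sum => p _.
by have [] := chaos_adapted hF hW t0 part k (perm_component p) (perm_coef a p) (leqnn N).
Qed.

(** The square of a sum of k! terms is at most k! times the sum of the squares; the
L^n triangle inequality then adds up the bounds of the ordered sums. *)
Lemma multiple_sum_moment n a :
  E (fun w => multiple_sum N sg a w ^+ (2 * n)) <=
  (k`!)%:R ^+ n * (2 * n - 1)%:R ^+ (n * k) * grid_norm N sg a ^+ n.
Proof.
pose X p := chaos f sg k (perm_component p) (perm_coef a p) N.
have aX p : allmom P (X p).
  by have [] := chaos_adapted hF hW t0 part k (perm_component p) (perm_coef a p) (leqnn N).
pose K : R := (k`!)%:R.
have K0 : 0 <= K by [].
have aQ : allmom P (fun w => \sum_p X p w ^+ 2).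
  by apply: allmom_sum => p _; exact: allmomX.
apply: (@le_trans _ _ (E (fun w => K ^+ n * (\sum_p X p w ^+ 2) ^+ n))).
  apply: le_Rintegral => //; first exact: (multiple_sum_allmom a).2.
    by apply: integrableRZ => //; exact: aQ.2.
  move=> w _; rewrite exprM -exprMn lerXn2r ?nnegrE ?sqr_ge0//.
    by rewrite mulr_ge0// sumr_ge0// => p _; exact: sqr_ge0.
  rewrite multiple_sumE; apply: le_trans (sqr_sum_le _) _.
  by rewrite card_Sn.
rewrite (RintegralZl _ measurableT (aQ.2 n)) -!mulrA.
apply: ler_wpM2l; first by rewrite exprn_ge0.
have := @E_expr_sum_le _ _ _ P n _ (index_enum _) (fun p w => X p w ^+ 2)
  (fun p => (2 * n - 1)%:R ^+ k * chaos_norm sg k (perm_coef a p) N).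
move=> H; apply: le_trans (H _ _ _ _) _.
- by move=> p; exact: allmomX.
- by move=> p w; exact: sqr_ge0.
- by move=> p; apply: mulr_ge0; [rewrite exprn_ge0|exact: (chaos_norm_ge0 part)].
- move=> p; under eq_Rintegral do rewrite -exprM.
  exact: (chaos_moment hF hW t0 part).
by rewrite -mulr_sumr -grid_normE exprMn -exprM (mulnC k n).
Qed.

End grid.

Section grid_iterated_sums.
Variables (N : nat) (sg : nat -> R).
Hypothesis part : partition_of t T N sg.

(** The cells that start before sg b are those of index less than b. *)
Lemma grid_iterated_nest (g : nat -> R -> R) (iota : nat -> 'I_m) l b w : (b <= N)%N ->
  grid_iterated f g iota N sg l (sg b) w =
  chaos f sg l iota (fun s => \prod_(r < l) g r (sg (nth 0%N s r))) b w.
Proof.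
elim: l b => [|l IH] b bN; first by rewrite /chaos /= !big_ord0 mulr1.
have [_ _ inc] := part.
have lt x y : (x < y)%N -> (y <= N)%N -> sg x < sg y.
  move=> xy yN; apply: lt_le_trans (inc x (leq_trans xy yN)) _.
  exact: (partition_le part).
rewrite /= /simple_int (bigID (fun c : 'I_N => (c < b)%N)) /= [X in _ + X]big1 ?addr0; last first.
  move=> c; rewrite -leqNgt => bc.
  by rewrite ltNge (partition_le part bc (ltnW (ltn_ord c))) mul0r.
rewrite /chaos /= (big_ord_widen_cond N xpredT (fun c => nest l c (fun s =>
   (\prod_(r < l.+1) g r (sg (nth 0%N (rcons s c) r))) *
   \prod_(r < l.+1) increment f (iota r) (sg (nth 0%N (rcons s c) r))
      (sg (nth 0%N (rcons s c) r).+1) w)))//.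
apply: eq_bigr => c cb.
have cN := leq_trans cb bN.
rewrite (lt c b cb bN) (min_idPl (partition_le part cb bN)).
rewrite (min_idPl (ltW (lt c b cb bN))) IH; last exact: ltnW.
rewrite /chaos !nestE mulr_sumr mulr_suml big_seq [RHS]big_seq; apply: eq_bigr => s.
rewrite mem_increasing_seqs => /and3P[/eqP sk _ _].
rewrite [in RHS]big_ord_recr [X in _ = _ * X]big_ord_recr /= nth_rcons sk ltnn eqxx.
have e1 : \prod_(r < l) g r (sg (nth 0%N (rcons s c) r)) =
    \prod_(r < l) g r (sg (nth 0%N s r)).
  by apply: eq_bigr => r _; rewrite nth_rcons sk ltn_ord.
have e2 : \prod_(r < l) increment f (iota r) (sg (nth 0%N (rcons s c) r))
      (sg (nth 0%N (rcons s c) r).+1) w =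
    \prod_(r < l) increment f (iota r) (sg (nth 0%N s r)) (sg (nth 0%N s r).+1) w.
  by apply: eq_bigr => r _; rewrite nth_rcons sk ltn_ord.
by rewrite e1 e2 /increment; ring.
Qed.

(** A product of functions of one variable stays one under every permutation, so
the sum decomposes into k! iterated sums. *)
Lemma multiple_sum_prod (g : 'I_k -> R -> R) w :
  multiple_sum N sg (fun x => \prod_(r < k) g r (sg (x r))) w =
  \sum_(p : 'S_k) grid_iterated f (fun q => g (p^-1%g (inord q)))
    (perm_component p) N sg k T w.
Proof.
rewrite multiple_sumE; apply: eq_bigr => p _.
have [_ eT _] := part; rewrite -eT grid_iterated_nest//.
apply: eq_nest => s sk; congr (_ * _); rewrite /perm_coef.
rewrite (reindex_inj (@perm_inj _ (p^-1)%g)) /=; apply: eq_bigr => q _.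
by rewrite permKV inord_val.
Qed.

(** Only the identity permutation keeps an increasing index increasing. *)
Lemma multiple_sum_kernel (psi : 'I_k -> R -> R) w :
  multiple_sum N sg (fun x =>
    if [forall r : 'I_k, forall r' : 'I_k, (r < r')%N ==> (sg (x r) < sg (x r'))]
    then \prod_(r < k) psi r (sg (x r)) else 0) w =
  grid_iterated f (fun q => psi (inord q)) (fun q => i (inord q)) N sg k T w.
Proof.
have [_ eT inc] := part.
have lt x y : (x < y)%N -> (y <= N)%N -> sg x < sg y.
  move=> xy yN; apply: lt_le_trans (inc x (leq_trans xy yN)) _.
  exact: (partition_le part).
rewrite -eT grid_iterated_nest// multiple_sumE (bigD1 (1%g : 'S_k))//= [X in _ + X]big1 ?addr0.
  rewrite /chaos !nestE big_seq [RHS]big_seq; apply: eq_bigr => s.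
  rewrite mem_increasing_seqs => /and3P[/eqP sk so al].
  rewrite /perm_coef; case: ifPn => [_|/negP[]].
    congr (_ * _); first by apply: eq_bigr => r _; rewrite perm1 inord_val.
    by apply: eq_bigr => r _; rewrite /perm_component invg1 perm1.
  apply/forallP => r; apply/forallP => r'; apply/implyP => rr'; rewrite !perm1.
  apply: lt.
    by apply: (sorted_ltn_nth ltn_trans) => //; rewrite inE sk ltn_ord.
  by apply: ltnW; apply: (allP al); rewrite mem_nth// sk.
move=> p p1; rewrite /chaos nestE big_seq big1// => s.
rewrite mem_increasing_seqs => /and3P[/eqP sk so al].
rewrite /perm_coef; case: ifPn => [/forallP H|_]; last by rewrite mul0r.
move/eqP: p1; case; apply: perm_increasing => r r' rr'.
have {H} := H r => /forallP/(_ r'); rewrite rr' /= => ss.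
have sN x : (x < k)%N -> (nth 0%N s x <= N)%N.
  by move=> xk; apply: ltnW; apply: (allP al); rewrite mem_nth// sk.
rewrite ltnNge; apply/negP => pp.
have le : (nth 0%N s (p r') <= nth 0%N s (p r))%N.
  move: pp; rewrite leq_eqVlt => /predU1P[->//|pp]; apply: ltnW.
  by apply: (sorted_ltn_nth ltn_trans) => //; rewrite inE sk ltn_ord.
by move: ss; rewrite ltNge (partition_le part le (sN _ (ltn_ord _))).
Qed.

End grid_iterated_sums.

End multiple_sums.

(** * Convergence along the given partitions *)

Section along_partitions.
Context (R : realType) d (Omega : measurableType d) (P : probability Omega R).
Variables (t T : R) (F : R -> set_system Omega) (m : nat) (f : 'I_m -> R -> Omega -> R).
Hypothesis hF : filtration T F.
Hypothesis hW : wiener P T F f.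
Hypothesis t0 : 0 <= t.
Hypothesis tT : t < T.
Variable tau : nat -> nat -> R.
Hypothesis ptau : forall N, (0 < N)%N -> partition_of t T N (tau N).
Hypothesis mesh : \big[Num.max/0]_(a < N) (tau N a.+1 - tau N a) @[N --> \oo] --> (0 : R).
Local Notation rint X := (P.-integrable setT (EFin \o X)).
Local Notation E X := (\int[P]_w X w).

Lemma eventually_fine dlt : 0 < dlt -> exists N0, forall N, (N0 <= N)%N ->
  (0 < N)%N /\ fine_grid t T dlt N (tau N).
Proof.
move=> d0; move/cvgr0Pnorm_lt: mesh => /(_ _ d0)[N0 _ H].
exists (maxn N0 1) => N; rewrite geq_max => /andP[/H lN N1]; split=> //.
split; first exact: ptau.
move=> b bN; apply: le_trans (ltW lN); apply: le_trans (ler_norm _).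
exact: (le_bigmax _ (fun a : 'I_N => tau N a.+1 - tau N a) (Ordinal bN)).
Qed.

Lemma grid_iterated_allmom (g : nat -> R -> R) (iota : nat -> 'I_m) N l :
  allmom P (grid_iterated f g iota N (tau N) l T).
Proof.
case: N => [|N]; last first.
  have [] // := grid_iterated_adapted hF hW t0 g iota (ptau (ltn0Sn N)) l (s := T).
  by rewrite (ltW tT) lexx.
case: l => [|l]; first exact: allmom_cst.
have e w : grid_iterated f g iota 0 (tau 0%N) l.+1 T w = 0 by rewrite /= /simple_int big_ord0.
by rewrite (funext e : grid_iterated _ _ _ _ _ _ _ = _); exact: allmom_cst.
Qed.

Section iterated.
Variables (g : nat -> R -> R) (iota : nat -> 'I_m).
Hypothesis cg : forall l, {within `[t, T], continuous (g l)}.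

(** The iterated Ito integral satisfies the approximation property exactly. *)
Lemma grid_iterated_msconv k (Z : nat -> R -> Omega -> R) :
  approx_iterated P t T F f g iota 0 k Z -> measurable_fun setT (Z k T) ->
  msconv P (fun N => grid_iterated f g iota N (tau N) k T) (Z k T).
Proof.
move=> aZ mZ; split=> // e e0.
have [dl dl0 H] := grid_iterated_cvg hF hW t0 tT iota cg (leqnn k) (divr_gt0 e0 (ltr0n R 2)).
have [N0 HN] := eventually_fine dl0; exists N0 => N /HN[N1 fg].
have aZ' : approx_iterated P t T F f g iota dl k Z.
  have [Z0 ZP] := aZ; split=> // l s lk sT J u v h A fam A0 HA.
  have [q1 q2] := ZP l s lk sT J u v h A fam A0 HA; split=> //.
  by apply: (le_trans q2); rewrite lerD2l ltW.
have [|q1 q2] := H N (tau N) Z fg aZ' T; first by rewrite (ltW tT) lexx.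
by split=> //; rewrite (le_lt_trans q2)// ltr_pdivrMr// ltr_pMr// ltr1n.
Qed.

(** Grid sums over two fine partitions are close, as each one approximates the
other: they form a Cauchy sequence. *)
Lemma grid_iterated_limit k : exists Y, msconv P
  (fun N => grid_iterated f g iota N (tau N) k T) Y.
Proof.
apply: riesz_fischer => [N|e e0]; first exact/allmom_sqint/grid_iterated_allmom.
have [d1 d10 H] := grid_iterated_cvg hF hW t0 tT iota cg (leqnn k) (divr_gt0 e0 (ltr0n R 2)).
have [d2 d20 H'] := approx_iterated_grid hF hW t0 tT iota cg k d10.
have d0 : 0 < Num.min d1 d2 by rewrite lt_min d10.
have [N0 HN] := eventually_fine d0; exists N0 => N M /HN[_ [pN fN]] /HN[_ [pM fM]].
have f1 : fine_grid t T d1 N (tau N) by split=> // b /fN; rewrite le_min => /andP[].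
have f2 : fine_grid t T d2 M (tau M) by split=> // b /fM; rewrite le_min => /andP[].
have [|q1 q2] := H N (tau N) _ f1 (H' M (tau M) f2) T; first by rewrite (ltW tT) lexx.
by rewrite (le_lt_trans q2)// ltr_pdivrMr// ltr_pMr// ltr1n.
Qed.

End iterated.

Section single_integral.
Variables (phi : R -> R) (a : 'I_m) (zt : Omega -> R).
Hypothesis cphi : {within `[t, T], continuous phi}.
Hypothesis ito : is_ito P F (f a) t T (fun s _ => phi s) zt.

Definition single_sum N (w : Omega) : R :=
  \sum_(b < N) phi (tau N b) * (f a (tau N b.+1) w - f a (tau N b) w).

Lemma single_sumE N w : single_sum N w =
  chaos f (tau N) 1 (fun=> a) (fun s => phi (tau N (nth 0%N s 0))) N w.
Proof. by rewrite /chaos /=; apply: eq_bigr => b _; rewrite big_ord1. Qed.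

Lemma single_sum_allmom N : allmom P (single_sum N).
Proof.
case: N => [|N].
  by rewrite /single_sum; under eq_fun do rewrite big_ord0; exact: allmom_cst.
rewrite (funext (single_sumE N.+1)).
by have [] := chaos_adapted hF hW t0 (ptau (ltn0Sn N)) 1 (fun=> a)
  (fun s => phi (tau N.+1 (nth 0%N s 0))) (leqnn N.+1).
Qed.

Lemma sum_mesh N : (0 < N)%N -> \sum_(b < N) (tau N b.+1 - tau N b) = T - t.
Proof.
move=> N0; have [<- <- _] := ptau N0.
by rewrite -(big_mkord xpredT (fun b => tau N b.+1 - tau N b)) telescope_sumr.
Qed.

(** The case k = 1 of the moment bound; uniform in N because the norm is at most
G ^ 2 * (T - t). *)
Lemma single_sum_moment q : exists C, forall N,
  E (fun w => single_sum N w ^+ (2 * q)) <= C.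
Proof.
have [G G0 GP] := segment_bounded cphi.
exists (1 + ((2 * q - 1)%:R * (G ^+ 2 * (T - t))) ^+ q) => N.
have c0 : 0 <= (2 * q - 1)%:R * (G ^+ 2 * (T - t)).
  by rewrite mulr_ge0// mulr_ge0 ?sqr_ge0// subr_ge0 ltW.
case: N => [|N].
  rewrite /single_sum; under eq_Rintegral do rewrite big_ord0 expr0n.
  rewrite E_cst; apply: (@le_trans _ _ 1); first by case: (_ == _).
  by rewrite lerDl exprn_ge0.
under eq_Rintegral do rewrite single_sumE.
have part := ptau (ltn0Sn N).
apply: le_trans (chaos_moment hF hW t0 part q 1 _ _ (leqnn _)) _.
apply: (@le_trans _ _ (((2 * q - 1)%:R * (G ^+ 2 * (T - t))) ^+ q)); last by rewrite lerDr.
rewrite expr1; have n0 := chaos_norm_ge0 part 1 (fun s => phi (tau N.+1 (nth 0%N s 0))) (leqnn _).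
apply: lerXn2r; rewrite ?nnegrE//; first exact: mulr_ge0.
apply: ler_wpM2l => //.
rewrite /chaos_norm /= -(sum_mesh (ltn0Sn N)) mulr_sumr; apply: ler_sum => b _.
rewrite big_ord1 /=; apply: ler_wpM2r.
  by rewrite subr_ge0; apply: (partition_le part) => //; exact: ltn_ord.
rewrite -real_normK ?num_real// lerXn2r ?nnegrE//.
exact/GP/(grid_bounds part)/ltnW/ltn_ord.
Qed.

Lemma single_sum_msconv : msconv P single_sum zt.
Proof.
have mz : measurable_fun setT zt by have [_ [q [s [h [_ _ _ []]]]]] := ito.
split=> // e e0.
pose A := e / (8 * (T - t)).
have Tt0 : 0 < T - t by rewrite subr_gt0.
have A0 : 0 < A by rewrite divr_gt0// mulr_gt0.
pose om := Num.min 1 A.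
have om0 : 0 < om by rewrite lt_min ltr01.
have omA : om ^+ 2 <= A.
  apply: (@le_trans _ _ om); last by rewrite ge_min lexx orbT.
  by rewrite expr2 ger_pMl// ge_min lexx.
have [dl dl0 H] := segment_unif_continuous cphi om0.
have [N0 HN] := eventually_fine dl0; exists N0 => N /HN[N1 [part fN]].
pose h (b : 'I_N) (w : Omega) := phi (tau N b).
have fam : simple_family P F t T (fun b : 'I_N => tau N b) (fun b : 'I_N => tau N b.+1) h.
  move=> b; have /andP[h1 h2] := grid_bounds part (ltnW (ltn_ord b)).
  have /andP[h3 h4] := grid_bounds part (ltn_ord b).
  split=> //; first exact: (partition_le part).
    by apply: measurable_wrt_cst; apply: (filtration_sigma hF); rewrite (le_trans t0 h1).
  exact: sqint_cst.
have [|s1 l1] := ito_estimate hF hW t0 (ltW tT) (lexx T) ito fam (ltW A0).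
  move=> r rtT; have [b rb] := grid_cell part rtT.
  have e1 w : simple_proc (fun b : 'I_N => tau N b) (fun b : 'I_N => tau N b.+1) h r w =
      phi (tau N b).
    rewrite /simple_proc (bigD1 b)//= big1 ?addr0.
      by rewrite indicE mem_set ?mulr1//= in_itv.
    move=> b' b'b; rewrite indicE memNset ?mulr0//= in_itv /= => rb'.
    by move/eqP: b'b; apply; apply: val_inj; exact: (grid_cell_uniq part _ _ rb' rb).
  under eq_fun do rewrite e1.
  rewrite expectationE; last exact: rint_cst.
  rewrite E_cst lee_fin; apply: le_trans omA.
  rewrite -real_normK ?num_real// lerXn2r ?nnegrE ?(ltW om0)//.
  have /andP[tr rT] := rtT; have /andP[h1 h2] := rb.
  apply: H; first exact: (grid_bounds part (ltnW (ltn_ord b))).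
    by rewrite tr ltW.
  rewrite distrC ger0_norm ?subr_ge0//; apply: le_trans (fN b (ltn_ord b)).
  by rewrite lerD2r ltW.
split; first exact: s1.
apply: (le_lt_trans l1).
have -> : 4 * A * (T - t) = e / 2 by rewrite /A; field; rewrite gt_eqF.
by rewrite ltr_pdivrMr// ltr_pMr// ltr1n.
Qed.

Lemma single_sum_lpconv : lpconv P single_sum zt.
Proof.
apply: msconv_lpconv; [exact: single_sum_allmom|exact: single_sum_moment|].
exact: single_sum_msconv.
Qed.

End single_integral.

Section multiple.
Variables (k0 : nat).
Local Notation k := k0.+1.
Variables (i : 'I_k -> 'I_m) (phi : nat -> R -> R) (zeta : nat -> 'I_m -> Omega -> R).
Hypothesis cphi : forall j, {within `[t, T], continuous (phi j)}.
Hypothesis ito : forall j a, is_ito P F (f a) t T (fun s _ => phi j s) (zeta j a).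

(** The part of the product of the single sums in which all indices differ. *)
Definition off_diagonal (j : 'I_k -> nat) N :=
  multiple_sum f i N (tau N) (fun x => \prod_(r < k) phi (j r) (tau N (x r))).

(** The full sum factors into single sums; removing the sum over pairwise
distinct indices leaves the diagonal sum. *)
Lemma sumGE j N w : sumG f i phi tau j N w =
  \prod_(r < k) single_sum (phi (j r)) (i r) N w - off_diagonal j N w.
Proof.
rewrite /sumG /single_sum bigA_distr_bigA /= /off_diagonal /multiple_sum.
rewrite [X in _ = X - _](bigID (mem (idxL k N))) /=.
under [X in _ = _ - X]eq_bigr do rewrite -big_split.
rewrite addrAC subrr add0r; apply: eq_bigl => l.
by rewrite !inE andbT.
Qed.

Lemma full_sum_msconv j :
  msconv P (fun N w => \prod_(r < k) single_sum (phi (j r)) (i r) N w)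
    (fun w => \prod_(r < k) zeta (j r) (i r) w).
Proof.
by apply: lpconv_msconv; apply: lpconv_prod => r; apply: single_sum_lpconv.
Qed.

Lemma off_diagonal_limit j : exists Y, msconv P (off_diagonal j) Y.
Proof.
have /choice[Y HY] (p : 'S_k) : exists Y, msconv P (fun N =>
    grid_iterated f (fun q => phi (j (p^-1%g (inord q)))) (perm_component i p) N (tau N) k T) Y.
  by apply: grid_iterated_limit => l; exact: cphi.
exists (fun w => \sum_p Y p w).
apply: (eq_msconv (N1 := 1%N) _ (msconv_sum (index_enum _) HY)) => N N1.
by apply/funext => w; rewrite /off_diagonal (multiple_sum_prod _ _ (ptau N1) (fun r => phi (j r))).
Qed.

Lemma measurable_off_diagonal j N : measurable_fun setT (off_diagonal j N).
Proof.
case: N => [|N].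
  have e w : off_diagonal j 0 w = 0.
    rewrite /off_diagonal /multiple_sum big1// => l _.
    by have := ltn_ord (l ord0); rewrite ltn0.
  by rewrite (funext e).
by have [] := multiple_sum_allmom hF hW t0 i (ptau (ltn0Sn N))
  (fun x => \prod_(r < k) phi (j r) (tau N.+1 (x r))).
Qed.

Lemma measurable_sumG j N : measurable_fun setT (sumG f i phi tau j N).
Proof.
rewrite (funext (sumGE j N)); apply: measurable_funB; last exact: measurable_off_diagonal.
by apply: measurable_prod => r _; have [] := single_sum_allmom (phi (j r)) (i r) N.
Qed.

Lemma sumG_limit j : exists D, lim_ms P (sumG f i phi tau j) D.
Proof.
have [Y HY] := off_diagonal_limit j.
exists (fun w => \prod_(r < k) zeta (j r) (i r) w - Y w).
apply/lim_msP; first exact: measurable_sumG.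
have := msconvB (full_sum_msconv j) HY; congr msconv.
by apply/funext => N; apply/funext => w; rewrite sumGE.
Qed.

Lemma off_diagonal_msconv j D : lim_ms P (sumG f i phi tau j) D ->
  msconv P (off_diagonal j) (fun w => \prod_(r < k) zeta (j r) (i r) w - D w).
Proof.
move=> lD; have HD := (lim_msP P D (measurable_sumG j)).1 lD.
have := msconvB (full_sum_msconv j) HD; congr msconv.
by apply/funext => N; apply/funext => w; rewrite sumGE opprB addrC subrK.
Qed.

End multiple.

End along_partitions.

(** * Bounded measurable functions and Bessel's identity *)

Section bounded_measurable.
Context d (X : measurableType d) (R : realType).
Variable mu : {measure set X -> \bar R}.
Variable D : set X.
Hypothesis mD : measurable D.
Implicit Types f g : X -> R.

(** Bounded measurable functions on a set of finite measure form an algebra of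
integrable functions. *)
Definition bmeas f :=
  measurable_fun D f /\ exists2 C, 0 <= C & forall x, D x -> `|f x| <= C.

Lemma bmeas_cst c : bmeas (fun=> c).
Proof. by split=> //; exists `|c|. Qed.

Lemma bmeasD f g : bmeas f -> bmeas g -> bmeas (fun x => f x + g x).
Proof.
move=> [mf [C C0 Hf]] [mg [C' C'0 Hg]]; split; first exact: measurable_funD.
exists (C + C'); first exact: addr_ge0.
by move=> x Dx; rewrite (le_trans (ler_normD _ _))// lerD ?Hf ?Hg.
Qed.

Lemma bmeasM f g : bmeas f -> bmeas g -> bmeas (fun x => f x * g x).
Proof.
move=> [mf [C C0 Hf]] [mg [C' C'0 Hg]]; split; first exact: measurable_funM.
exists (C * C'); first exact: mulr_ge0.
by move=> x Dx; rewrite normrM ler_pM ?Hf ?Hg.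
Qed.

Lemma bmeasZ c f : bmeas f -> bmeas (fun x => c * f x).
Proof. by move=> bf; apply: bmeasM => //; exact: bmeas_cst. Qed.

Lemma bmeasB f g : bmeas f -> bmeas g -> bmeas (fun x => f x - g x).
Proof.
move=> bf bg; have := bmeasD bf (bmeasZ (-1) bg).
by under [in X in X -> _]eq_fun do rewrite mulN1r.
Qed.

Lemma bmeasX f n : bmeas f -> bmeas (fun x => f x ^+ n).
Proof.
move=> [mf [C C0 Hf]]; split; first exact: measurable_funX.
exists (C ^+ n); first by rewrite exprn_ge0.
by move=> x Dx; rewrite normrX lerXn2r ?nnegrE// Hf.
Qed.

Lemma bmeas_norm f : bmeas f -> bmeas (fun x => `|f x|).
Proof.
move=> [mf [C C0 Hf]]; split; first exact: measurableT_comp.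
by exists C => // x Dx; rewrite normr_id Hf.
Qed.

Lemma bmeas_sum I (s : seq I) (h : I -> X -> R) :
  (forall i, bmeas (h i)) -> bmeas (fun x => \sum_(i <- s) h i x).
Proof.
move=> H; elim: s => [|a s IH].
  by under eq_fun do rewrite big_nil; exact: bmeas_cst.
by under eq_fun do rewrite big_cons; exact: bmeasD.
Qed.

Lemma bmeas_prod I (s : seq I) (h : I -> X -> R) :
  (forall i, bmeas (h i)) -> bmeas (fun x => \prod_(i <- s) h i x).
Proof.
move=> H; elim: s => [|a s IH].
  by under eq_fun do rewrite big_nil; exact: bmeas_cst.
by under eq_fun do rewrite big_cons; exact: bmeasM.
Qed.

Hypothesis muD : (mu D < +oo)%E.

Lemma bmeas_integrable f : bmeas f -> mu.-integrable D (EFin \o f).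
Proof.
move=> [mf [C C0 Hf]]; apply: measurable_bounded_integrable => //.
exists C; split; first exact: num_real.
by move=> M CM x Dx; apply: le_trans (ltW CM); exact: Hf.
Qed.

Section bessel.
Variables (J : finType) (u : J -> X -> R).
Hypothesis bu : forall j, bmeas (u j).
Hypothesis ortho : forall j j', \int[mu]_(x in D) (u j x * u j' x) = (j == j')%:R.

Definition coef f j := \int[mu]_(x in D) (f x * u j x).

(** Pythagoras: the Fourier coefficients minimise the distance to f. *)
Lemma bessel_identity f (a : J -> R) : bmeas f ->
  \int[mu]_(x in D) ((f x - \sum_j a j * u j x) ^+ 2) =
  \int[mu]_(x in D) (f x ^+ 2) - \sum_j coef f j ^+ 2 + \sum_j (coef f j - a j) ^+ 2.
Proof.
move=> bf; have I g (bg : bmeas g) := bmeas_integrable bg.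
pose g x := \sum_j a j * u j x.
have bau j : bmeas (fun x => a j * u j x) by exact: bmeasZ.
have bg : bmeas g by exact: bmeas_sum.
have e1 : \int[mu]_(x in D) (f x * g x) = \sum_j a j * coef f j.
  rewrite (@eq_Rintegral _ _ _ mu D (fun x => \sum_j a j * (f x * u j x))); last first.
    by move=> x _; rewrite mulr_sumr; apply: eq_bigr => j _; rewrite mulrCA.
  rewrite Rintegral_sum//; last by move=> j _; apply/I/bmeasZ/bmeasM.
  by apply: eq_bigr => j _; apply: RintegralZl => //; apply/I/bmeasM.
have e2 : \int[mu]_(x in D) (g x * g x) = \sum_j a j ^+ 2.
  rewrite (@eq_Rintegral _ _ _ mu D
    (fun x => \sum_j \sum_j' a j * a j' * (u j x * u j' x))); last first.
    move=> x _; rewrite /g big_distrlr /=; apply: eq_bigr => j _; apply: eq_bigr => j' _.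
    by ring.
  have bb j j' : bmeas (fun x => a j * a j' * (u j x * u j' x)).
    by apply: bmeasZ; exact: bmeasM.
  rewrite Rintegral_sum//; last by move=> j _; apply/I/bmeas_sum.
  apply: eq_bigr => j _; rewrite Rintegral_sum//; last by move=> j' _; exact: I.
  rewrite (bigD1 j)//= big1 ?addr0.
    rewrite RintegralZl//; last by apply/I/bmeasM.
    by rewrite ortho eqxx mulr1 expr2.
  move=> j' j'j; rewrite RintegralZl//; last by apply/I/bmeasM.
  by rewrite ortho eq_sym (negbTE j'j) mulr0.
rewrite (@eq_Rintegral _ _ _ mu D
  (fun x => (f x ^+ 2 + -2 * (f x * g x)) + g x * g x)); last first.
  by move=> x _; rewrite /g; ring.
have b1 : bmeas (fun x => -2 * (f x * g x)) by apply: bmeasZ; exact: bmeasM.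
rewrite RintegralD//; [|by apply: I; apply: bmeasD => //; exact: bmeasX
                       |by apply: I; exact: bmeasM].
rewrite RintegralD//; [|by apply: I; exact: bmeasX|exact: I].
rewrite RintegralZl//; last by apply: I; exact: bmeasM.
rewrite e1 e2 -!addrA; congr (_ + _); rewrite mulr_sumr -sumrN -!big_split /=.
by apply: eq_bigr => j _; ring.
Qed.

Definition residual f := \int[mu]_(x in D) (f x ^+ 2) - \sum_j coef f j ^+ 2.

Lemma residualE f : bmeas f ->
  residual f = \int[mu]_(x in D) ((f x - \sum_j coef f j * u j x) ^+ 2).
Proof.
move=> bf; rewrite bessel_identity// [X in _ = _ + X]big1 ?addr0// => j _.
by rewrite subrr expr0n.
Qed.

Lemma residual_ge0 f : bmeas f -> 0 <= residual f.
Proof. by move=> bf; rewrite residualE//; apply: Rintegral_ge0 => x _; exact: sqr_ge0. Qed.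

Lemma residual_le f (a : J -> R) : bmeas f ->
  residual f <= \int[mu]_(x in D) ((f x - \sum_j a j * u j x) ^+ 2).
Proof.
by move=> bf; rewrite bessel_identity// lerDl sumr_ge0// => j _; exact: sqr_ge0.
Qed.

Lemma residual_le_norm f : residual f <= \int[mu]_(x in D) (f x ^+ 2).
Proof. by rewrite gerBl sumr_ge0// => j _; exact: sqr_ge0. Qed.

Lemma coefZ c f j : bmeas f -> coef (fun x => c * f x) j = c * coef f j.
Proof.
move=> bf; rewrite /coef; under eq_Rintegral do rewrite -mulrA.
by apply: RintegralZl => //; apply: bmeas_integrable; exact: bmeasM.
Qed.

Lemma residualZ c f : bmeas f -> residual (fun x => c * f x) = c ^+ 2 * residual f.
Proof.
move=> bf; rewrite /residual; under eq_Rintegral do rewrite exprMn.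
rewrite RintegralZl//; last by apply: bmeas_integrable; exact: bmeasX.
under eq_bigr do rewrite coefZ// exprMn.
by rewrite -mulr_sumr mulrBr.
Qed.

(** The residual is a squared distance to a linear space: compare with the sum of
the best approximations. *)
Lemma residual_sum (I : finType) (h : I -> X -> R) :
  (forall i, bmeas (h i)) ->
  residual (fun x => \sum_i h i x) <= #|I|%:R * \sum_i residual (h i).
Proof.
move=> bh; have bp h' : bmeas h' -> bmeas (fun x => (h' x - \sum_j coef h' j * u j x)).
  by move=> bh'; apply: bmeasB => //; apply: bmeas_sum => j; exact: bmeasZ.
have ip h' (bh' : bmeas h') := bmeas_integrable (bmeasX 2 (bp h' bh')).
have bS : bmeas (fun x => \sum_i h i x) by exact: bmeas_sum.
apply: le_trans (residual_le (fun j => \sum_i coef (h i) j) bS) _.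
rewrite (eq_bigr _ (fun i _ => residualE (bh i))).
rewrite -Rintegral_sum//; last by move=> i _; exact: ip.
have iS : mu.-integrable D (EFin \o (fun x => \sum_i (h i x - \sum_j coef (h i) j * u j x) ^+ 2)).
  by apply: integrableR_sum => // i _; exact: ip.
rewrite -(RintegralZl _ mD iS).
apply: le_Rintegral => //; [|exact: integrableRZ|].
  apply/bmeas_integrable/bmeasX/bmeasB => //; apply: bmeas_sum => j; exact: bmeasZ.
move=> x _; have -> : \sum_i h i x - \sum_j (\sum_i coef (h i) j) * u j x =
    \sum_i (h i x - \sum_j coef (h i) j * u j x).
  rewrite sumrB exchange_big /=; congr (_ - _).
  by apply: eq_bigr => j _; rewrite mulr_suml.
exact: sqr_sum_le.
Qed.

Lemma residualD f g : bmeas f -> bmeas g ->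
  residual (fun x => f x + g x) <= 2 * residual f + 2 * residual g.
Proof.
move=> bf bg; have := @residual_sum bool (fun b => if b then f else g).
rewrite card_bool big_bool /= -mulrDr => H.
have -> : (fun x => f x + g x) = fun x => \sum_(b : bool) (if b then f else g) x.
  by apply/funext => x; rewrite big_bool.
by apply: H; case.
Qed.

End bessel.
End bounded_measurable.

(** Distributivity, with all the ranges first embedded into that of the largest p l. *)
Lemma sum_dffun (R : comNzRingType) (k : nat) (p : 'I_k -> nat)
    (G : 'I_k -> nat -> R) :
  \sum_(j : {dffun forall l : 'I_k, 'I_(p l).+1}) \prod_l G l (j l) =
  \prod_l \sum_(a < (p l).+1) G l a.
Proof.
pose M := \max_l p l.
have pM l : ((p l).+1 <= M.+1)%N by rewrite ltnS; exact: (leq_bigmax l).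
transitivity (\prod_l \sum_(a < M.+1 | (a < (p l).+1)%N) G l a).
  rewrite bigA_distr_big_dep /=.
  pose h (j : {dffun forall l : 'I_k, 'I_(p l).+1}) : {ffun 'I_k -> 'I_M.+1} :=
    [ffun l => inord (j l)].
  pose h' (j : {ffun 'I_k -> 'I_M.+1}) : {dffun forall l : 'I_k, 'I_(p l).+1} :=
    [ffun l => inord (j l)].
  rewrite (reindex_onto h h') /=; last first.
    move=> j /familyP jp; apply/ffunP => l; rewrite !ffunE; apply: val_inj.
    by rewrite /= (inordK (jp l)) inord_val.
  have hv j l : h j l = j l :> nat.
    by rewrite ffunE inordK// (leq_trans _ (pM l)).
  have e j : (h j \in family (fun l (a : 'I_M.+1) => (a < (p l).+1)%N)) && (h' (h j) == j).
    apply/andP; split; first by apply/familyP => l; rewrite unfold_in hv.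
    by apply/eqP/ffunP => l; rewrite ffunE; apply: val_inj; rewrite /= hv inord_val.
  rewrite [RHS](eq_bigl xpredT); last by move=> j; rewrite e.
  by apply: eq_bigr => j _; apply: eq_bigr => l _; rewrite hv.
apply: eq_bigr => l _.
by rewrite [RHS](big_ord_widen _ _ (pM l)).
Qed.

(** * Integrals of product functions on the cube *)

Section tuples.
Context (R : realType).
Local Notation mu := (@lebesgue_measure R).
Local Notation Tup k := (k.-tuple (measurableTypeR R)).

(** Fubini's theorem, one variable at a time. *)
Lemma product_integral k (g : 'I_k -> measurableTypeR R -> R) :
  (forall l, mu.-integrable setT (EFin \o g l)) ->
  (lebesgue_tuple R k).-integrable setT (EFin \o (fun x : Tup k => \prod_(l < k) g l (tnth x l))) /\
  Rintegral (lebesgue_tuple R k) setT (fun x : Tup k => \prod_(l < k) g l (tnth x l)) =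
  \prod_(l < k) Rintegral mu setT (g l).
Proof.
elim: k g => [|k IH] g ig.
  split.
    rewrite (_ : _ \o _ = cst 1%:E); last first.
      by apply/funext => x /=; rewrite big_ord0.
    apply/integrableP; split => //=.
    rewrite integral_dirac//= ?normr1 ?mul1e ?diracE ?mem_set//.
    by rewrite ltry.
  have e (x : Tup 0) : \prod_(l < 0) g l (tnth x l) = 1 by rewrite big_ord0.
  rewrite (funext e) /Rintegral /= integral_dirac//=.
  by rewrite indicE mem_set//= mulr1 big_ord0.
have [ik ek] := IH (fun l => g (lift ord0 l)) (fun l => ig _).
pose G (x : Tup k.+1) := \prod_(l < k.+1) g l (tnth x l).
pose mk := lebesgue_tuple R k.
have GE (p : measurableTypeR R * Tup k) : G (cons_pair p) =
    g ord0 p.1 * \prod_(l < k) g (lift ord0 l) (tnth p.2 l).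
  rewrite /G big_ord_recl /=; congr (g _ _ * _).
  by apply: eq_bigr => l _; congr (g _ _); rewrite !(tnth_nth 0).
have mG : measurable_fun setT G.
  apply: measurable_prod => l _.
  exact: measurableT_comp (integrableR_measurable (ig l)) (measurable_tnth l).
have iT := integrable_tensor (ig ord0) ik.
have eT := Rintegral_tensor (ig ord0) ik.
have iGc : (mu \x mk)%E.-integrable setT (EFin \o G \o @cons_pair R k).
  by apply: eq_integrable iT => // p _ /=; rewrite GE.
have iG : (pushforward (mu \x mk)%E (@cons_pair R k)).-integrable setT (EFin \o G).
  apply: integrable_pushforward => //; first exact: measurable_cons_pair.
  exact/measurable_EFinP.
have push (h : Tup k.+1 -> \bar R) :
    (\int[lebesgue_tuple R k.+1]_x h x =
     \int[pushforward (mu \x mk)%E (@cons_pair R k)]_x h x)%E.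
  by apply: eq_measure_integral => //; exact: measurable_cons_pair.
split.
  apply/integrableP; split; first exact/measurable_EFinP.
  by rewrite push; have /integrableP[] := iG.
rewrite /Rintegral push integral_pushforward//.
- rewrite big_ord_recl -ek -eT; congr fine.
  by apply: eq_integral => p _; congr EFin; exact: GE.
- exact: measurable_cons_pair.
- exact/measurable_EFinP.
Qed.

Section cube.
Variables (t T : R).
Hypothesis tT : t < T.

Lemma measurable_cube k : measurable (@cube R t T k).
Proof.
rewrite (_ : @cube R t T k = \bigcap_(l in [set: 'I_k])
    ((fun x : Tup k => tnth x l) @^-1` `[t, T]%classic)); last first.
  apply/seteqP; split => x.
    by move=> Hx l _ /=; rewrite in_itv; exact: Hx.
  by move=> Hx l; have := Hx l I; rewrite /= in_itv.
apply: fin_bigcap_measurable => // l _.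
rewrite -[X in measurable X]setTI.
by apply: (measurable_tnth l) => //; exact: (@measurable_itv R).
Qed.

Lemma bmeas_coord k (l : 'I_k) (g : R -> R) :
  bmeas (`[t, T]%classic : set (measurableTypeR R)) g ->
  bmeas (@cube R t T k) (fun x => g (tnth x l)).
Proof.
move=> [mg [C C0 Hg]]; split.
  apply: (@measurable_comp _ _ _ _ _ _ (`[t, T]%classic : set (measurableTypeR R)) g) => //.
    by move=> _ [x Hx <-] /=; rewrite in_itv; exact: Hx.
  by apply: measurable_funTS; exact: measurable_tnth.
exists C => // x Hx; apply: Hg; rewrite /= in_itv; exact: Hx.
Qed.

Lemma lebesgue_segment : mu `[t, T]%classic = (T - t)%:E.
Proof. by rewrite lebesgue_measure_itv /= lte_fin tT EFinB. Qed.

Lemma lebesgue_segment_lty : (mu `[t, T]%classic < +oo)%E.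
Proof. by rewrite lebesgue_segment ltry. Qed.

Lemma cube_product_integral k (g : 'I_k -> measurableTypeR R -> R) :
  (forall l, bmeas (`[t, T]%classic : set (measurableTypeR R)) (g l)) ->
  \int[lebesgue_tuple R k]_(x in @cube R t T k) (\prod_(l < k) g l (tnth x l)) =
  \prod_(l < k) \int[mu]_(y in `[t, T]) g l y.
Proof.
move=> bg; rewrite Rintegral_mkcond.
pose h l := (g l) \_ `[t, T].
have ih l : mu.-integrable setT (EFin \o h l).
  rewrite /h -restrict_EFin; apply/(integrable_mkcond (EFin \o g l) _).1 => //.
  by apply: bmeas_integrable => //; exact: lebesgue_segment_lty.
have [_ eh] := product_integral ih.
rewrite (_ : _ \_ _ = fun x : Tup k => \prod_(l < k) h l (tnth x l)).
  by rewrite eh; apply: eq_bigr => l _; rewrite [RHS]Rintegral_mkcond.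
apply/funext => x; rewrite patchE; case: ifPn => [|/negP].
  rewrite inE => Hx; apply: eq_bigr => l _.
  by rewrite /h patchE mem_set//= in_itv; exact: Hx.
rewrite inE => Hx; have [l Hl] : exists l : 'I_k, ~ (t <= tnth x l <= T).
  by apply/existsNP => H; apply: Hx.
by rewrite (bigD1 l)//= /h patchE memNset ?mul0r//= in_itv.
Qed.

Lemma lebesgue_cube_lty k : (lebesgue_tuple R k (@cube R t T k) < +oo)%E.
Proof.
have b1 (l : 'I_k) :
    mu.-integrable setT (EFin \o (\1_(`[t, T]%classic) : measurableTypeR R -> R)).
  apply/integrableP; split; first exact/measurable_EFinP/measurable_indic.
  under eq_integral do rewrite /= ger0_norm//.
  by rewrite integral_indic// setIT lebesgue_segment_lty.
have [+ _] := product_integral b1 => /integrableP[_].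
apply: le_lt_trans.
have mc := @measurable_cube k.
rewrite -[X in lebesgue_tuple R k X]setIT -(integral_indic _ measurableT mc).
apply: ge0_le_integral => //.
- by apply/measurable_EFinP; exact: measurable_indic.
- apply/measurableT_comp => //; apply/measurable_EFinP; apply: measurable_prod => l _.
  exact: measurableT_comp (integrableR_measurable (b1 l)) (measurable_tnth l).
move=> x _; rewrite /= lee_fin; rewrite indicE; case: (pselect (cube t T x)) => Hx; last first.
  by rewrite memNset// normr_ge0.
rewrite mem_set// big1 ?normr1// => l _.
by rewrite indicE mem_set//= in_itv; exact: Hx.
Qed.

End cube.
End tuples.

(** * Riemann sums of functions with jumps on the diagonals *)

Section regular.
Context (R : realType) (t T : R).
Local Notation Tup k := (k.-tuple (measurableTypeR R)).

(** Uniform continuity as long as the coordinates keep their order: the kernel is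
of this kind, and so are products of continuous functions of one coordinate. *)
Definition regular k (Phi : Tup k -> R) :=
  bmeas (@cube R t T k) Phi /\
  forall e, 0 < e -> exists2 dlt, 0 < dlt & forall x y, cube t T x -> cube t T y ->
    (forall r, `|tnth x r - tnth y r| <= dlt) ->
    (forall r r', (tnth x r < tnth x r') = (tnth y r < tnth y r')) ->
    `|Phi x - Phi y| <= e.

Lemma regular_cst k c : regular (fun _ : Tup k => c).
Proof.
split; first exact: bmeas_cst.
by move=> e e0; exists 1 => // x y _ _ _ _; rewrite subrr normr0 ltW.
Qed.

Lemma regularD k (Phi Psi : Tup k -> R) : regular Phi -> regular Psi ->
  regular (fun x => Phi x + Psi x).
Proof.
move=> [bf Hf] [bg Hg]; split; first exact: bmeasD.
move=> e e0; have e2 : 0 < e / 2 by rewrite divr_gt0.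
have [d1 d10 H1] := Hf _ e2; have [d2 d20 H2] := Hg _ e2.
exists (Num.min d1 d2); first by rewrite lt_min d10.
move=> x y cx cy xy oxy; rewrite opprD addrACA (splitr e).
apply: le_trans (ler_normD _ _) _; apply: lerD.
  by apply: H1 => // r; have := xy r; rewrite le_min => /andP[].
by apply: H2 => // r; have := xy r; rewrite le_min => /andP[].
Qed.

Lemma regularM k (Phi Psi : Tup k -> R) : regular Phi -> regular Psi ->
  regular (fun x => Phi x * Psi x).
Proof.
move=> [bf Hf] [bg Hg]; split; first exact: bmeasM.
have [_ [A A0 HA]] := bf; have [_ [B B0 HB]] := bg.
move=> e e0; pose M := A + B + 1; have M0 : 0 < M by rewrite ltr_wpDl// addr_ge0.
have e2 : 0 < e / M by rewrite divr_gt0.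
have [d1 d10 H1] := Hf _ e2; have [d2 d20 H2] := Hg _ e2.
exists (Num.min d1 d2); first by rewrite lt_min d10.
move=> x y cx cy xy oxy.
have h1 : `|Phi x - Phi y| <= e / M.
  by apply: H1 => // r; have := xy r; rewrite le_min => /andP[].
have h2 : `|Psi x - Psi y| <= e / M.
  by apply: H2 => // r; have := xy r; rewrite le_min => /andP[].
have -> : Phi x * Psi x - Phi y * Psi y =
  Phi x * (Psi x - Psi y) + Psi y * (Phi x - Phi y) by ring.
apply: le_trans (ler_normD _ _) _; rewrite !normrM.
apply: (@le_trans _ _ (A * (e / M) + B * (e / M))).
  by apply: lerD; apply: ler_pM => //; [exact: HA|exact: HB].
rewrite -mulrDl mulrCA ger_pMr// ler_pdivrMr// mul1r /M.
by rewrite lerDl.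
Qed.

Lemma regular_sum k I (s : seq I) (h : I -> Tup k -> R) :
  (forall a, regular (h a)) -> regular (fun x => \sum_(a <- s) h a x).
Proof.
move=> H; elim: s => [|a s IH].
  by under eq_fun do rewrite big_nil; exact: regular_cst.
by under eq_fun do rewrite big_cons; exact: regularD.
Qed.

Lemma regular_prod k I (s : seq I) (h : I -> Tup k -> R) :
  (forall a, regular (h a)) -> regular (fun x => \prod_(a <- s) h a x).
Proof.
move=> H; elim: s => [|a s IH].
  by under eq_fun do rewrite big_nil; exact: regular_cst.
by under eq_fun do rewrite big_cons; exact: regularM.
Qed.

Lemma continuous_bmeas (g : R -> R) : {within `[t, T], continuous g} ->
  bmeas (`[t, T]%classic : set (measurableTypeR R)) g.
Proof.
move=> cg; split.
  exact: subspace_continuous_measurable_fun.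
have [G G0 HG] := segment_bounded cg; exists G => //.
Qed.

Lemma regular_coord k (l : 'I_k) (g : R -> R) : {within `[t, T], continuous g} ->
  regular (fun x : Tup k => g (tnth x l)).
Proof.
move=> cg; split; first exact/bmeas_coord/continuous_bmeas.
move=> e e0; have [dlt d0 H] := segment_unif_continuous cg e0; exists dlt => //.
by move=> x y cx cy xy _; apply: H; rewrite ?cx ?cy//; exact: xy.
Qed.

Lemma regular_order k (l l' : 'I_k) :
  regular (fun x : Tup k => (tnth x l < tnth x l')%R%:R).
Proof.
split.
  split.
    apply: measurable_funTS.
    rewrite (_ : (fun x => _) = \1_[set x : Tup k | tnth x l < tnth x l']).
      apply: measurable_indic; rewrite -[X in measurable X]setTI.
      have mc (r : 'I_k) : measurable_fun setT (fun x : Tup k => tnth x r : R).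
        exact: measurable_tnth.
      exact: (measurable_fun_ltr (mc l) (mc l') measurableT (Y := [set true]) I).
    by apply/funext => x; rewrite indicE; case: (boolP (_ < _)) => H;
      [rewrite mem_set|rewrite memNset//; exact/negP].
  by exists 1 => // x _; case: (_ < _); rewrite ?normr1 ?normr0.
by move=> e e0; exists 1 => // x y _ _ _ o; rewrite o subrr normr0 ltW.
Qed.

(** The kernel is a product of order indicators and of continuous functions. *)
Lemma regular_kernel k (psi : 'I_k -> R -> R) :
  (forall l, {within `[t, T], continuous (psi l)}) -> regular (Defs.kernel psi).
Proof.
move=> cpsi.
have -> : Defs.kernel psi = fun x : Tup k =>
    (\prod_(l < k) \prod_(l' < k) (if (l < l')%N then (tnth x l < tnth x l')%R%:R else 1)) *
    \prod_(l < k) psi l (tnth x l).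
  apply/funext => x; rewrite /Defs.kernel; case: ifPn => [/forallP H|].
    rewrite [X in _ = X * _]big1 ?mul1r// => l _; rewrite big1// => l' _.
    by have /forallP/(_ l') := H l; case: ltnP => //= _ ->.
  rewrite negb_forall => /existsP[l]; rewrite negb_forall => /existsP[l'].
  rewrite negb_imply => /andP[ll' /negbTE xx].
  by rewrite (bigD1 l)//= (bigD1 l')//= ll' xx !mul0r.
apply: regularM; apply: regular_prod => l; last exact: regular_coord.
apply: regular_prod => l'; case: (l < l')%N; last exact: regular_cst.
exact: regular_order.
Qed.

End regular.

(** * Step approximation on a product grid *)

Section steps.
Context (R : realType) (t T : R).
Hypothesis tT : t < T.
Local Notation mu := (@lebesgue_measure R).
Local Notation Tup k := (k.-tuple (measurableTypeR R)).

Definition cell (sg : nat -> R) (b : nat) : measurableTypeR R -> R :=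
  \1_(`[sg b, sg b.+1[%classic).

Definition node k N (sg : nat -> R) (l : {ffun 'I_k -> 'I_N}) : Tup k :=
  [tuple sg (l r) | r < k].

Definition step_approx k N (sg : nat -> R) (Phi : Tup k -> R) (x : Tup k) : R :=
  \sum_(l : {ffun 'I_k -> 'I_N}) Phi (node sg l) * \prod_(r < k) cell sg (l r) (tnth x r).

Definition riemann_sum k N (sg : nat -> R) (Phi : Tup k -> R) : R :=
  \sum_(l : {ffun 'I_k -> 'I_N})
    Phi (node sg l) * \prod_(r < k) (sg (l r).+1 - sg (l r)).

Lemma cellE sg b x : cell sg b x = (sg b <= x < sg b.+1)%R%:R.
Proof.
rewrite /cell indicE; congr (nat_of_bool _)%:R.
by apply/idP/idP; rewrite inE /= in_itv.
Qed.

Lemma cell_bmeas sg b : bmeas (`[t, T]%classic : set (measurableTypeR R)) (cell sg b).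
Proof.
split; first by apply: measurable_funTS; exact: measurable_indic.
by exists 1 => // x _; rewrite cellE; case: (_ <= _ < _); rewrite ?normr1 ?normr0.
Qed.

Lemma end_bmeas : bmeas (`[t, T]%classic : set (measurableTypeR R)) (\1_([set T]) : R -> R).
Proof.
split; first by apply: measurable_funTS; exact: measurable_indic.
by exists 1 => // x _; rewrite indicE; case: (_ \in _); rewrite ?normr1 ?normr0.
Qed.

Section fixed_grid.
Variables (N : nat) (sg : nat -> R).
Hypothesis part : partition_of t T N sg.

Lemma cell_integral (b : 'I_N) :
  \int[mu]_(x in `[t, T]) cell sg b x = sg b.+1 - sg b.
Proof.
have [_ _ lt] := part.
have /andP[tb _] := grid_bounds part (ltnW (ltn_ord b)).
have /andP[_ bT] := grid_bounds part (ltn_ord b).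
rewrite /Rintegral.
have -> : (\int[mu]_(x in `[t, T]) (cell sg b x)%:E =
          mu (`[sg b, sg b.+1[%classic `&` `[t, T]%classic))%E.
  by rewrite /cell integral_indic.
rewrite (_ : _ `&` _ = `[sg b, sg b.+1[%classic); last first.
  apply/seteqP; split => x /=; rewrite !in_itv /=; first by case.
  move=> /andP[h1 h2]; split; first by rewrite h1.
  by rewrite (le_trans tb h1) ltW// (lt_le_trans h2 bT).
by rewrite lebesgue_measure_itv /= lte_fin lt.
Qed.

Lemma node_cube k (l : {ffun 'I_k -> 'I_N}) : cube t T (node sg l).
Proof. by move=> r; rewrite tnth_mktuple; exact: grid_bounds part (ltnW (ltn_ord _)). Qed.

Lemma bmeas_cells k (l : {ffun 'I_k -> 'I_N}) :
  bmeas (@cube R t T k) (fun x => \prod_(r < k) cell sg (l r) (tnth x r)).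
Proof.
apply: bmeas_prod => r; apply: bmeas_coord; exact: cell_bmeas.
Qed.

Lemma bmeas_step k (Phi : Tup k -> R) : bmeas (@cube R t T k) (step_approx N sg Phi).
Proof.
by apply: bmeas_sum => l; apply: bmeasZ; exact: bmeas_cells.
Qed.

Lemma integrable_cube k (h : Tup k -> R) : bmeas (@cube R t T k) h ->
  (lebesgue_tuple R k).-integrable (@cube R t T k) (EFin \o h).
Proof.
by apply: bmeas_integrable; [exact: measurable_cube|exact: lebesgue_cube_lty].
Qed.

Lemma step_integral k (Phi : Tup k -> R) :
  \int[lebesgue_tuple R k]_(x in @cube R t T k) step_approx N sg Phi x =
  riemann_sum N sg Phi.
Proof.
rewrite Rintegral_sum//; first last.
- move=> l _; by apply/integrable_cube/bmeasZ/bmeas_cells.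
- exact: measurable_cube.
apply: eq_bigr => l _; rewrite RintegralZl//; first last.
- exact/integrable_cube/bmeas_cells.
- exact: measurable_cube.
congr (_ * _).
rewrite (cube_product_integral tT (g := fun r => cell sg (l r))); last first.
  by move=> r; exact: cell_bmeas.
by apply: eq_bigr => r _; exact: cell_integral.
Qed.

(** A point of the cube lies in exactly one product of cells, unless one of its
coordinates is T. *)
Lemma step_cases k (Phi : Tup k -> R) (x : Tup k) : cube t T x ->
  (exists r, tnth x r = T) /\ step_approx N sg Phi x = 0 \/
  exists2 a : {ffun 'I_k -> 'I_N}, forall r, sg (a r) <= tnth x r < sg (a r).+1 &
    step_approx N sg Phi x = Phi (node sg a).
Proof.
move=> cx; have [[r xT]|nT] := pselect (exists r, tnth x r = T); [left|right].
  split; first by exists r.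
  rewrite /step_approx big1// => l _.
  have /andP[_ bT] := grid_bounds part (ltn_ord (l r)).
  by rewrite (bigD1 r)//= cellE xT (ltNge T) bT andbF mul0r mulr0.
have /choice[a0 a0P] (r : 'I_k) : exists b : 'I_N, sg b <= tnth x r < sg b.+1.
  apply: (grid_cell part); have /andP[h1 h2] := cx r; rewrite h1 lt_neqAle h2 andbT.
  by apply/eqP => h; apply: nT; exists r.
pose a : {ffun 'I_k -> 'I_N} := [ffun r => a0 r].
have ax r : sg (a r) <= tnth x r < sg (a r).+1 by rewrite /a ffunE.
exists a => //; rewrite /step_approx (bigD1 a)//= [X in _ + X]big1 ?addr0 => [|l la].
  by rewrite big1 ?mulr1// => r _; rewrite cellE ax.
have [r lr] : exists r, l r != a r.
  by apply/existsP; rewrite -negb_forall; apply: contra la => /forallP H;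
    apply/eqP/ffunP => r; exact/eqP/H.
rewrite (bigD1 r)//= cellE; case: (boolP (_ <= _ < _)) => [H|]; rewrite ?mul0r ?mulr0//.
case/eqP: lr; apply: val_inj.
exact: (grid_cell_uniq part (ltn_ord _) (ltn_ord _) H (ax r)).
Qed.

Lemma step_bound k (Phi : Tup k -> R) C x :
  (forall y, cube t T y -> `|Phi y| <= C) -> cube t T x -> `|step_approx N sg Phi x| <= C.
Proof.
move=> HC cx; have [[_ ->]|[a _ ->]] := step_cases Phi cx.
  by rewrite normr0; exact: le_trans (HC x cx).
exact/HC/node_cube.
Qed.

(** The points at which the step approximation need not be close: two
coordinates share a cell, or a coordinate sits at the right end of the segment,
which belongs to no cell. *)
Definition exceptional k (x : Tup k) : R :=
  \sum_(q : 'I_k * 'I_k | q.1 != q.2) \sum_(b < N)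
     cell sg b (tnth x q.1) * cell sg b (tnth x q.2) +
  \sum_(r < k) (\1_([set T]) : R -> R) (tnth x r).

Lemma exceptional_ge0 k (x : Tup k) : 0 <= exceptional x.
Proof.
rewrite addr_ge0 ?sumr_ge0// => q _; rewrite ?sumr_ge0// => b _.
by rewrite mulr_ge0// cellE ler0n.
Qed.

(** When the coordinates lie in distinct cells, their order is that of the node. *)
Lemma step_pointwise k (Phi : Tup k -> R) C e dlt x :
  0 <= e -> (forall y, cube t T y -> `|Phi y| <= C) ->
  (forall b : 'I_N, sg b.+1 - sg b <= dlt) ->
  (forall x y, cube t T x -> cube t T y ->
    (forall r, `|tnth x r - tnth y r| <= dlt) ->
    (forall r r', (tnth x r < tnth x r') = (tnth y r < tnth y r')) ->
    `|Phi x - Phi y| <= e) ->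
  cube t T x ->
  `|step_approx N sg Phi x - Phi x| <= e + C *+ 2 * exceptional x.
Proof.
move=> e0 HC mesh HP cx.
have C0 : 0 <= C by apply: le_trans (HC x cx).
have big1e : 1 <= exceptional x ->
    `|step_approx N sg Phi x - Phi x| <= e + C *+ 2 * exceptional x.
  move=> ge1; apply: le_trans (ler_normB _ _) _.
  apply: (@le_trans _ _ (C *+ 2)); first by rewrite mulr2n lerD// ?HC// step_bound.
  by apply: ler_wpDl => //; rewrite ler_peMr// mulrn_wge0.
have [[[r xr] _]|[a ax sE]] := step_cases Phi cx.
  apply: big1e; rewrite /exceptional; apply: ler_wpDl.
    apply: sumr_ge0 => q _; apply: sumr_ge0 => b _.
    by rewrite mulr_ge0// cellE ler0n.
  by rewrite (bigD1 r)//= {1}indicE mem_set//= lerDl sumr_ge0.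
have [[[r r'] /= [rr' arr]]|inj] :=
    pselect (exists q : 'I_k * 'I_k, q.1 != q.2 /\ a q.1 = a q.2).
  apply: big1e; rewrite /exceptional; apply: ler_wpDr; first by apply: sumr_ge0 => ? _.
  rewrite (bigD1 (r, r'))//= (bigD1 (a r))//= !cellE ax arr ax mulr1.
  rewrite -addrA lerDl addr_ge0//; last apply: sumr_ge0 => q _;
    by apply: sumr_ge0 => b _; rewrite mulr_ge0// cellE ler0n.
rewrite sE; apply: ler_wpDr.
  by rewrite mulr_ge0 ?exceptional_ge0// mulrn_wge0.
have inja r r' : r != r' -> a r != a r'.
  by move=> rr'; apply/eqP => aa; apply: inj; exists (r, r').
apply: HP => //; first exact: node_cube.
  move=> r; rewrite tnth_mktuple distrC ger0_norm.
    have := mesh (a r); have /andP[_ h] := ax r; move: h; lra.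
  by rewrite subr_ge0; have /andP[] := ax r.
have mono (b b' : nat) : (b < b')%N -> (b' <= N)%N -> sg b.+1 <= sg b'.
  have [_ _ lt] := part.
  move=> + b'N; elim: b' b'N => // b' IH b'N; rewrite ltnS leq_eqVlt => /predU1P[->//|bb'].
  by apply: le_trans (IH (ltnW b'N) bb') _; exact/ltW/lt.
have ord (r r' : 'I_k) : (a r < a r')%N -> tnth x r < tnth x r' /\ sg (a r) < sg (a r').
  move=> aa; have h := mono _ _ aa (ltnW (ltn_ord (a r'))).
  have [_ _ lt] := part; have := lt _ (ltn_ord (a r)).
  by have /andP[h1 h2] := ax r; have /andP[h3 h4] := ax r'; split; lra.
move=> r r'; rewrite !tnth_mktuple.
have [->|rr'] := eqVneq r r'; first by rewrite !ltxx.
have := inja _ _ rr'; rewrite -val_eqE /= neq_ltn => /orP[] /ord[h1 h2].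
  by rewrite h1 h2.
by rewrite !ltNge !ltW.
Qed.

Lemma exceptional_bmeas k : bmeas (@cube R t T k) (@exceptional k).
Proof.
apply: bmeasD.
  rewrite (_ : (fun _ => _) = fun x : Tup k => \sum_q if q.1 != q.2 then
      \sum_(b < N) cell sg b (tnth x q.1) * cell sg b (tnth x q.2) else 0); last first.
    by apply/funext => x; rewrite big_mkcond.
  apply: bmeas_sum => q; case: (q.1 != q.2); last exact: bmeas_cst.
  apply: bmeas_sum => b; apply: bmeasM => //; apply: bmeas_coord; exact: cell_bmeas.
by apply: bmeas_sum => r; exact: (@bmeas_coord R t T k r _ end_bmeas).
Qed.

(** The factor 1 + (T - t) dominates both T - t and 1, so that its power k bounds
the integral over the other coordinates whatever their number. *)
Lemma cube_coord2_integral k (r r' : 'I_k) (g : measurableTypeR R -> R) : r != r' ->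
  bmeas (`[t, T]%classic : set (measurableTypeR R)) g -> (forall x, 0 <= g x) ->
  \int[lebesgue_tuple R k]_(x in @cube R t T k) (g (tnth x r) * g (tnth x r')) <=
  (\int[mu]_(y in `[t, T]) g y) ^+ 2 * (1 + (T - t)) ^+ k.
Proof.
move=> rr' bg g0.
pose h (l : 'I_k) : measurableTypeR R -> R := if l \in pred2 r r' then g else fun=> 1.
have bh l : bmeas (`[t, T]%classic : set (measurableTypeR R)) (h l).
  by rewrite /h; case: (l \in _) => //; exact: bmeas_cst.
have r'r : r' != r by rewrite eq_sym.
have hr : h r = g by rewrite /h inE eqxx.
have hr' : h r' = g by rewrite /h inE eqxx orbT.
rewrite (@eq_Rintegral _ _ _ _ _ (fun x : Tup k => \prod_(l < k) h l (tnth x l))); last first.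
  move=> x _; rewrite (bigD1 r)//= (bigD1 r')//= hr hr' big1 ?mulr1// => l /andP[lr lr'].
  by rewrite /h inE (negbTE lr) (negbTE lr').
rewrite cube_product_integral// (bigD1 r)//= (bigD1 r')//= hr hr' mulrA -expr2.
apply: ler_wpM2l; first exact: sqr_ge0.
have e1 l : (l != r) && (l != r') -> \int[mu]_(y in `[t, T]) h l y = T - t.
  move=> /andP[lr lr']; rewrite /h inE (negbTE lr) (negbTE lr').
  rewrite Rintegral_cst//= lebesgue_segment//= mul1r//.
rewrite (eq_bigr _ e1) prodr_const.
have Tt : 0 <= T - t by rewrite subr_ge0 ltW.
apply: (@le_trans _ _ ((1 + (T - t)) ^+ #|[pred l | (l != r) && (l != r')]|)).
  by apply: lerXn2r; rewrite ?nnegrE//; [exact: addr_ge0|rewrite lerDr].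
by rewrite ler_weXn2l ?lerDl// -[leqRHS]card_ord max_card.
Qed.

Lemma cube_coord_null k (r : 'I_k) (g : measurableTypeR R -> R) :
  bmeas (`[t, T]%classic : set (measurableTypeR R)) g ->
  \int[mu]_(y in `[t, T]) g y = 0 ->
  \int[lebesgue_tuple R k]_(x in @cube R t T k) g (tnth x r) = 0.
Proof.
move=> bg g0.
pose h (l : 'I_k) : measurableTypeR R -> R := if l == r then g else fun=> 1.
have bh l : bmeas (`[t, T]%classic : set (measurableTypeR R)) (h l).
  by rewrite /h; case: (l == r) => //; exact: bmeas_cst.
have hr : h r = g by rewrite /h eqxx.
rewrite (@eq_Rintegral _ _ _ _ _ (fun x : Tup k => \prod_(l < k) h l (tnth x l))); last first.
  move=> x _; rewrite (bigD1 r)//= hr big1 ?mulr1// => l lr.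
  by rewrite /h (negbTE lr).
by rewrite cube_product_integral// (bigD1 r)//= hr g0 mul0r.
Qed.

Lemma end_integral : \int[mu]_(y in `[t, T]) (\1_([set T]) : measurableTypeR R -> R) y = 0.
Proof.
have m0 : mu ([set T] `&` `[t, T]%classic) = 0%E.
  apply: (@subset_measure0 _ _ _ mu _ [set T]) => //; last exact: lebesgue_measure_set1.
  exact: measurableI.
by rewrite /Rintegral integral_indic//; exact: (congr1 (@fine R) m0).
Qed.

(** Two given coordinates share a cell on a set of measure at most the sum of the
squared lengths of the cells, hence of order the mesh. *)
Lemma exceptional_integral k dlt : 0 <= dlt -> (forall b : 'I_N, sg b.+1 - sg b <= dlt) ->
  \int[lebesgue_tuple R k]_(x in @cube R t T k) exceptional x <=
  (k * k)%:R * ((T - t) * (1 + (T - t)) ^+ k) * dlt.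
Proof.
move=> dlt0 mesh; have mc := @measurable_cube R t T k.
have [sg0 sgN lt] := part.
have bc b (q : 'I_k * 'I_k) : bmeas (@cube R t T k)
    (fun x => cell sg b (tnth x q.1) * cell sg b (tnth x q.2)).
  by apply: bmeasM; apply: bmeas_coord; exact: cell_bmeas.
have be (r : 'I_k) : bmeas (@cube R t T k) (fun x => (\1_([set T]) : R -> R) (tnth x r)).
  exact: (@bmeas_coord R t T k r _ end_bmeas).
have ic (q : 'I_k * 'I_k) : (lebesgue_tuple R k).-integrable (@cube R t T k) (EFin \o (fun x =>
    \sum_(b < N) cell sg b (tnth x q.1) * cell sg b (tnth x q.2))).
  by apply: integrable_cube; apply: bmeas_sum => b; exact: bc.
rewrite RintegralD//; first last.
- by apply: integrable_cube; apply: bmeas_sum => r; exact: be.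
- by apply: (integrableR_sum mc) => q _; exact: ic.
rewrite [X in _ + X]Rintegral_sum//; last by move=> r _; exact/integrable_cube/be.
rewrite [X in _ + X]big1 ?addr0; last first.
  by move=> r _; exact: (@cube_coord_null k r _ end_bmeas end_integral).
rewrite Rintegral_sum//.
pose c := (T - t) * (1 + (T - t)) ^+ k * dlt.
have Tt : 0 <= T - t by rewrite subr_ge0 ltW.
have M0 : 0 <= (1 + (T - t)) ^+ k by rewrite exprn_ge0// addr_ge0.
have bound (q : 'I_k * 'I_k) : q.1 != q.2 -> \int[lebesgue_tuple R k]_(x in @cube R t T k)
    (\sum_(b < N) cell sg b (tnth x q.1) * cell sg b (tnth x q.2)) <= c.
  move=> qq; rewrite Rintegral_sum//; last by move=> b _; exact/integrable_cube/bc.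
  have -> : c = \sum_(b < N) (sg b.+1 - sg b) * dlt * (1 + (T - t)) ^+ k.
    rewrite -!mulr_suml -(big_mkord xpredT (fun b => sg b.+1 - sg b)) telescope_sumr//.
    by rewrite sg0 sgN /c; ring.
  apply: ler_sum => b _; apply: le_trans (cube_coord2_integral qq _ _) _.
  - exact: cell_bmeas.
  - by move=> x; rewrite cellE ler0n.
  rewrite cell_integral; apply: ler_wpM2r => //.
  by rewrite expr2 ler_wpM2l// subr_ge0 ltW// lt.
apply: (@le_trans _ _ (\sum_(q : 'I_k * 'I_k) c)).
  apply: (@le_trans _ _ (\sum_(q : 'I_k * 'I_k | q.1 != q.2) c)); first exact: ler_sum.
  rewrite [leRHS](bigID (fun q : 'I_k * 'I_k => q.1 != q.2))/= lerDl.
  by rewrite sumr_ge0// => q _; rewrite /c !mulr_ge0.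
by rewrite sumr_const card_prod card_ord -[leLHS]mulr_natl /c mulrA.
Qed.

End fixed_grid.

(** Small pointwise error outside of a set of measure of order the mesh, and bounded
error on it. *)
Lemma step_L1 k (Phi : Tup k -> R) e : regular t T Phi -> 0 < e ->
  exists2 dlt, 0 < dlt & forall N sg, fine_grid t T dlt N sg ->
    \int[lebesgue_tuple R k]_(x in @cube R t T k) `|step_approx N sg Phi x - Phi x| <= e.
Proof.
move=> [bPhi rPhi] e0; have [_ [C C0 HC]] := bPhi.
have mc := @measurable_cube R t T k.
pose V := (T - t) ^+ k; have V0 : 0 <= V by rewrite exprn_ge0// subr_ge0 ltW.
pose M := (k * k)%:R * ((T - t) * (1 + (T - t)) ^+ k).
have M0 : 0 <= M.
  have Tt : 0 <= T - t by rewrite subr_ge0 ltW.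
  by rewrite /M !mulr_ge0// exprn_ge0//; exact: addr_ge0.
pose e1 := e / 2 / (V + 1).
have e10 : 0 < e1 by rewrite !divr_gt0// ltr_wpDl.
have [d1 d10 H1] := rPhi _ e10.
pose d2 := e / 2 / (C *+ 2 * M + 1).
have CM0 : 0 <= C *+ 2 * M by rewrite mulr_ge0// mulrn_wge0.
have d20 : 0 < d2 by rewrite !divr_gt0// ltr_wpDl.
exists (Num.min d1 d2); first by rewrite lt_min d10.
move=> N sg [part mesh].
have bP := @exceptional_bmeas N sg k.
have iV : \int[lebesgue_tuple R k]_(x in @cube R t T k) e1 <= e / 2.
  have -> : \int[lebesgue_tuple R k]_(x in @cube R t T k) e1 = e1 * V.
    have h : \int[lebesgue_tuple R k]_(x in @cube R t T k) (\prod_(l < k) (1 : R)) = V.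
      rewrite (cube_product_integral tT (g := fun l : 'I_k => fun=> 1)).
        rewrite Rintegral_cst//= lebesgue_segment//= mul1r.
        by rewrite prodr_const card_ord.
      by move=> l; exact: bmeas_cst.
    rewrite -h -RintegralZl//; last by apply: integrable_cube; exact: bmeas_cst.
    by apply: eq_Rintegral => x _; rewrite big1 ?mulr1.
  rewrite /e1 -[leRHS]mulr1 -mulrA ler_wpM2l ?divr_ge0 ?(ltW e0)//.
  by rewrite mulrC ler_pdivrMr ?mul1r ?lerDl// ltr_wpDl.
apply: (@le_trans _ _ (\int[lebesgue_tuple R k]_(x in @cube R t T k)
    (e1 + C *+ 2 * exceptional N sg x))).
  apply: le_Rintegral => //.
  - by apply: integrable_cube; apply/bmeas_norm/bmeasB => //; exact: bmeas_step.
  - by apply: integrable_cube; apply: bmeasD; [exact: bmeas_cst|exact: bmeasZ].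
  move=> x cx; apply: (@step_pointwise N sg part k Phi C e1 (Num.min d1 d2)) => //.
  - exact: ltW.
  - by move=> b; exact: mesh.
  move=> y z cy cz yz; apply: H1 => // r; apply: le_trans (yz r) _.
  by rewrite ge_min lexx.
rewrite RintegralD//; first last.
- by apply: integrable_cube; exact: bmeasZ.
- by apply: integrable_cube; exact: bmeas_cst.
rewrite (RintegralZl _ mc (integrable_cube bP)).
rewrite [leRHS](splitr e) lerD//.
have dlt0 : 0 <= Num.min d1 d2 by rewrite le_min !ltW.
have := @exceptional_integral N sg part k _ dlt0 (fun b => mesh b (ltn_ord b)).
rewrite -/M => /(ler_wpM2l (mulrn_wge0 2 C0)) /le_trans; apply.
rewrite mulrA; apply: (@le_trans _ _ (C *+ 2 * M * d2)).
  by apply: ler_wpM2l => //; rewrite ge_min lexx orbT.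
rewrite /d2 mulrCA -[leRHS]mulr1 ler_wpM2l ?divr_ge0 ?(ltW e0)//.
by rewrite ler_pdivrMr ?mul1r ?lerDl// ltr_wpDl.
Qed.

Lemma riemann_sum_limit k (Phi : Tup k -> R) e : regular t T Phi -> 0 < e ->
  exists2 dlt, 0 < dlt & forall N sg, fine_grid t T dlt N sg ->
    riemann_sum N sg Phi <= \int[lebesgue_tuple R k]_(x in @cube R t T k) Phi x + e.
Proof.
move=> rPhi e0; have [dlt d0 H] := step_L1 rPhi e0; exists dlt => // N sg fine.
have mc := @measurable_cube R t T k.
have [part _] := fine; have [bPhi _] := rPhi.
have bs := @bmeas_step N sg k Phi.
rewrite -(step_integral part) -lerBlDl -RintegralB//; [|exact: integrable_cube..].
apply: le_trans (H N sg fine).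
apply: le_Rintegral => //; [|by apply: integrable_cube; exact/bmeas_norm/bmeasB|].
  by apply: integrable_cube; exact: bmeasB.
by move=> x _; exact: ler_norm.
Qed.

Lemma fine_grid_exists dlt : 0 < dlt -> exists N sg, fine_grid t T dlt N sg.
Proof.
move=> d0; have Tt : 0 < T - t by rewrite subr_gt0.
pose N := (Num.truncn ((T - t) / dlt)).+1.
have N0 : 0 < N%:R :> R by rewrite ltr0n.
exists N, (fun b => t + b%:R * ((T - t) / N%:R)); split; last first.
  move=> b _; rewrite -natr1 mulrDl mul1r opprD addrACA subrr add0r addrAC subrr add0r.
  rewrite ler_pdivrMr// mulrC -ler_pdivrMr//; apply/ltW.
  by rewrite truncnS_gt.
split; first by rewrite mul0r addr0.
  by rewrite mulrC divfK ?gt_eqF// addrC subrK.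
by move=> b _; rewrite ltrD2l ltr_pM2r ?divr_gt0// ltr_nat.
Qed.

(** The error is bounded, so its square is controlled by its absolute value. *)
Lemma step_L2 k (Phi : Tup k -> R) e : regular t T Phi -> 0 < e ->
  exists N sg, partition_of t T N sg /\
    \int[lebesgue_tuple R k]_(x in @cube R t T k) ((Phi x - step_approx N sg Phi x) ^+ 2) <= e.
Proof.
move=> rPhi e0; have [bPhi _] := rPhi; have [_ [C C0 HC]] := bPhi.
have mc := @measurable_cube R t T k.
pose e1 := e / (C *+ 2 + 1).
have C20 : 0 <= C *+ 2 by rewrite mulrn_wge0.
have e10 : 0 < e1 by rewrite divr_gt0// ltr_wpDl.
have [dlt d0 H] := step_L1 rPhi e10; have [N [sg fine]] := fine_grid_exists d0.
have [part _] := fine; exists N, sg; split => //.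
have bD : bmeas (@cube R t T k) (fun x => step_approx N sg Phi x - Phi x).
  by apply: bmeasB => //; exact: bmeas_step.
apply: (@le_trans _ _ (C *+ 2 * e1)); last first.
  by rewrite /e1 mulrCA ger_pMr// ler_pdivrMr ?mul1r ?lerDl// ltr_wpDl.
apply: le_trans (ler_wpM2l C20 (H N sg fine)).
have iN := integrable_cube (bmeas_norm bD).
rewrite -(RintegralZl _ mc iN).
apply: le_Rintegral => //.
- apply: integrable_cube; apply: bmeasX; apply: bmeasB => //; exact: bmeas_step.
- by apply: integrable_cube; exact/bmeasZ/bmeas_norm.
move=> x cx; rewrite -normrN opprB -(real_normK (num_real _)) expr2 -normrN opprB.
rewrite ler_wpM2r//; apply: le_trans (ler_normB _ _) _.
by rewrite mulr2n lerD ?HC//; exact: step_bound.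
Qed.
End steps.

(** * Completeness of the tensor products *)

(** Telescoping the difference of two products of bounded factors. *)
Lemma prod_gap (R : realFieldType) k (a b : 'I_k -> R) A e : 1 <= A -> 0 <= e ->
  (forall l, 0 <= b l <= a l) -> (forall l, a l <= A) -> (forall l, a l - b l <= e) ->
  \prod_(l < k) a l - \prod_(l < k) b l <= k%:R * (e * A ^+ k).
Proof.
move=> A1 e0; have A0 : 0 <= A by exact: le_trans A1.
elim: k a b => [|k IH] a b ba aA ab; first by rewrite !big_ord0 subrr mul0r.
rewrite !big_ord_recl.
have := IH (fun l => a (lift ord0 l)) (fun l => b (lift ord0 l))
  (fun l => ba _) (fun l => aA _) (fun l => ab _).
have P0 : 0 <= \prod_(l < k) a (lift ord0 l) <= A ^+ k.
  apply/andP; split.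
    by apply: prodr_ge0 => l _; have /andP[h1 h2] := ba (lift ord0 l); exact: le_trans h2.
  rewrite -[X in _ ^+ X]card_ord -prodr_const; apply: ler_prod => l _.
  by have /andP[h1 h2] := ba (lift ord0 l); rewrite (le_trans h1 h2) aA.
move: (\prod_(l < k) a _) (\prod_(l < k) b _) P0 => pa pb /andP[pa0 paA] H.
have /andP[b0 b0a] := ba ord0.
have -> : a ord0 * pa - b ord0 * pb = (a ord0 - b ord0) * pa + b ord0 * (pa - pb) by ring.
have Ak : 0 <= A ^+ k by exact: exprn_ge0.
have h1 : (a ord0 - b ord0) * pa <= e * A ^+ k.+1.
  apply: ler_pM => //; first by rewrite subr_ge0.
  by apply: le_trans paA _; rewrite exprS ler_peMl.
have h2 : b ord0 * (pa - pb) <= A * (k%:R * (e * A ^+ k)).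
  apply: (@le_trans _ _ (b ord0 * (k%:R * (e * A ^+ k)))); first exact: ler_wpM2l.
  by apply: ler_wpM2r; [rewrite !mulr_ge0|exact: le_trans (aA ord0)].
apply: le_trans (lerD h1 h2) _; rewrite le_eqVlt; apply/orP; left; apply/eqP.
by rewrite exprS -natr1; ring.
Qed.

Section parseval.
Context (R : realType) (t T : R).
Hypothesis tT : t < T.
Local Notation mu := (@lebesgue_measure R).
Local Notation Tup k := (k.-tuple (measurableTypeR R)).
Variable phi : nat -> R -> R.
Hypothesis cphi : forall j, {within `[t, T], continuous (phi j)}.
Hypothesis complete : complete_orthonormal t T phi.
Local Notation seg := (`[t, T]%classic : set (measurableTypeR R)).

Let mseg : measurable seg.
Proof. exact: measurable_itv. Qed.

Lemma phi_bmeas j : bmeas seg (phi j).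
Proof. exact: continuous_bmeas (@cphi j). Qed.

Lemma phi_ortho j j' : \int[mu]_(x in seg) (phi j x * phi j' x) = (j == j')%:R.
Proof. by have [_ H _] := complete; exact: H. Qed.

Local Notation segment_residual p g :=
  (residual mu seg (fun a : 'I_p.+1 => phi a : measurableTypeR R -> R) g).

Lemma segment_integrable (g : measurableTypeR R -> R) : bmeas seg g ->
  mu.-integrable seg (EFin \o g).
Proof.
by apply: bmeas_integrable => //; exact: lebesgue_segment_lty.
Qed.

(** An approximation in the span of finitely many phi j bounds the residual, by
minimality of the Fourier coefficients. *)
Lemma parseval (g : measurableTypeR R -> R) e : bmeas seg g -> 0 < e ->
  exists p0, forall p, (p0 <= p)%N -> segment_residual p g <= e.
Proof.
move=> bg e0; have [_ _ dense] := complete.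
have ig2 := segment_integrable (bmeasX 2 bg).
have L2g : L2 t T g.
  split; first by case: bg.
  by rewrite (RintegralE mseg ig2) ltry.
have [q [c]] := dense _ L2g _ e0; set h := fun x => _ => hc.
exists q => p qp.
have bd (J : finType) (s : J -> nat) (a : J -> R) :
    bmeas seg (fun x => (g x - \sum_j a j * phi (s j) x) ^+ 2).
  apply: bmeasX; apply: bmeasB => //; apply: bmeas_sum => j; apply: bmeasZ.
  exact: phi_bmeas.
have ot (j j' : 'I_p.+1) : \int[mu]_(x in seg) (phi j x * phi j' x) = (j == j')%:R.
  by rewrite phi_ortho.
pose a (j : 'I_p.+1) := if (j < q)%N then c j else 0.
have h1 := residual_le mseg (lebesgue_segment_lty tT)
  (u := fun b : 'I_p.+1 => phi b) (fun j => phi_bmeas _) ot a bg.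
apply: le_trans h1 _.
rewrite -lee_fin -(RintegralE mseg); last exact/segment_integrable/bd.
apply: le_trans (ltW hc); rewrite le_eqVlt; apply/orP; left; apply/eqP.
apply: eq_integral => x _; rewrite /h; congr ((_ ^+ 2)%:E); congr (_ - _).
transitivity (\sum_(j < p.+1 | (j < q)%N) c j * phi j x).
  rewrite [RHS]big_mkcond /=; apply: eq_bigr => j _.
  by rewrite /a; case: (j < q)%N; rewrite ?mul0r.
by rewrite [RHS](big_ord_widen _ (fun j => c j * phi j x) (leqW qp)).
Qed.

Section tensor.
Variable k : nat.
Local Notation seg_coef g a := (\int[mu]_(x in seg) (g x * phi a x)).

Definition tensor (p : 'I_k -> nat) (j : {dffun forall l : 'I_k, 'I_(p l).+1}) (x : Tup k) : R :=
  \prod_(l < k) phi (j l) (tnth x l).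

Local Notation tensor_residual p h :=
  (residual (lebesgue_tuple R k) (@cube R t T k) (@tensor p) h).

Lemma tensor_bmeas p j : bmeas (@cube R t T k) (@tensor p j).
Proof. by apply: bmeas_prod => l; apply: bmeas_coord; exact: phi_bmeas. Qed.

Lemma tensor_ortho p (j j' : {dffun forall l : 'I_k, 'I_(p l).+1}) :
  \int[lebesgue_tuple R k]_(x in @cube R t T k) (tensor j x * tensor j' x) = (j == j')%:R.
Proof.
rewrite (@eq_Rintegral _ _ _ _ _
    (fun x : Tup k => \prod_(l < k) (phi (j l) (tnth x l) * phi (j' l) (tnth x l)))); last first.
  by move=> x _; rewrite big_split.
rewrite (cube_product_integral tT (g := fun l y => phi (j l) y * phi (j' l) y)); last first.
  by move=> l; apply: bmeasM; exact: phi_bmeas.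
under eq_bigr do rewrite phi_ortho.
have [->|jj'] := eqVneq j j'; first by rewrite big1// => l _; rewrite eqxx.
have [l lj] : exists l, j l != j' l.
  apply/existsP; rewrite -negb_forall; apply: contra jj' => /forallP H.
  by apply/eqP/ffunP => l; exact/eqP/H.
by rewrite (bigD1 l)//= val_eqE (negbTE lj) mul0r.
Qed.

(** Integrals of products factor, and so does the sum of the squared coefficients. *)
Lemma tensor_residualE p (g : 'I_k -> measurableTypeR R -> R) :
  (forall l, bmeas seg (g l)) ->
  tensor_residual p (fun x => \prod_(l < k) g l (tnth x l)) =
  \prod_(l < k) \int[mu]_(y in seg) (g l y ^+ 2) -
  \prod_(l < k) \sum_(a < (p l).+1) seg_coef (g l) a ^+ 2.
Proof.
move=> bg; rewrite /residual; congr (_ - _).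
  rewrite -cube_product_integral//; last by move=> l; exact: bmeasX.
  by apply: eq_Rintegral => x _; rewrite prodrXl.
rewrite -(sum_dffun p (fun l a => seg_coef (g l) a ^+ 2)).
apply: eq_bigr => j _; rewrite /coef prodrXl; congr (_ ^+ 2).
rewrite -(cube_product_integral tT (g := fun l y => g l y * phi (j l) y)).
  by apply: eq_Rintegral => x _; rewrite big_split.
by move=> l; apply: bmeasM => //; exact: phi_bmeas.
Qed.

(** The two products have factors that are close to each other by Parseval. *)
Lemma tensor_small (g : 'I_k -> measurableTypeR R -> R) e :
  (forall l, bmeas seg (g l)) -> 0 < e ->
  exists p0, forall p : 'I_k -> nat, (forall l, (p0 <= p l)%N) ->
    tensor_residual p (fun x => \prod_(l < k) g l (tnth x l)) <= e.
Proof.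
move=> bg e0.
pose a l := \int[mu]_(y in seg) (g l y ^+ 2).
have a0 l : 0 <= a l by apply: Rintegral_ge0 => y _; exact: sqr_ge0.
pose A := 1 + \sum_l a l.
have A1 : 1 <= A by rewrite lerDl sumr_ge0.
have B0 : 0 <= k%:R * A ^+ k by rewrite mulr_ge0// exprn_ge0// (le_trans _ A1).
pose e1 := e / (k%:R * A ^+ k + 1).
have e10 : 0 < e1 by rewrite divr_gt0// ltr_wpDl.
pose q l := projT1 (cid (parseval (bg l) e10)).
exists (\max_l q l)%N => p pq; rewrite tensor_residualE//.
have := @prod_gap R k a (fun l => \sum_(c < (p l).+1) seg_coef (g l) c ^+ 2) A e1 A1 (ltW e10).
have ot m (j j' : 'I_m.+1) : \int[mu]_(x in seg) (phi j x * phi j' x) = (j == j')%:R.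
  by rewrite phi_ortho.
have h1 l : 0 <= \sum_(c < (p l).+1) seg_coef (g l) c ^+ 2 <= a l.
  rewrite sumr_ge0 /=; last by move=> c _; exact: sqr_ge0.
  rewrite -subr_ge0; exact: (residual_ge0 mseg (lebesgue_segment_lty tT)
    (u := fun b : 'I_(p l).+1 => phi b) (fun j => phi_bmeas _) (ot _) (bg l)).
have h2 l : a l <= A.
  by rewrite /A (bigD1 l)//= addrCA lerDl addr_ge0// sumr_ge0.
have h3 l : a l - \sum_(c < (p l).+1) seg_coef (g l) c ^+ 2 <= e1.
  apply: (projT2 (cid (parseval (bg l) e10))); apply: leq_trans (pq l).
  exact: (leq_bigmax l).
move=> /(_ h1 h2 h3) /le_trans; apply.
have -> : k%:R * (e1 * A ^+ k) = e * (k%:R * A ^+ k / (k%:R * A ^+ k + 1)).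
  by rewrite /e1; ring.
by rewrite ger_pMr// ler_pdivrMr ?mul1r ?lerDl// ltr_wpDl.
Qed.

(** A step approximation of Phi is a finite sum of products of cell indicators. *)
Lemma residual_small (Phi : Tup k -> R) e : regular t T Phi -> 0 < e ->
  exists p0, forall p : 'I_k -> nat, (forall l, (p0 <= p l)%N) ->
    tensor_residual p Phi <= e.
Proof.
move=> rPhi e0; have [bPhi _] := rPhi; have [_ [C C0 HC]] := bPhi.
have mc := @measurable_cube R t T k.
have e40 : 0 < e / 4 by rewrite divr_gt0.
have [N [sg [part L2]]] := step_L2 tT rPhi e40.
pose I := {ffun 'I_k -> 'I_N}.
pose B := #|I|%:R * (#|I|%:R * C ^+ 2) : R.
have B0 : 0 <= B by rewrite !mulr_ge0// sqr_ge0.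
have e10 : 0 < e / 4 / (B + 1) by rewrite !divr_gt0// ltr_wpDl.
have bcl (l : I) r := @cell_bmeas R t T sg (l r).
pose q (l : I) := projT1 (cid (tensor_small (bcl l) e10)).
exists (\max_(l : I) q l)%N => p pq.
pose S := step_approx N sg Phi.
have bS : bmeas (@cube R t T k) S by exact: bmeas_step.
have bPS : bmeas (@cube R t T k) (fun x => Phi x - S x) by exact: bmeasB.
have -> : Phi = fun x => S x + (Phi x - S x) by apply/funext => x; rewrite addrC subrK.
have fin := lebesgue_cube_lty tT k.
apply: le_trans (residualD mc fin (@tensor_bmeas p) (@tensor_ortho p) bS bPS) _.
have h1 : tensor_residual p (fun x => Phi x - S x) <= e / 4.
  by apply: le_trans (residual_le_norm _ _ _ _) L2.
suff h2 : tensor_residual p S <= e / 4 by lra.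
apply: le_trans (residual_sum mc fin (@tensor_bmeas p) (@tensor_ortho p) _) _.
  by move=> l; apply: bmeasZ; exact: bmeas_cells.
apply: (@le_trans _ _ (#|I|%:R * \sum_(l : I) (C ^+ 2 * (e / 4 / (B + 1))))).
  apply: ler_wpM2l => //; apply: ler_sum => l _.
  rewrite residualZ//; [|exact: tensor_bmeas|exact: bmeas_cells].
  apply: ler_pM; first exact: sqr_ge0.
  - by apply: residual_ge0 => //; [exact: tensor_bmeas|exact: tensor_ortho|exact: bmeas_cells].
  - rewrite -(real_normK (num_real _)) lerXn2r ?nnegrE// HC//; exact: node_cube.
  apply: (projT2 (cid (tensor_small (bcl l) e10))) => r; apply: leq_trans (pq r).
  exact: (leq_bigmax l).
rewrite sumr_const -[X in _ * X <= _]mulr_natr.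
have -> : #|I|%:R * (C ^+ 2 * (e / 4 / (B + 1)) * #|I|%:R) = e / 4 * (B / (B + 1)).
  by rewrite /B; ring.
by rewrite ger_pMr// ler_pdivrMr ?mul1r ?lerDl// ltr_wpDl.
Qed.

End tensor.
End parseval.

(** * The moments of the approximation error *)

Section error.
Context (R : realType) d (Omega : measurableType d) (P : probability Omega R).
Variables (t T : R) (F : R -> set_system Omega) (m : nat) (f : 'I_m -> R -> Omega -> R).
Hypothesis hF : filtration T F.
Hypothesis hW : wiener P T F f.
Hypothesis t0 : 0 <= t.
Hypothesis tT : t < T.
Variable tau : nat -> nat -> R.
Hypothesis ptau : forall N, (0 < N)%N -> partition_of t T N (tau N).
Hypothesis mesh : \big[Num.max/0]_(a < N) (tau N a.+1 - tau N a) @[N --> \oo] --> (0 : R).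
Variables (k0 n : nat).
Local Notation k := k0.+1.
Variables (i : 'I_k -> 'I_m) (psi : 'I_k -> R -> R) (phi : nat -> R -> R).
Variables (J : Omega -> R) (zeta : nat -> 'I_m -> Omega -> R).
Hypothesis n0 : (0 < n)%N.
Hypothesis cpsi : forall l, {within `[t, T], continuous (psi l)}.
Hypothesis cphi : forall j, {within `[t, T], continuous (phi j)}.
Hypothesis complete : complete_orthonormal t T phi.
Hypothesis itoJ : is_iterated_ito P F f t T i psi J.
Hypothesis itozeta : forall j a, is_ito P F (f a) t T (fun s _ => phi j s) (zeta j a).
Variable D : ('I_k -> nat) -> Omega -> R.
Hypothesis limD : forall j, lim_ms P (sumG f i phi tau j) (D j).
Local Notation Tup := (k.-tuple (measurableTypeR R)).
Local Notation rint X := (P.-integrable setT (EFin \o X)).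
Local Notation E X := (\int[P]_w X w).

Section truncation.
Variable p : 'I_k -> nat.
Local Notation idx := {dffun forall l : 'I_k, 'I_(p l).+1}.
Local Notation val j := (fun l : 'I_k => nat_of_ord (j l)).

Definition kernel_error (x : Tup) : R :=
  Defs.kernel psi x - \sum_(j : idx) fourier_coef t T psi phi (val j) * tensor phi j x.

Lemma regular_kernel_error : regular t T kernel_error.
Proof.
have -> : kernel_error = fun x => Defs.kernel psi x + -1 * \sum_(j : idx)
    fourier_coef t T psi phi (val j) * tensor phi j x.
  by apply/funext => x; rewrite mulN1r.
apply: regularD; first exact: regular_kernel.
apply: regularM; first exact: regular_cst.
apply: regular_sum => j; apply: regularM; first exact: regular_cst.
by apply: regular_prod => l; apply: regular_coord; exact: cphi.
Qed.

(** The residual of a function is the squared norm of its approximation error. *)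
Lemma kernel_error_integral :
  \int[lebesgue_tuple R k]_(x in @cube R t T k) (kernel_error x ^+ 2) =
  fourier_residual t T psi phi p.
Proof.
have mc := @measurable_cube R t T k.
have [bK _] := regular_kernel cpsi.
by rewrite -(residualE mc (lebesgue_cube_lty tT k) (tensor_bmeas cphi (p := p))
  (tensor_ortho tT cphi complete (p := p)) bK).
Qed.

Lemma fourier_residual_ge0 : 0 <= fourier_residual t T psi phi p.
Proof. by rewrite -kernel_error_integral; apply: Rintegral_ge0 => x _; exact: sqr_ge0. Qed.

Definition error_sum N (w : Omega) : R :=
  multiple_sum f i N (tau N)
    (fun x => kernel_error [tuple tau N (x r) | r < k]) w.

Lemma iterated_msconv : msconv P (fun N => grid_iterated f (fun q => psi (inord q))
  (fun q => i (inord q)) N (tau N) k T) J.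
Proof.
have [Y [Y0 HY ->]] := itoJ.
apply: (grid_iterated_msconv hF hW t0 tT ptau mesh) => [l||].
- exact: cpsi.
- apply: (approx_iterated_ito hF hW t0) => // l s lk sT.
  by have := HY (inord l) s sT; rewrite inordK.
have [|_ [q [s [h [_ _ _ []]]]]] := HY ord_max T; first by rewrite lexx ltW.
by [].
Qed.

Lemma error_sumE N w : (0 < N)%N -> error_sum N w =
  grid_iterated f (fun q => psi (inord q)) (fun q => i (inord q)) N (tau N) k T w -
  \sum_(j : idx) fourier_coef t T psi phi (val j) * off_diagonal f tau i phi (val j) N w.
Proof.
move=> N0; rewrite -(multiple_sum_kernel _ _ (ptau N0)).
rewrite /error_sum /off_diagonal /multiple_sum.
under [X in _ = _ - X]eq_bigr do rewrite mulr_sumr.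
rewrite exchange_big /= -sumrB; apply: eq_bigr => l _.
rewrite /kernel_error mulrBl /Defs.kernel; congr (_ * _ - _).
  congr (if _ then _ else _); last by apply: eq_bigr => r _; rewrite tnth_mktuple.
  by apply: eq_forallb => r; apply: eq_forallb => r'; rewrite !tnth_mktuple.
rewrite mulr_suml; apply: eq_bigr => j _; rewrite mulrA; congr (_ * _ * _).
by apply: eq_bigr => r _; rewrite tnth_mktuple.
Qed.

Lemma error_msconv : msconv P error_sum
  (fun w => J w - J_approx t T i psi phi zeta D p w).
Proof.
have h (j : idx) := msconvZ (fourier_coef t T psi phi (val j))
  (off_diagonal_msconv hF hW t0 tT ptau mesh cphi itozeta (limD (val j))).
apply: (eq_msconv (N1 := 1%N) _ (msconvB iterated_msconv (msconv_sum (index_enum _) h))).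
by move=> N N1; apply/funext => w; rewrite error_sumE.
Qed.

Lemma error_sum_allmom N : allmom P (error_sum N).
Proof.
case: N => [|N]; last exact: (multiple_sum_allmom hF hW t0 i (ptau (ltn0Sn N))).
have e w : error_sum 0 w = 0.
  rewrite /error_sum /multiple_sum big1// => l _.
  by have := ltn_ord (l ord0); rewrite ltn0.
by rewrite (funext e); exact: allmom_cst.
Qed.

(** The sum over distinct indices is part of the Riemann sum over all of them, with
nonnegative terms. *)
Lemma error_grid_norm e : 0 < e -> exists N0, forall N, (N0 <= N)%N -> (0 < N)%N /\
  grid_norm N (tau N) (fun x => kernel_error [tuple tau N (x r) | r < k]) <=
  fourier_residual t T psi phi p + e.
Proof.
move=> e0; have reg := regularM regular_kernel_error regular_kernel_error.
have [dlt d0 H] := riemann_sum_limit tT reg e0.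
have [N0 HN] := eventually_fine ptau mesh d0; exists N0 => N /HN[N1 fine]; split => //.
have [part _] := fine; have [_ _ lt] := part.
rewrite -kernel_error_integral; apply: le_trans (H N _ fine).
rewrite /grid_norm /riemann_sum.
rewrite [leRHS](bigID (mem (idxL k N))) /=; apply: ler_wpDr.
  apply: sumr_ge0 => l _; rewrite mulr_ge0 ?sqr_ge0// prodr_ge0// => r _.
  by rewrite subr_ge0 ltW// lt.
by [].
Qed.

(** For every slack e the grid bound holds eventually with the residual enlarged by
e; the slack disappears because the power is continuous. *)
Lemma error_moment :
  rint (fun w => (J w - J_approx t T i psi phi zeta D p w) ^+ (2 * n)) /\
  E (fun w => (J w - J_approx t T i psi phi zeta D p w) ^+ (2 * n)) <=
  (k`!)%:R ^+ n * (2 * n - 1)%:R ^+ (n * k) * fourier_residual t T psi phi p ^+ n.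
Proof.
pose c : R := (k`!)%:R ^+ n * (2 * n - 1)%:R ^+ (n * k).
have c0 : 0 < c.
  rewrite /c mulr_gt0// exprn_gt0// ltr0n ?fact_gt0// subn_gt0.
  by case: n n0 => // n' _; rewrite mulnS.
have H e : 0 < e -> rint (fun w => (J w - J_approx t T i psi phi zeta D p w) ^+ (2 * n)) /\
    E (fun w => (J w - J_approx t T i psi phi zeta D p w) ^+ (2 * n)) <=
    c * (fourier_residual t T psi phi p + e) ^+ n.
  move=> e0; apply: (moment_msconv n0 error_msconv error_sum_allmom) => e' e'0.
  have [N0 HN] := error_grid_norm e0; exists N0 => N /HN[N1 gle].
  apply: le_trans (multiple_sum_moment hF hW t0 i (ptau N1) n _) _.
  apply: ler_wpDr; first exact: ltW.
  rewrite ler_wpM2l ?(ltW c0)// lerXn2r// nnegrE.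
    rewrite /grid_norm sumr_ge0// => l _; rewrite mulr_ge0 ?sqr_ge0// prodr_ge0// => r _.
    by have [_ _ lt] := ptau N1; rewrite subr_ge0 ltW// lt.
  by rewrite addr_ge0 ?fourier_residual_ge0// ltW.
split; first exact: (H 1 ltr01).1.
rewrite mulrC -ler_pdivrMr//; apply: expr_limit; first exact: fourier_residual_ge0.
by move=> e e0; rewrite ler_pdivrMr// mulrC; exact: (H e e0).2.
Qed.
End truncation.

Lemma error_small e : 0 < e -> exists p0, forall p : 'I_k -> nat, (forall l, (p0 <= p l)%N) ->
  (k`!)%:R ^+ n * (2 * n - 1)%:R ^+ (n * k) * fourier_residual t T psi phi p ^+ n < e.
Proof.
move=> e0; pose c : R := (k`!)%:R ^+ n * (2 * n - 1)%:R ^+ (n * k).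
have c0 : 0 <= c by rewrite /c mulr_ge0// exprn_ge0.
pose x := Num.min 1 (e / (c + 1) / 2).
have x0 : 0 < x by rewrite lt_min ltr01 !divr_gt0// ltr_wpDl.
have [p0 Hp0] := residual_small tT cphi complete (regular_kernel cpsi) x0.
exists p0 => p /Hp0 Hp; rewrite -/c.
have r0 := fourier_residual_ge0 p.
have rx : fourier_residual t T psi phi p <= x := Hp.
apply: (@le_lt_trans _ _ (c * x)).
  apply: ler_wpM2l => //; apply: le_trans (rx).
  case: n n0 => // n' _; rewrite exprS ler_piMr// exprn_ile1//.
  by apply: le_trans rx _; rewrite /x ge_min lexx.
apply: (@le_lt_trans _ _ (c * (e / (c + 1) / 2))).
  by apply: ler_wpM2l => //; rewrite /x ge_min lexx orbT.
have c1 : 0 < c + 1 by rewrite ltr_wpDl.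
rewrite mulrA ltr_pdivrMr// mulrA ltr_pdivrMr// (mulrC c) -mulrA ltr_pM2l//.
by rewrite mulrDr mulr1; lra.
Qed.
End error.

Theorem mainTheorem5 (R : realType) (d : measure_display)
    (Omega : measurableType d) (P : probability Omega R)
    (t T : R) (F : R -> set_system Omega)
    (m : nat) (f : 'I_m -> R -> Omega -> R) (tau : nat -> nat -> R)
    (k n : nat) (i : 'I_k -> 'I_m)
    (psi : 'I_k -> R -> R) (phi : nat -> R -> R)
    (J : Omega -> R) (zeta : nat -> 'I_m -> Omega -> R) :
  0 <= t -> t < T ->
  measure_is_complete P -> filtration T F -> wiener P T F f ->
  (forall N, (0 < N)%N -> partition_of t T N (tau N)) ->
  \big[Num.max/0]_(a < N) (tau N a.+1 - tau N a) @[N --> \oo] --> (0 : R) ->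
  (0 < k)%N -> (0 < n)%N ->
  (forall l, {within `[t, T], continuous (psi l)}) ->
  (forall j, {within `[t, T], continuous (phi j)}) ->
  complete_orthonormal t T phi ->
  is_iterated_ito P F f t T i psi J ->
  (forall j a, is_ito P F (f a) t T (fun s _ => phi j s) (zeta j a)) ->
  (forall j : 'I_k -> nat,
     exists D : Omega -> R, lim_ms P (sumG f i phi tau j) D) /\
  (forall D : ('I_k -> nat) -> Omega -> R,
     (forall j, lim_ms P (sumG f i phi tau j) (D j)) ->
     (forall p : 'I_k -> nat,
        ('E_P[fun w => ((J w - J_approx t T i psi phi zeta D p w) ^+ (2 * n))%R]
         <= ((k`!)%:R ^+ n * (2 * n - 1)%:R ^+ (n * k) *
             fourier_residual t T psi phi p ^+ n)%:E)%E) /\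
     (forall e : R, 0 < e -> exists p0 : nat,
        forall p : 'I_k -> nat, (forall l, (p0 <= p l)%N) ->
        ('E_P[fun w => ((J w - J_approx t T i psi phi zeta D p w) ^+ (2 * n))%R]
         < e%:E)%E)).
Proof.
move=> t0 tT _ hF hW ptau mesh.
case: k i psi => // k0 i psi _ n0 cpsi cphi complete itoJ itozeta.
split; first by move=> j; exact: (sumG_limit hF hW t0 tT ptau mesh i cphi itozeta).
move=> D limD; have bound p :
    ('E_P[fun w => ((J w - J_approx t T i psi phi zeta D p w) ^+ (2 * n))%R]
     <= ((k0.+1`!)%:R ^+ n * (2 * n - 1)%:R ^+ (n * k0.+1) *
         fourier_residual t T psi phi p ^+ n)%:E)%E.
  have [ie le] := error_moment hF hW t0 tT ptau mesh n0 cpsi cphi complete itoJ itozeta limD p.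
  by rewrite expectationE ?lee_fin.
split=> // e e0.
have [p0 H] := error_small tT n0 cpsi cphi complete e0.
by exists p0 => p /H lt; apply: le_lt_trans (bound p) _; rewrite lte_fin.
Qed.
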